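(* Fix $\alpha\in(0,1)$. Let $d=d_n$ be an arbitrary sequence of positive integers, and let $m_1=m_1(n)$, $m_2=n-m_1$ be positive integers with $\kappa_\ast\le m_1/n\le\kappa^\ast$ for some constants $0<\kappa_\ast\le\kappa^\ast<1$. Suppose that $\epsilon_n\ge K_n\sqrt{d/n}$, where $K_n$ is a positive sequence increasing to infinity as $n\to\infty$ at any rate. Then $$\lim_{n\to\infty}\mathbb{E}_{P_0}[\phi_{\mathrm{cov}}]=\alpha\quad\text{and}\quad\lim_{n\to\infty}\sup_{P\in\mathcal{Q}_{\mathrm{cov},d}(\epsilon_n)}\mathbb{E}_P[1-\phi_{\mathrm{cov}}]=0 .$$ In particular, $p_n=1-\Phi(T_{\mathrm{cov}})$ is a dimension-agnostic $p$-value, i.e. $\limsup_{n\to\infty}P_0(p_n\le a)\le a$ for any $a\in[0,1]$, regardless of the sequence $(d_n)_{n\ge1}$.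
   Context: $\Phi$ is the cumulative distribution function of $N(0,1)$, $z_\beta$ its $\beta$-quantile, and $\|\cdot\|_F$ the Frobenius norm. $X_1,\dots,X_n$ are i.i.d. from $P$ on $\mathbb{R}^d$; $P_0=N(0,I)$ on $\mathbb{R}^d$; and $$\mathcal{Q}_{\mathrm{cov},d}(\epsilon_n)=\{P=N(0,\Sigma):\ \|\Sigma-I\|_F\ge\epsilon_n\},$$ with $\Sigma$ a ($d\times d$, positive definite) covariance matrix. Let $$f_{\mathrm{cov}}(x)=\frac1{m_2}\sum_{j=m_1+1}^{n}\mathrm{tr}\bigl\{(xx^\top-I)(X_jX_j^\top-I)\bigr\},\qquad \overline f_{\mathrm{cov}}=\frac1{m_1}\sum_{i=1}^{m_1}f_{\mathrm{cov}}(X_i),$$ $$T_{\mathrm{cov}}=\frac{\sqrt{m_1}\,\overline f_{\mathrm{cov}}}{\sqrt{m_1^{-1}\sum_{i=1}^{m_1}\{f_{\mathrm{cov}}(X_i)-\overline f_{\mathrm{cov}}\}^2}},$$ and $\phi_{\mathrm{cov}}=\mathbf 1(T_{\mathrm{cov}}>z_{1-\alpha})$. *)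

(* Defs.v *)
From HB Require Import structures.
From mathcomp Require Import all_boot all_order all_algebra.
From mathcomp Require Import all_classical all_reals all_analysis.
Import Order.TTheory GRing.Theory Num.Theory.
Import numFieldNormedType.Exports.

Set Implicit Arguments.
Unset Strict Implicit.
Unset Printing Implicit Defensive.

Local Open Scope classical_set_scope.
Local Open Scope ring_scope.

Section iid_law.
Context {d : measure_display} {T : measurableType d} {R : realType}.

Definition pair_cons n (p : T * n.-tuple T) : n.+1.-tuple T :=
  [the n.+1.-tuple T of p.1 :: p.2].

Lemma measurable_pair_cons n : measurable_fun [set: T * n.-tuple T] (@pair_cons n).
Proof. exact: measurable_cons. Qed.

HB.instance Definition _ n :=
  isMeasurableFun.Build _ _ _ _ (@pair_cons n) (@measurable_pair_cons n).

(* The product law of P with itself, n times: under [iid_law P n] the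
   coordinates [tnth X i] of the sample [X] are i.i.d. from [P]. *)
Fixpoint iid_law (P : probability T R) (n : nat) : probability (n.-tuple T) R :=
  match n return probability (n.-tuple T) R with
  | 0 => \d_([tuple] : 0.-tuple T)
  | n'.+1 => distribution (P \x iid_law P n')%E (@pair_cons n')
  end.

Lemma iid_law_box (P : probability T R) n (B : 'I_n -> set T) :
  (forall i, measurable (B i)) ->
  (iid_law P n [set X | forall i, B i (tnth X i)] = \prod_(i < n) P (B i))%E.
Proof.
elim: n B => [|n IHn] B mB /=.
  by rewrite big_ord0 diracE mem_set// => -[].
have mBt (m : nat) (C : 'I_m -> set T) : (forall i, measurable (C i)) ->
    measurable [set X : m.-tuple T | forall i, C i (tnth X i)].
  move=> mC; rewrite (_ : [set _ | _] =
      \bigcap_(i in [set: 'I_m]) ((@tnth m T)^~ i @^-1` C i)); last first.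
    by apply/seteqP; split=> X /= h i; [move=> _; exact: h|exact: (h i Logic.I)].
  apply: fin_bigcap_measurable => [|i _]; first exact: finite_finset.
  by rewrite -[X in measurable X]setTI; apply: measurable_tnth.
rewrite /distribution /pushforward big_ord_recl -IHn//.
have mBS := mBt _ _ (fun i => mB (lift ord0 i)).
rewrite -[RHS](product_measure1E P (iid_law P n) (mB ord0) mBS).
congr (_ _); apply/seteqP; split=> -[x X] /=.
  by move=> h; split=> [|i]; [exact: (h ord0)|have := h (lift ord0 i); rewrite tnthS].
by move=> [h0 h] i; case: (unliftP ord0 i) => [j ->|->//]; rewrite tnthS; exact: h.
Qed.

End iid_law.

(* R^d as a measurable space: the sigma-algebra on tuples is the product of the
   Borel sigma-algebras. Matrix algebra is done on the associated column vectors. *)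
Notation Rvec R d := (d.-tuple (measurableTypeR R)).

Section multivariate_normal.
Context {R : realType}.

Definition col_of d (x : Rvec R d) : 'cV[R]_d := \col_i (tnth x i : R).

Definition lin_tuple d (A : 'M[R]_d) (x : Rvec R d) : Rvec R d :=
  [tuple (A *m col_of x) i ord0 | i < d].

Definition std_normal (d : nat) : probability (Rvec R d) R :=
  iid_law (normal_prob 0 1) d.

(* P = N(0, Sigma): P is the law of A Z, for Z with i.i.d. N(0,1) entries and
   A A^T = Sigma (this law only depends on A through A A^T). *)
Definition is_normal0 d (Sigma : 'M[R]_d) (P : probability (Rvec R d) R) :=
  exists2 A : 'M[R]_d, A *m A^T = Sigma &
    forall B, measurable B -> P B = pushforward (std_normal d) (lin_tuple A) B.

Lemma std_normal_is_normal0 d : is_normal0 1%:M (std_normal d).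
Proof.
exists 1%:M => [|B mB]; first by rewrite trmx1 mulmx1.
rewrite /pushforward; congr (_ _); apply/funext => x.
congr (B _); apply: eq_from_tnth => i.
by rewrite tnth_mktuple mul1mx mxE.
Qed.

Definition posdefmx d (S : 'M[R]_d) :=
  S^T = S /\ forall u : 'cV[R]_d, u != 0 -> 0 < (u^T *m S *m u) ord0 ord0.

Definition frobenius_norm d (A : 'M[R]_d) : R :=
  Num.sqrt (\sum_i \sum_j A i j ^+ 2).

Definition Qcov d (eps : R) : set (probability (Rvec R d) R) :=
  [set P | exists Sigma : 'M[R]_d,
    [/\ posdefmx Sigma, is_normal0 Sigma P & eps <= frobenius_norm (Sigma - 1%:M)]].

Definition Phi (x : R) : R := fine (normal_prob (0 : R) 1 `]-oo, x]).

Definition z_quantile (b : R) : R := inf [set x | b <= Phi x].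

End multivariate_normal.

Section covariance_test.
Context {R : realType}.
Variables (n m1 d : nat).
Implicit Types X : n.-tuple (Rvec R d).

Definition cov_dev (x : Rvec R d) : 'M[R]_d := col_of x *m (col_of x)^T - 1%:M.

(* Indices start at 0: the first split is i < m1, the second m1 <= j < n. *)
Definition f_cov X (x : Rvec R d) : R :=
  (n - m1)%:R^-1 *
  \sum_(j < n | (m1 <= j)%N) \tr (cov_dev x *m cov_dev (tnth X j)).

Definition fbar_cov X : R :=
  m1%:R^-1 * \sum_(i < n | (i < m1)%N) f_cov X (tnth X i).

(* x / 0 = 0: T_cov is 0 when the empirical variance vanishes. *)
Definition T_cov X : R :=
  Num.sqrt m1%:R * fbar_cov X /
  Num.sqrt (m1%:R^-1 *
    \sum_(i < n | (i < m1)%N) (f_cov X (tnth X i) - fbar_cov X) ^+ 2).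

Definition phi_cov (alpha : R) X : R := (z_quantile (1 - alpha) < T_cov X)%R%:R.

Definition p_cov X : R := 1 - Phi (T_cov X).

End covariance_test.

(* Main.v *)
Require Import Defs.
From HB Require Import structures.
From mathcomp Require Import all_boot all_order all_algebra.
From mathcomp Require Import all_classical all_reals all_analysis.
From mathcomp Require Import measurable_realfun.
From mathcomp Require Import ring lra.

(** Split the sample into [X] (the first [m1] observations) and [Y] (the others). The
    statistic [f_cov] is linear in the second half: [f_cov x = \tr (cov_dev x *m M)]
    with [M = cov_mean Y]. Given [Y], the statistic [T_cov] is therefore Student's
    statistic of the i.i.d. real variables [\tr (cov_dev X_i *m M)], which are
    quadratic forms of a Gaussian vector ([T_cov_cat], [pr_iid_cat]).

    Null hypothesis. A centred quadratic form of a Gaussian vector satisfies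
    [E q^4 <= 75 (E q^2)^2], with a constant that depends neither on the dimension nor
    on the matrix ([quad_form_moment4]): condition on all coordinates but one, and
    induct. A central limit theorem for Student's statistic that is uniform over all
    laws of bounded kurtosis ([student_clt]) then gives the conditional level up to an
    error independent of [Y] and [d]. It rests on Lindeberg's replacement argument
    applied to a smoothed indicator ([lindeberg_replacement], [clt_upper],
    [clt_lower]) and on the concentration of the empirical variance
    ([evar_concentration]). The only degenerate case is [M = 0], where the trace of
    [M] vanishes as well; this has a small probability, by the same theorem applied to
    the second half ([null_level]).

    Alternative. Let [D = Sigma - 1], [th] its squared Frobenius norm and [V(M)] the
    variance of [\tr (cov_dev x *m M)] under [N(0, Sigma)]. Given [Y], the summands
    have mean [tau = \tr (D *m M)] and variance [V(M)], so Chebyshev's inequality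
    bounds the probability of not rejecting by a multiple of
    [1 / m1 + V(M) / (m1 tau^2)] ([tstat_le_pr]). Over [Y], the signal [tau] has mean
    [th] and variance [V(D) / m2] with [V(D) <= 4 (th + th^2)], while
    [V(M) <= 2 V(D) + 4 |A^T (M - D) A|^2], where [A A^T = Sigma] and the last squared
    norm has mean of order [(d + th)^2 / m2]. Everything is controlled by the ratios
    [(d + th) / (m th)] with [m = m1] or [m2] ([type2_error_rate]). These tend to zero
    because [th >= eps^2 >= K^2 d / n] and both halves have a size of order [n].

    P-value. If [p_cov <= a < b], then [T_cov] exceeds the quantile of order [1 - b];
    hence the upper limit is at most [b], for every [b > a].

    The Gaussian moments behind all this come from the stability of the Gaussian law:
    [(X + Y) / sqrt 2] has the law of [X], which determines each even moment from the
    lower ones ([gaussian_convolution], [gaussian_moment8]); the second one is squeezed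
    by a tangent inequality ([gaussian_moment2]). *)

Import Order.TTheory GRing.Theory Num.Theory.
Import numFieldNormedType.Exports.
Local Open Scope classical_set_scope.
Local Open Scope ring_scope.

Set Implicit Arguments.
Unset Strict Implicit.

(** * Real-valued expectations *)

Section has_mean.
Context {d : measure_display} {T : measurableType d} {R : realType}.
Implicit Types (P : probability T R) (f g : T -> R).

(** A relation rather than a function: a mean in this sense comes with
    integrability, so that the rules of linearity have no side condition. *)
Definition has_mean P f (v : R) :=
  P.-integrable [set: T] (EFin \o f) /\ (\int[P]_x (f x)%:E)%E = v%:E.

Lemma has_mean_measurable P f v : has_mean P f v -> measurable_fun [set: T] f.
Proof. by move=> [/measurable_int mf _]; exact/measurable_EFinP. Qed.

Lemma has_mean_uniq P f v w : has_mean P f v -> has_mean P f w -> v = w.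
Proof. by move=> [_ fv] [_ fw]; apply: EFin_inj; rewrite -fv. Qed.

Lemma has_mean_ext P f g v : f =1 g -> has_mean P f v -> has_mean P g v.
Proof. by move=> /funext ->. Qed.

Lemma has_mean_val P f v w : v = w -> has_mean P f v -> has_mean P f w.
Proof. by move=> ->. Qed.

Lemma has_mean_cst P (k : R) : has_mean P (fun=> k) k.
Proof.
split; first exact: finite_measure_integrable_cst.
by rewrite integral_cst//= probability_setT mule1.
Qed.

Lemma has_meanD P f g v w :
  has_mean P f v -> has_mean P g w -> has_mean P (fun x => f x + g x) (v + w).
Proof.
move=> [fi fv] [gi gw]; split.
  by apply: eq_integrable (integrableD _ fi gi) => // x _; rewrite /= EFinD.
under eq_integral do rewrite EFinD.
by rewrite integralD//= fv gw.
Qed.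

Lemma has_meanZ P f v (k : R) :
  has_mean P f v -> has_mean P (fun x => k * f x) (k * v).
Proof.
move=> [fi fv]; split.
  by apply: eq_integrable (integrableZl _ k fi) => // x _; rewrite /= EFinM.
under eq_integral do rewrite EFinM.
by rewrite integralZl//= fv.
Qed.

Lemma has_meanN P f v : has_mean P f v -> has_mean P (fun x => - f x) (- v).
Proof.
move=> /(has_meanZ (-1)); rewrite mulN1r; apply: has_mean_ext => x.
by rewrite mulN1r.
Qed.

Lemma has_meanB P f g v w :
  has_mean P f v -> has_mean P g w -> has_mean P (fun x => f x - g x) (v - w).
Proof. by move=> fv /has_meanN; exact: has_meanD. Qed.

Lemma has_mean_sum P (I : Type) (s : seq I) (Q : pred I) (f : I -> T -> R)
    (v : I -> R) : (forall i, Q i -> has_mean P (f i) (v i)) ->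
  has_mean P (fun x => \sum_(i <- s | Q i) f i x) (\sum_(i <- s | Q i) v i).
Proof.
move=> fv; elim: s => [|i s IHs].
  rewrite big_nil; apply: has_mean_ext (has_mean_cst P 0) => x.
  by rewrite big_nil.
rewrite big_cons; case: (boolP (Q i)) => Qi.
  apply: has_mean_ext (has_meanD (fv _ Qi) IHs) => x.
  by rewrite big_cons Qi.
by apply: has_mean_ext IHs => x; rewrite big_cons (negbTE Qi).
Qed.

Lemma has_mean_le P f g v w : has_mean P f v -> has_mean P g w ->
  (forall x, f x <= g x) -> v <= w.
Proof.
move=> [fi fv] [gi gw] fg; rewrite -lee_fin -fv -gw.
by apply: le_integral => // x _; rewrite lee_fin.
Qed.

Lemma has_mean_ge0_integral P f v : measurable_fun [set: T] f ->
  (forall x, 0 <= f x) -> (\int[P]_x (f x)%:E = v%:E)%E -> has_mean P f v.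
Proof.
move=> mf f0 fv; split=> //; apply/integrableP; split.
  exact/measurable_EFinP.
under eq_integral do rewrite /= ger0_norm//.
by rewrite fv ltry.
Qed.

(** Integrability is obtained by exhibiting a dominating function whose mean is
    already known, so that no absolute moment has to be computed. *)
Lemma has_mean_dom P f g w : measurable_fun [set: T] f ->
  (forall x, `|f x| <= g x) -> has_mean P g w -> exists v, has_mean P f v.
Proof.
move=> mf fg [gi gw]; exists (fine (\int[P]_x (f x)%:E)%E).
have fi : P.-integrable [set: T] (EFin \o f).
  apply: le_integrable gi => //; first exact/measurable_EFinP.
  by move=> x _; rewrite /= lee_fin (le_trans (fg x))// ler_norm.
split=> //; rewrite fineK//; exact: integrable_fin_num.
Qed.

Lemma has_mean_bounded P f (C : R) : measurable_fun [set: T] f ->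
  (forall x, `|f x| <= C) -> exists v, has_mean P f v.
Proof. by move=> mf fC; exact: has_mean_dom mf fC (has_mean_cst P C). Qed.

Definition pr P (A : set T) : R := fine (P A).

Lemma prE P A : measurable A -> P A = (pr P A)%:E.
Proof. by move=> mA; rewrite fineK// fin_num_measure. Qed.

Lemma has_mean_indic P A : measurable A -> has_mean P (\1_A) (pr P A).
Proof.
move=> mA; apply: has_mean_ge0_integral => //.
by rewrite integral_indic//= setIT -prE.
Qed.

Lemma pr_ge0 P A : 0 <= pr P A.
Proof. by rewrite fine_ge0. Qed.

Lemma pr_le1 P A : measurable A -> pr P A <= 1.
Proof. by move=> mA; rewrite -lee_fin -prE// probability_le1. Qed.

Lemma le_pr P A B : measurable A -> measurable B -> A `<=` B ->
  pr P A <= pr P B.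
Proof.
move=> mA mB AB; apply: has_mean_le (has_mean_indic P mA) (has_mean_indic P mB) _ => x.
rewrite !indicE ler_nat; case: (boolP (x \in A)) => //.
by rewrite inE => /AB /mem_set ->.
Qed.

Lemma prC P A : measurable A -> pr P (~` A) = 1 - pr P A.
Proof.
move=> mA; have mC : measurable (~` A) by exact: measurableC.
apply: has_mean_uniq (has_mean_indic P mC) _.
apply: has_mean_ext (has_meanB (has_mean_cst P 1) (has_mean_indic P mA)) => x.
by rewrite !indicE in_setC; case: (x \in A); rewrite ?subrr ?subr0.
Qed.

(** Markov's inequality. With [g] a sum of indicators and of squares divided by
    squared thresholds, it performs a union bound and several Chebyshev bounds at
    once. *)
Lemma pr_le_mean P A g w : measurable A -> has_mean P g w ->
  (forall x, 0 <= g x) -> (forall x, A x -> 1 <= g x) -> pr P A <= w.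
Proof.
move=> mA gw g0 Ag; apply: has_mean_le (has_mean_indic P mA) gw _ => x.
rewrite indicE; case: (boolP (x \in A)) => //.
by rewrite inE => /Ag.
Qed.

Lemma indic_bool (p : T -> bool) x : \1_[set z | p z] x = if p x then 1 else 0 :> R.
Proof.
rewrite indicE (_ : (x \in _) = p x); first by case: ifP.
by apply/idP/idP; rewrite inE.
Qed.

Lemma expectation_has_mean P f v : has_mean P f v -> ('E_P[f] = v%:E)%E.
Proof. by move=> [_ fv]; rewrite unlock. Qed.

End has_mean.

(** * Integration against the product law *)

Section iid_calculus.
Context {d : measure_display} {T : measurableType d} {R : realType}.
Variable P : probability T R.
Implicit Types (n m k : nat).

Lemma ge0_integral_iid_lawS n (F : n.+1.-tuple T -> R) :
  measurable_fun [set: n.+1.-tuple T] F -> (forall X, 0 <= F X) ->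
  (\int[iid_law P n.+1]_X (F X)%:E =
   \int[(P \x iid_law P n)%E]_p (F (pair_cons p))%:E)%E.
Proof.
move=> mF F0 /=; rewrite /distribution.
rewrite (ge0_integral_pushforward (@measurable_pair_cons _ T n))//.
- exact/measurable_EFinP.
- by move=> X _; rewrite lee_fin.
Qed.

Let measurable_F n (F : n.+1.-tuple T -> R) :
  measurable_fun [set: n.+1.-tuple T] F ->
  measurable_fun [set: T * n.-tuple T] (fun p => (F (pair_cons p))%:E).
Proof.
move=> mF; apply/measurable_EFinP; exact: measurableT_comp.
Qed.

(** Conditioning on the first observation: the form used by an induction that
    exchanges or removes the others first. *)
Lemma has_mean_iid_lawSl n (F : n.+1.-tuple T -> R) (G : T -> R) v :
  measurable_fun [set: n.+1.-tuple T] F -> (forall X, 0 <= F X) ->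
  (forall x, has_mean (iid_law P n) (fun X => F (cons_tuple x X)) (G x)) ->
  has_mean P G v -> has_mean (iid_law P n.+1) F v.
Proof.
move=> mF F0 FG [_ Gv]; apply: has_mean_ge0_integral => //.
rewrite ge0_integral_iid_lawS// fubini_tonelli1/=; last 2 first.
- exact: measurable_F.
- by move=> p; rewrite lee_fin.
rewrite -Gv; apply: eq_integral => x _; rewrite /fubini_F.
by have [_ <-] := FG x.
Qed.

(** Conditioning on all observations but the first: the form used by the moment
    recursions, where a polynomial in a single variable is integrated explicitly. *)
Lemma has_mean_iid_lawSr n (F : n.+1.-tuple T -> R) (G : n.-tuple T -> R) v :
  measurable_fun [set: n.+1.-tuple T] F -> (forall X, 0 <= F X) ->
  (forall X, has_mean P (fun x => F (cons_tuple x X)) (G X)) ->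
  has_mean (iid_law P n) G v -> has_mean (iid_law P n.+1) F v.
Proof.
move=> mF F0 FG [_ Gv]; apply: has_mean_ge0_integral => //.
rewrite ge0_integral_iid_lawS// fubini_tonelli2/=; last 2 first.
- exact: measurable_F.
- by move=> p; rewrite lee_fin.
rewrite -Gv; apply: eq_integral => x _; rewrite /fubini_G.
by have [_ <-] := FG x.
Qed.

Lemma measurable_coord n (i : 'I_n) (y : T -> R) : measurable_fun [set: T] y ->
  measurable_fun [set: n.-tuple T] (fun X => y (tnth X i)).
Proof. by move=> my; apply: measurableT_comp => //; exact: measurable_tnth. Qed.

Lemma measurable_coord_sum n (y : T -> R) : measurable_fun [set: T] y ->
  measurable_fun [set: n.-tuple T] (fun X => \sum_(i < n) y (tnth X i)).
Proof. by move=> my; apply: measurable_sum => i; exact: measurable_coord. Qed.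

Lemma has_mean_iid_coord n (i : 'I_n) (y : T -> R) v :
  has_mean P y v -> has_mean (iid_law P n) (fun X => y (tnth X i)) v.
Proof.
move=> yv; have my := has_mean_measurable yv.
have mt : measurable_fun [set: n.-tuple T] (fun X => tnth X i).
  exact: measurable_tnth.
have law A : measurable A ->
    pushforward (iid_law P n) (fun X => tnth X i) A = P A.
  move=> mA; rewrite /pushforward.
  pose B j := if j == i then A else setT.
  have mB j : measurable (B j) by rewrite /B; case: ifP.
  transitivity (iid_law P n [set X | forall j, B j (tnth X j)]).
    congr (_ _); apply/seteqP; split=> X /=.
      by move=> AX j; rewrite /B; case: eqP => // ->.
    by move=> /(_ i); rewrite /B eqxx.
  rewrite iid_law_box// (bigD1 i)//= big1 ?mule1; first by rewrite /B eqxx.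
  by move=> j /negPf ji; rewrite /B ji probability_setT.
have intE (f : T -> R) : measurable_fun [set: T] f -> (forall x, 0 <= f x) ->
    (\int[iid_law P n]_X (f (tnth X i))%:E = \int[P]_x (f x)%:E)%E.
  move=> mf f0.
  rewrite -(@ge0_integral_pushforward _ _ _ _ _ _ mt (iid_law P n)
    [set: T] (EFin \o f))//; last 2 first.
  - exact/measurable_EFinP.
  - by move=> x _; rewrite lee_fin.
  by refine (eq_measure_integral P _) => A mA _; exact: law.
have [yi yE] := yv.
have yi' : (iid_law P n).-integrable setT (EFin \o (fun X => y (tnth X i))).
  apply/integrableP; split; first by apply/measurable_EFinP; exact: measurable_coord.
  rewrite (intE (fun x => `|y x|))//; last exact: measurableT_comp.
  by move/integrableP : yi => [].
split=> //.
rewrite -(@integral_pushforward _ _ _ _ _ _ mt (iid_law P n)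
   setT (EFin \o y)) //.
- by rewrite -yE; refine (eq_measure_integral P _) => A mA _; exact: law.
- exact/measurable_EFinP.
Unshelve. all: exact: mt.
Qed.

Lemma has_mean_iid_sum n (y : T -> R) v : has_mean P y v ->
  has_mean (iid_law P n) (fun X => \sum_(i < n) y (tnth X i)) (n%:R * v).
Proof.
move=> yv; rewrite mulr_natl -[n in v *+ n]card_ord -sumr_const.
by apply: has_mean_sum => i _; exact: has_mean_iid_coord.
Qed.

Lemma sum_tnth_cons n (y : T -> R) x (X : n.-tuple T) :
  \sum_(i < n.+1) y (tnth (cons_tuple x X) i) = y x + \sum_(i < n) y (tnth X i).
Proof. by rewrite big_ord_recl; congr (_ + _); apply: eq_bigr => i _; rewrite tnthS. Qed.

(** The cross terms vanish by independence, one observation at a time. *)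
Lemma has_mean_iid_sum_sqr n (y : T -> R) v :
  has_mean P y 0 -> has_mean P (fun x => y x ^+ 2) v ->
  has_mean (iid_law P n) (fun X => (\sum_(i < n) y (tnth X i)) ^+ 2) (n%:R * v).
Proof.
move=> y0 yv; have my := has_mean_measurable y0.
elim: n => [|n IHn].
  rewrite mul0r; apply: has_mean_ext (has_mean_cst _ 0) => X.
  by rewrite big_ord0 expr0n.
apply: (@has_mean_iid_lawSr n _ (fun X => v + (\sum_(i < n) y (tnth X i)) ^+ 2)).
- by apply: measurable_funX; exact: measurable_coord_sum.
- by move=> X; exact: sqr_ge0.
- move=> X; set S := \sum_(i < n) _.
  have := has_meanD (has_meanD yv (has_meanZ (2 * S) y0)) (has_mean_cst P (S ^+ 2)).
  rewrite mulr0 addr0; apply: has_mean_ext => x.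
  by rewrite sum_tnth_cons -/S; ring.
- apply: has_mean_val (has_meanD (has_mean_cst _ v) IHn).
  by rewrite -natr1; ring.
Qed.

Lemma measurable_cat_tuple m k :
  measurable_fun [set: m.-tuple T * k.-tuple T]
    (fun p => (cat_tuple p.1 p.2)).
Proof.
apply/measurable_fun_tnthP => i.
case: (split_ordP i) => j ->.
  rewrite (_ : _ \o _ = (fun p : m.-tuple T * k.-tuple T => tnth p.1 j)).
    exact: (measurableT_comp (measurable_tnth j) measurable_fst).
  by apply/funext => p /=; rewrite tnth_lshift.
rewrite (_ : _ \o _ = (fun p : m.-tuple T * k.-tuple T => tnth p.2 j)).
  exact: (measurableT_comp (measurable_tnth j) measurable_snd).
by apply/funext => p /=; rewrite tnth_rshift.
Qed.

Lemma ge0_integral_iid_law_cat m k (F : (m + k).-tuple T -> R) :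
  measurable_fun [set: (m + k).-tuple T] F -> (forall X, 0 <= F X) ->
  (\int[iid_law P (m + k)]_X (F X)%:E =
   \int[iid_law P k]_Y \int[iid_law P m]_X (F (cat_tuple X Y))%:E)%E.
Proof.
elim: m F => [|m IHm] F mF F0.
  apply: eq_integral => Y _ /=.
  rewrite integral_dirac//= ?diracT ?mul1e; first by congr ((F _)%:E); exact: val_inj.
  apply/measurable_EFinP; apply: (measurableT_comp mF) => //.
  exact: (measurableT_comp (@measurable_cat_tuple 0 k) (measurable_pair2 Y)).
rewrite ge0_integral_iid_lawS// fubini_tonelli1/=; last 2 first.
- exact: measurable_F.
- by move=> p; rewrite lee_fin.
have mFcat : measurable_fun [set: (T * k.-tuple T) * m.-tuple T]
    (fun p => (F (cons_tuple p.1.1 (cat_tuple p.2 p.1.2)))%:E).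
  apply/measurable_EFinP; apply: measurableT_comp => //.
  apply: measurable_cons; first exact: measurableT_comp.
  have mswap : measurable_fun [set: (T * k.-tuple T) * m.-tuple T]
      (fun p => (p.2, p.1.2)).
    by apply: measurable_fun_pair => //; exact: measurableT_comp.
  exact: (measurableT_comp (@measurable_cat_tuple m k) mswap).
pose H (q : T * k.-tuple T) :=
  (\int[iid_law P m]_X (F (cons_tuple q.1 (cat_tuple X q.2)))%:E)%E.
have mH : measurable_fun [set: T * k.-tuple T] H.
  apply: (measurable_fun_fubini_tonelli_F (m2 := iid_law P m) _ mFcat) => p.
  by rewrite lee_fin.
have H0 q : (0 <= H q)%E by apply: integral_ge0 => X _; rewrite lee_fin.
transitivity (\int[P]_x \int[iid_law P k]_Y H (x, Y))%E.
  apply: eq_integral => x _; rewrite /fubini_F /=.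
  rewrite (IHm (fun X => F (cons_tuple x X)))//.
  by apply: measurableT_comp => //; exact: measurable_cons.
rewrite (fubini_tonelli _ mH H0).
apply: eq_integral => Y _.
pose FY (X : m.+1.-tuple T) := F (cat_tuple X Y).
have mFY : measurable_fun [set: m.+1.-tuple T] FY.
  apply: (measurableT_comp mF).
  exact: (measurableT_comp (@measurable_cat_tuple m.+1 k) (measurable_pair2 Y)).
rewrite (ge0_integral_iid_lawS mFY (fun X => F0 _)) fubini_tonelli1/=; last 2 first.
- exact: (measurable_F mFY).
- by move=> p; rewrite lee_fin; exact: F0.
apply: eq_integral => x _; apply: eq_integral => X _.
by congr ((F _)%:E); exact: val_inj.
Qed.

(** Sample splitting: conditionally on the last [k] observations, the first [m]
    are still i.i.d. *)
Lemma has_mean_iid_law_cat m k (F : (m + k).-tuple T -> R) (G : k.-tuple T -> R) v :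
  measurable_fun [set: (m + k).-tuple T] F -> (forall X, 0 <= F X) ->
  (forall Y, has_mean (iid_law P m)
     (fun X => F (cat_tuple X Y)) (G Y)) ->
  has_mean (iid_law P k) G v -> has_mean (iid_law P (m + k)) F v.
Proof.
move=> mF F0 FG [_ Gv]; apply: has_mean_ge0_integral => //.
rewrite ge0_integral_iid_law_cat// -Gv; apply: eq_integral => Y _.
by have [_ <-] := FG Y.
Qed.

End iid_calculus.

(** * The one-dimensional Gaussian law *)

Section gaussian.
Context {R : realType}.
Local Notation mu := (@lebesgue_measure R).
Implicit Types (m s x u : R).

Definition gaussian1 : probability (measurableTypeR R) R := normal_prob (0 : R) 1.

Lemma ge0_integral_normal_prob m s (f : R -> \bar R) :
  measurable_fun [set: R] f -> (forall x, (0 <= f x)%E) ->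
  (\int[normal_prob m s]_x f x = \int[mu]_x (f x * (normal_pdf m s x)%:E))%E.
Proof.
move=> mf f0.
have dom : normal_prob m s `<< mu by exact: normal_prob_dominates.
rewrite -(@Radon_Nikodym_SigmaFinite.change_of_variables _ _ _ (normal_prob m s)
  mu dom f)//.
apply: ae_eq_integral => //.
- apply: emeasurable_funM => //.
  exact: measurable_int (Radon_Nikodym_SigmaFinite.f_integrable dom).
- apply: emeasurable_funM => //; apply/measurable_EFinP.
  exact: measurable_normal_pdf.
- apply: ae_eqe_mul2l => /=; apply: integral_ae_eq => //=.
  + exact: Radon_Nikodym_SigmaFinite.f_integrable.
  + by apply/measurable_EFinP; exact: measurable_normal_pdf.
  + by move=> E _ mE; rewrite -Radon_Nikodym_SigmaFinite.f_integral.
Qed.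

Lemma normal_peakE s : 0 < s -> normal_peak s = s^-1 * normal_peak 1.
Proof.
move=> s0; rewrite /normal_peak expr1n mul1r -mulrnAr sqrtrM ?sqr_ge0// sqrtr_sqr.
by rewrite (gtr0_norm s0) invfM.
Qed.

Lemma normal_pdf_expR m s x : 0 < s ->
  normal_pdf m s x = s^-1 * normal_peak 1 * expR (- (x - m) ^+ 2 / (s ^+ 2 * 2)).
Proof.
move=> s0; rewrite normal_pdfE ?gt_eqF// normal_peakE//.
by rewrite /normal_fun -[in LHS]mulr_natr.
Qed.

(** Completing the square: the joint density of [X] and [a X + b Y] factors
    through the marginal density of the latter. *)
Lemma normal_pdf_mul (a b S x u : R) : 0 < b -> 0 < S -> S ^+ 2 = a ^+ 2 + b ^+ 2 ->
  normal_pdf (a * x) b u * normal_pdf 0 1 x =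
  normal_pdf 0 S u * normal_pdf (a * u / S ^+ 2) (b / S) x.
Proof.
move=> b0 S0 SE; rewrite !normal_pdf_expR// ?divr_gt0//.
rewrite ![_ * expR _ * _]mulrACA -!expRD.
congr (_ * expR _); first by field; rewrite !gt_eqF.
have S2 : a ^+ 2 + b ^+ 2 != 0 by rewrite -SE sqrf_eq0 gt_eqF.
rewrite expr_div_n SE; field.
by rewrite S2 gt_eqF.
Qed.

Let affine_is_derive (c s y : R) : is_derive y (1 : R) (fun y : R => c + s * y) s.
Proof.
apply: (is_derive_eq (is_deriveD (is_derive_cst c y 1)
  (is_deriveZ s (is_derive_id y 1)))).
by rewrite add0r /GRing.scale /= mulr1.
Qed.

Let affine_cvgy (c s : R) : 0 < s -> c + s * x @[x --> +oo%R] --> +oo%R.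
Proof.
move=> s0; apply: (@cvg_comp _ _ _ (fun y => s * y) (fun y => c + y) _ (+oo%R)).
  rewrite (_ : (fun y => s * y) = (fun y => y * s)).
    exact: gt0_cvgMly.
  by apply/funext => y; rewrite mulrC.
exact: cvg_addrl.
Qed.

Let affine_cvgNy (c s : R) : 0 < s -> c + s * x @[x --> -oo%R] --> -oo%R.
Proof.
move=> s0; apply: (@cvg_comp _ _ _ (fun y => s * y) (fun y => c + y) _ (-oo%R)).
  rewrite (_ : (fun y => s * y) = (fun y => y * s)).
    exact: gt0_cvgMlNy.
  by apply/funext => y; rewrite mulrC.
exact: cvg_addrl_Ny.
Qed.

Let continuous_affine (c s : R) : continuous (fun y : R => c + s * y).
Proof.
by move=> y; apply: cvgD; [exact: cvg_cst|apply: cvgM; [exact: cvg_cst|exact: cvg_id]].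
Qed.

Lemma ge0_integral_normal_affine (c s : R) (g : R -> R) : 0 < s ->
  continuous g -> (forall x, 0 <= g x) ->
  (\int[gaussian1]_y (g (c + s * y))%:E =
   \int[mu]_u (g u * normal_pdf c s u)%:E)%E.
Proof.
move=> s0 cg g0.
have mg : measurable_fun [set: R] g by exact: continuous_measurable_fun.
rewrite (ge0_integral_normal_prob 0 1); last 2 first.
- apply/measurable_EFinP; apply: measurableT_comp => //.
  by apply: continuous_measurable_fun; exact: continuous_affine.
- by move=> x; rewrite lee_fin.
have F' : derive1 (fun y : R => c + s * y) = cst s.
  by apply/funext => y; rewrite derive1E; apply: derive_val.
rewrite (@increasing_ge0_integration_by_substitutionT _ (fun y : R => c + s * y)
  (fun u => g u * normal_pdf c s u)).
- apply: eq_integral => y _; rewrite F' -EFinM !fctE; congr (_%:E).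
  rewrite -mulrA; congr (_ * _); rewrite !normal_pdf_expR//.
  rewrite [RHS]mulrAC; congr (_ * expR _); last by field; rewrite gt_eqF.
  by rewrite invr1 mul1r mulrAC mulVf ?gt_eqF// mul1r.
- by move=> x y xy; rewrite ltrD2l ltr_pM2l.
- by rewrite F'; move=> x; exact: cvg_cst.
- by rewrite F'; exact: is_cvg_cst.
- by rewrite F'; exact: is_cvg_cst.
- by move=> x; exact: ex_derive.
- exact: affine_cvgNy.
- exact: affine_cvgy.
- by move=> x; apply: cvgM; [exact: cg|apply: continuous_normal_pdf; rewrite gt_eqF].
- by move=> x; rewrite mulr_ge0// normal_pdf_ge0.
Qed.

Let measurable_normal_pdf_joint (a b : R) : 0 < b ->
  measurable_fun [set: R * R] (fun p : R * R => normal_pdf (a * p.1) b p.2).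
Proof.
move=> b0; rewrite (_ : (fun p => _) = fun p : R * R =>
  b^-1 * normal_peak 1 * expR (- (p.2 - a * p.1) ^+ 2 / (b ^+ 2 * 2))).
  apply: measurable_funM => //; apply: measurableT_comp => //.
  apply: measurable_funM => //; apply: measurable_funN.
  apply: measurable_funX; apply: measurable_funB => //.
  exact: measurable_funM.
by apply/funext => p; rewrite normal_pdf_expR.
Qed.

(** Stability of the Gaussian law under independent linear combinations. The inner
    integral is taken against the density of [N(a x, b^2)]; once the integrals are
    exchanged, [normal_pdf_mul] leaves the total mass of a Gaussian density in [x],
    which is one. *)
Lemma gaussian_convolution (a b S : R) (g : R -> R) :
  0 < b -> 0 < S -> S ^+ 2 = a ^+ 2 + b ^+ 2 ->
  continuous g -> (forall x, 0 <= g x) ->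
  (\int[gaussian1]_x \int[gaussian1]_y (g (a * x + b * y))%:E =
   \int[gaussian1]_z (g (S * z))%:E)%E.
Proof.
move=> b0 S0 SE cg g0.
have mg : measurable_fun [set: R] g by exact: continuous_measurable_fun.
under eq_integral do rewrite ge0_integral_normal_affine//.
have mG : measurable_fun [set: R * R]
    (fun p : R * R => (g p.2 * normal_pdf (a * p.1) b p.2)%:E).
  apply/measurable_EFinP; apply: measurable_funM.
    exact: measurableT_comp.
  exact: measurable_normal_pdf_joint.
have G0 p : (0 <= (g p.2 * normal_pdf (a * p.1) b p.2)%:E)%E.
  by rewrite lee_fin mulr_ge0// normal_pdf_ge0.
rewrite (ge0_integral_normal_prob 0 1); last 2 first.
- exact: (measurable_fun_fubini_tonelli_F (m2 := mu) _ mG).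
- by move=> x; apply: integral_ge0 => u _; rewrite lee_fin mulr_ge0// normal_pdf_ge0.
pose Q (p : R * R) :=
  ((g p.2 * normal_pdf (a * p.1) b p.2) * normal_pdf 0 1 p.1)%:E.
have mQ : measurable_fun [set: R * R] Q.
  apply/measurable_EFinP; apply: measurable_funM; first exact/measurable_EFinP.
  by apply: measurableT_comp => //; exact: measurable_normal_pdf.
have Q0 p : (0 <= Q p)%E by rewrite lee_fin !mulr_ge0// normal_pdf_ge0.
transitivity (\int[mu]_x \int[mu]_u Q (x, u))%E.
  apply: eq_integral => x _; rewrite -ge0_integralZr//.
  - apply/measurable_EFinP; apply: measurable_funM => //.
    exact: measurable_normal_pdf.
  - by move=> u _; exact: (G0 (x, u)).
  - by rewrite lee_fin normal_pdf_ge0.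
rewrite (fubini_tonelli (m1 := mu) (m2 := mu) _ mQ Q0).
under [RHS]eq_integral => z _ do rewrite -[S * z]add0r.
rewrite ge0_integral_normal_affine//; apply: eq_integral => u _.
transitivity (\int[mu]_x ((g u * normal_pdf 0 S u)%:E *
    (normal_pdf (a * u / S ^+ 2) (b / S) x)%:E))%E.
  by apply: eq_integral => x _; rewrite /Q /= -mulrA (normal_pdf_mul _ _ b0 S0 SE) mulrA EFinM.
rewrite ge0_integralZl//.
- by rewrite integral_normal_pdf mule1.
- by apply/measurable_EFinP; exact: measurable_normal_pdf.
- by move=> x _; rewrite lee_fin normal_pdf_ge0.
- by rewrite lee_fin mulr_ge0// normal_pdf_ge0.
Qed.

End gaussian.

(** * Gaussian moments *)

Section gaussian_moments.
Context {R : realType}.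
Local Notation gaussian1 := (@gaussian1 R).

(** The integrand times the standard density is [r] times the density of
    [N(0, r^2)]. *)
Lemma gaussian_expR_sqr (r : R) : 0 < r ->
  has_mean gaussian1 (fun x => expR ((1 - r ^- 2) * (x ^+ 2 / 2))) r.
Proof.
move=> r0.
have mE : measurable_fun [set: R] (fun x : R => expR ((1 - r ^- 2) * (x ^+ 2 / 2))).
  apply: measurableT_comp => //; apply: measurable_funM => //.
  by apply: measurable_funM => //; exact: measurable_funX.
apply: has_mean_ge0_integral => //.
rewrite (ge0_integral_normal_prob 0 1); last 2 first.
- exact/measurable_EFinP.
- by move=> x; rewrite lee_fin expR_ge0.
transitivity (\int[lebesgue_measure]_x (r%:E * (normal_pdf 0 r x)%:E))%E.
  apply: eq_integral => x _; rewrite -!EFinM !normal_pdf_expR//; congr (_%:E).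
  rewrite mulrCA -expRD !mulrA divff ?gt_eqF// mul1r invr1 mul1r.
  by congr (_ * expR _); field; rewrite gt_eqF.
rewrite ge0_integralZl//.
- by rewrite integral_normal_pdf mule1.
- by apply/measurable_EFinP; exact: measurable_normal_pdf.
- by move=> x _; rewrite lee_fin normal_pdf_ge0.
- by rewrite lee_fin ltW.
Qed.

Definition gaussian_moment (k : nat) : R := fine (\int[gaussian1]_x (x ^+ k)%:E)%E.

Lemma has_mean_gaussian_moment k : (k <= 8)%N ->
  has_mean gaussian1 (fun x => x ^+ k) (gaussian_moment k).
Proof.
move=> k8.
have s2 : 0 < Num.sqrt 2 :> R by rewrite sqrtr_gt0.
(* 24 * 256 = 4! * 4^4, because expR u >= u^4 / 4! at u = x^2 / 4 *)
have dom := has_meanD (has_mean_cst gaussian1 1)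
  (has_meanZ (24 * 256) (gaussian_expR_sqr s2)).
have mX : measurable_fun [set: R] (fun x : R => x ^+ k) by exact: measurable_funX.
have [|v xv] := @has_mean_dom _ _ _ gaussian1 _ _ _ mX _ dom; last first.
  by rewrite /gaussian_moment; have [_ ->] := xv.
move=> x; rewrite normrX sqr_sqrtr//.
have -> : (1 - 2^-1) * (x ^+ 2 / 2) = x ^+ 2 / 4 :> R by field.
have x8 : `|x| ^+ 8 <= 24 * 256 * expR (x ^+ 2 / 4).
  have := @expR_ge1Dxn R (x ^+ 2 / 4) 3; rewrite divr_ge0 ?sqr_ge0// => /(_ isT).
  rewrite (_ : (3.+1)`! = 24)%N//; set E := expR _ => h.
  have -> : `|x| ^+ 8 = (x ^+ 2) ^+ 4 by rewrite -(real_normK (num_real x)) -exprM.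
  have : (x ^+ 2) ^+ 4 = (24 * 256) * ((x ^+ 2 / 4) ^+ 4 / 24%:R) by field.
  lra.
have [x1|x1] := lerP `|x| 1.
  have : `|x| ^+ k <= 1 by rewrite exprn_ile1.
  have := expR_ge0 (x ^+ 2 / 4); lra.
have : `|x| ^+ k <= `|x| ^+ 8 by rewrite ler_weXn2l// ltW.
lra.
Qed.

Let M k (h : (k <= 8)%N) := has_mean_gaussian_moment h.

(** With [v] the second moment, the tangent inequality [1 + t <= expR t] at
    [t = (1 - r^-2) x^2 / 2] integrates to [(r^2 - 1) v <= 2 r^2 (r - 1)]. For [r]
    close to one this reads [v <= 1] on the right and [v >= 1] on the left; the
    values of [r] used below are [1 + |v - 1| / 4] and [1 - |v - 1| / 4]. *)
Lemma gaussian_moment2 : gaussian_moment 2 = 1.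
Proof.
set v := gaussian_moment 2.
have v2 : has_mean gaussian1 (fun x => x ^+ 2) v by exact: M.
have key r : 0 < r -> (r ^+ 2 - 1) * v <= 2 * r ^+ 2 * (r - 1).
  move=> r0.
  have h : 1 + (1 - r ^- 2) / 2 * v <= r.
    apply: has_mean_le (has_meanD (has_mean_cst gaussian1 1)
      (has_meanZ ((1 - r ^- 2) / 2) v2)) (gaussian_expR_sqr r0) _ => x.
    apply: le_trans (expR_ge1Dx _); rewrite lerD2l.
    by rewrite le_eqVlt; apply/orP; left; apply/eqP; field; rewrite gt_eqF.
  have r2 : 0 < 2 * r ^+ 2 by rewrite mulr_gt0// exprn_gt0.
  have -> : (r ^+ 2 - 1) * v = 2 * r ^+ 2 * ((1 - r ^- 2) / 2 * v).
    by field; rewrite gt_eqF.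
  rewrite ler_pM2l//; lra.
have v0 : 0 <= v.
  by apply: has_mean_le (has_mean_cst gaussian1 0) v2 _ => x; exact: sqr_ge0.
have v8 : v <= 8 / 3 by have := key 2 ltac:(lra); lra.
have [vlt|vgt|//] := ltrgtP v 1.
- have e0 : 0 < (1 - v) / 4 by lra.
  have := key (1 - (1 - v) / 4) ltac:(lra).
  have : (1 - v) / 4 <= 1 / 4 by lra.
  set e := (1 - v) / 4 in e0 *.
  have -> : v = 1 - 4 * e by rewrite /e; field.
  have -> : ((1 - e) ^+ 2 - 1) * (1 - 4 * e) = e * ((e - 2) * (1 - 4 * e)) by ring.
  have -> : 2 * (1 - e) ^+ 2 * (1 - e - 1) = e * (- (2 * (1 - e) ^+ 2)) by ring.
  by rewrite ler_pM2l//; nra.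
- have e0 : 0 < (v - 1) / 4 by lra.
  have := key (1 + (v - 1) / 4) ltac:(lra).
  have : (v - 1) / 4 <= 1 by lra.
  set e := (v - 1) / 4 in e0 *.
  have -> : v = 1 + 4 * e by rewrite /e; field.
  have -> : ((1 + e) ^+ 2 - 1) * (1 + 4 * e) = e * ((e + 2) * (1 + 4 * e)) by ring.
  have -> : 2 * (1 + e) ^+ 2 * (1 + e - 1) = e * (2 * (1 + e) ^+ 2) by ring.
  by rewrite ler_pM2l//; nra.
Qed.

Let gaussian_opp (f : R -> R) : measurable_fun [set: R] f -> (forall x, 0 <= f x) ->
  (\int[gaussian1]_x (f (- x))%:E = \int[gaussian1]_x (f x)%:E)%E.
Proof.
move=> mf f0; rewrite !(ge0_integral_normal_prob 0 1); last 4 first.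
- exact/measurable_EFinP.
- by move=> x; rewrite lee_fin.
- by apply/measurable_EFinP; apply: measurableT_comp.
- by move=> x; rewrite lee_fin.
have mh : measurable_fun [set: R] (fun x => (f x)%:E * (normal_pdf 0 1 x)%:E)%E.
  apply: emeasurable_funM; apply/measurable_EFinP => //.
  exact: measurable_normal_pdf.
have mN : measurable_fun [set: measurableTypeR R] (-%R : R -> measurableTypeR R).
  exact: oppr_measurable.
transitivity (\int[pushforward lebesgue_measure (-%R : R -> measurableTypeR R)]_x
    ((f x)%:E * (normal_pdf 0 1 x)%:E))%E.
  rewrite (ge0_integral_pushforward mN); [|exact: measurableT|exact: mh|].
    by apply: eq_integral => x _ /=; rewrite !normal_pdf_expR// !subr0 sqrrN.
  by move=> x _; rewrite mule_ge0// lee_fin// normal_pdf_ge0.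
by apply: eq_measure_integral => A mA _; exact: lebesgue_measureN.
Qed.

(** The functions [1 + x^8 + x^k] and [1 + x^8 - x^k] are nonnegative and exchanged
    by [x -> - x], so they have the same mean. *)
Lemma gaussian_moment_odd k : (k <= 8)%N -> odd k -> gaussian_moment k = 0.
Proof.
move=> k8 ok; set v := gaussian_moment k.
have vk : has_mean gaussian1 (fun x => x ^+ k) v by exact: M.
pose f (e : R) (x : R) := 1 + x ^+ 8 + e * x ^+ k.
have fe e : has_mean gaussian1 (f e) (1 + gaussian_moment 8 + e * v).
  by apply: has_meanD (has_meanZ e vk); apply: has_meanD (has_mean_cst _ _) (M _).
have f0 e : `|e| = 1 -> forall x, 0 <= f e x.
  move=> e1 x; rewrite /f.
  have : `|e * x ^+ k| <= 1 + x ^+ 8.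
    rewrite normrM e1 mul1r normrX; have -> : x ^+ 8 = `|x| ^+ 8.
      by rewrite -normrX ger0_norm// exprn_even_ge0.
    have [x1|x1] := lerP `|x| 1.
      have : `|x| ^+ k <= 1 by rewrite exprn_ile1.
      by have := exprn_ge0 8 (normr_ge0 x); lra.
    have : `|x| ^+ k <= `|x| ^+ 8 by rewrite ler_weXn2l// ltW.
    lra.
  by rewrite ler_norml => /andP[]; lra.
have [_ f1] := fe 1; have [_ fN1] := fe (-1).
have fN x : f 1 (- x) = f (-1) x.
  have xk : (- x) ^+ k = - x ^+ k by rewrite exprNn -signr_odd ok expr1 mulN1r.
  by rewrite /f xk; ring.
have : 1 + gaussian_moment 8 + 1 * v = 1 + gaussian_moment 8 + -1 * v.
  apply: EFin_inj; rewrite -f1 -fN1 -gaussian_opp//.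
  - by apply: eq_integral => x _; rewrite fN.
  - exact: has_mean_measurable (fe 1).
  - by apply: f0; rewrite normr1.
lra.
Qed.

Lemma gaussian_convolution_mean (a b S : R) (g G : R -> R) v w :
  0 < b -> 0 < S -> S ^+ 2 = a ^+ 2 + b ^+ 2 ->
  continuous g -> (forall x, 0 <= g x) ->
  (forall x, has_mean gaussian1 (fun y => g (a * x + b * y)) (G x)) ->
  has_mean gaussian1 G v -> has_mean gaussian1 (fun z => g (S * z)) w -> v = w.
Proof.
move=> b0 S0 SE cg g0 gG [_ Gv] [_ gw]; apply: EFin_inj.
rewrite -Gv -gw -(gaussian_convolution b0 S0 SE cg g0).
by apply: eq_integral => x _; have [_ <-] := gG x.
Qed.

Let sqrt2_gt0 : 0 < Num.sqrt 2 :> R. Proof. by rewrite sqrtr_gt0. Qed.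
Let sqrt2_sqr : Num.sqrt 2 ^+ 2 = 1 ^+ 2 + 1 ^+ 2 :> R.
Proof. by rewrite sqr_sqrtr// expr1n. Qed.

Let moment_scaled k : (k <= 4)%N ->
  has_mean gaussian1 (fun z => (Num.sqrt 2 * z) ^+ k.*2)
    (2 ^+ k * gaussian_moment k.*2).
Proof.
move=> k4; apply: has_mean_ext (has_meanZ (2 ^+ k) (M (_ : (k.*2 <= 8)%N))).
  by move=> z; rewrite exprMn -[in RHS]muln2 [in RHS]mulnC exprM sqr_sqrtr// mul2n.
by rewrite (leq_double _ 4).
Qed.

(** Each even moment is determined by the lower ones, because
    [(X + Y) / sqrt 2] has the law of [X]. *)
Let even_moment k (Hk : (k <= 4)%N) (G : R -> R) v :
  (forall x, has_mean gaussian1 (fun y => (x + y) ^+ k.*2) (G x)) ->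
  has_mean gaussian1 G v -> v = 2 ^+ k * gaussian_moment k.*2.
Proof.
move=> hG Gv.
apply: (gaussian_convolution_mean (g := fun u => u ^+ k.*2) ltr01 sqrt2_gt0 sqrt2_sqr
  _ _ _ Gv (moment_scaled Hk)).
- by move=> x; exact: exprn_continuous.
- by move=> x; rewrite exprn_even_ge0// odd_double.
- by move=> x; apply: has_mean_ext (hG x) => y; rewrite !mul1r.
Qed.

Lemma gaussian_moment4 : gaussian_moment 4 = 3.
Proof.
have m1 := M (isT : 1 <= 8)%N; rewrite gaussian_moment_odd// in m1.
have m2 := M (isT : 2 <= 8)%N; rewrite gaussian_moment2 in m2.
have m3 := M (isT : 3 <= 8)%N; rewrite gaussian_moment_odd// in m3.
have m4 := M (isT : 4 <= 8)%N.
suff : gaussian_moment 4 + 6 * 1 + gaussian_moment 4 =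
  2 ^+ 2 * gaussian_moment 2.*2 by rewrite /=; lra.
apply: (@even_moment 2 isT (fun x => x ^+ 4 + 6 * x ^+ 2 + gaussian_moment 4)).
- move=> x; have := has_meanD (has_meanD (has_meanD (has_meanD
    (has_mean_cst gaussian1 (x ^+ 4)) (has_meanZ (4 * x ^+ 3) m1))
    (has_meanZ (6 * x ^+ 2) m2)) (has_meanZ (4 * x) m3)) m4.
  rewrite !mulr0 !addr0 mulr1; apply: has_mean_ext => y.
  by rewrite (_ : 2.*2 = 4)%N//; ring.
- exact: has_meanD (has_meanD m4 (has_meanZ 6 m2)) (has_mean_cst _ _).
Qed.

Lemma gaussian_moment6 : gaussian_moment 6 = 15.
Proof.
have m1 := M (isT : 1 <= 8)%N; rewrite gaussian_moment_odd// in m1.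
have m2 := M (isT : 2 <= 8)%N; rewrite gaussian_moment2 in m2.
have m3 := M (isT : 3 <= 8)%N; rewrite gaussian_moment_odd// in m3.
have m4 := M (isT : 4 <= 8)%N; rewrite gaussian_moment4 in m4.
have m5 := M (isT : 5 <= 8)%N; rewrite gaussian_moment_odd// in m5.
have m6 := M (isT : 6 <= 8)%N.
suff : gaussian_moment 6 + 15 * 3 + 45 * 1 + gaussian_moment 6 =
  2 ^+ 3 * gaussian_moment 3.*2 by rewrite /=; lra.
apply: (@even_moment 3 isT
  (fun x => x ^+ 6 + 15 * x ^+ 4 + 45 * x ^+ 2 + gaussian_moment 6)).
- move=> x; have := has_meanD (has_meanD (has_meanD (has_meanD (has_meanD (has_meanD
    (has_mean_cst gaussian1 (x ^+ 6)) (has_meanZ (6 * x ^+ 5) m1))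
    (has_meanZ (15 * x ^+ 4) m2)) (has_meanZ (20 * x ^+ 3) m3))
    (has_meanZ (15 * x ^+ 2) m4)) (has_meanZ (6 * x) m5)) m6.
  rewrite !mulr0 !addr0 mulr1 (mulrAC 15 _ 3) -natrM; apply: has_mean_ext => y.
  by rewrite (_ : 3.*2 = 6)%N//; ring.
- exact: has_meanD (has_meanD (has_meanD m6 (has_meanZ 15 m4)) (has_meanZ 45 m2))
    (has_mean_cst _ _).
Qed.

Lemma gaussian_moment8 : gaussian_moment 8 = 105.
Proof.
have m1 := M (isT : 1 <= 8)%N; rewrite gaussian_moment_odd// in m1.
have m2 := M (isT : 2 <= 8)%N; rewrite gaussian_moment2 in m2.
have m3 := M (isT : 3 <= 8)%N; rewrite gaussian_moment_odd// in m3.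
have m4 := M (isT : 4 <= 8)%N; rewrite gaussian_moment4 in m4.
have m5 := M (isT : 5 <= 8)%N; rewrite gaussian_moment_odd// in m5.
have m6 := M (isT : 6 <= 8)%N; rewrite gaussian_moment6 in m6.
have m7 := M (isT : 7 <= 8)%N; rewrite gaussian_moment_odd// in m7.
have m8 := M (isT : 8 <= 8)%N.
suff : gaussian_moment 8 + 28 * 15 + 210 * 3 + 420 * 1 + gaussian_moment 8 =
  2 ^+ 4 * gaussian_moment 4.*2 by rewrite /=; lra.
apply: (@even_moment 4 isT
  (fun x => x ^+ 8 + 28 * x ^+ 6 + 210 * x ^+ 4 + 420 * x ^+ 2 + gaussian_moment 8)).
- move=> x; have := has_meanD (has_meanD (has_meanD (has_meanD (has_meanD (has_meanD
    (has_meanD (has_meanD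
    (has_mean_cst gaussian1 (x ^+ 8)) (has_meanZ (8 * x ^+ 7) m1))
    (has_meanZ (28 * x ^+ 6) m2)) (has_meanZ (56 * x ^+ 5) m3))
    (has_meanZ (70 * x ^+ 4) m4)) (has_meanZ (56 * x ^+ 3) m5))
    (has_meanZ (28 * x ^+ 2) m6)) (has_meanZ (8 * x) m7)) m8.
  rewrite !mulr0 !addr0 mulr1 (mulrAC 70 _ 3) (mulrAC 28 _ 15) -!natrM.
  apply: has_mean_ext => y.
  by rewrite (_ : 4.*2 = 8)%N//; ring.
- exact: has_meanD (has_meanD (has_meanD (has_meanD m8 (has_meanZ 28 m6))
    (has_meanZ 210 m4)) (has_meanZ 420 m2)) (has_mean_cst _ _).
Qed.

Lemma has_mean_gaussian_poly8 (c0 c1 c2 c3 c4 c5 c6 c7 c8 : R) :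
  has_mean gaussian1 (fun x => c0 + c1 * x + c2 * x ^+ 2 + c3 * x ^+ 3 + c4 * x ^+ 4
    + c5 * x ^+ 5 + c6 * x ^+ 6 + c7 * x ^+ 7 + c8 * x ^+ 8)
  (c0 + c2 + 3 * c4 + 15 * c6 + 105 * c8).
Proof.
have -> : c0 + c2 + 3 * c4 + 15 * c6 + 105 * c8 = c0 + c1 * 0 + c2 * 1 + c3 * 0
  + c4 * 3 + c5 * 0 + c6 * 15 + c7 * 0 + c8 * 105 by ring.
rewrite -gaussian_moment8 -gaussian_moment6 -gaussian_moment4 -[in c2 * _]gaussian_moment2.
rewrite -[in c1 * _](@gaussian_moment_odd 1)// -[in c3 * _](@gaussian_moment_odd 3)//.
rewrite -[in c5 * _](@gaussian_moment_odd 5)// -[in c7 * _](@gaussian_moment_odd 7)//.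
do 7 (apply: has_meanD; last by apply: has_meanZ; exact: M).
exact: has_meanD (has_mean_cst _ _) (has_meanZ c1 (M (isT : 1 <= 8)%N)).
Qed.

End gaussian_moments.

(** * Quadratic forms of a standard Gaussian vector *)

Section cauchy_schwarz.
Context {d : measure_display} {T : measurableType d} {R : realType}.
Implicit Types (P : probability T R) (f g : T -> R).

Lemma has_mean_cauchy_schwarz P f g p q r :
  has_mean P (fun x => f x ^+ 2) p -> has_mean P (fun x => g x ^+ 2) q ->
  has_mean P (fun x => f x * g x) r -> r ^+ 2 <= p * q.
Proof.
move=> fp gq fgr.
have key t : 0 <= t ^+ 2 * p - 2 * t * r + q.
  apply: has_mean_le (has_mean_cst P 0) (has_meanD (has_meanB
    (has_meanZ (t ^+ 2) fp) (has_meanZ (2 * t) fgr)) gq) _ => x.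
  have -> : t ^+ 2 * f x ^+ 2 - 2 * t * (f x * g x) + g x ^+ 2 = (t * f x - g x) ^+ 2.
    by ring.
  exact: sqr_ge0.
have p0 : 0 <= p.
  by apply: has_mean_le (has_mean_cst P 0) fp _ => x; exact: sqr_ge0.
have [p_eq0|p_neq0] := eqVneq p 0.
  have [->|r0] := eqVneq r 0; first by rewrite expr0n p_eq0 mul0r.
  (* the quadratic in [t] degenerates to an affine function; this [t] makes it -1 *)
  have := key ((q + 1) / (2 * r)); rewrite p_eq0.
  have -> : 2 * ((q + 1) / (2 * r)) * r = q + 1 by field.
  lra.
have pgt0 : 0 < p by rewrite lt0r p_neq0.
have := key (r / p).
have -> : (r / p) ^+ 2 * p - 2 * (r / p) * r + q = (p * q - r ^+ 2) / p by field.
by rewrite pmulr_lge0 ?invr_gt0// subr_ge0.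
Qed.

End cauchy_schwarz.

Section quadratic_forms.
Context {R : realType}.
Local Notation gaussian d := (iid_law (@gaussian1 R) d).
Implicit Types (d : nat) (c : R).

Definition lin_form d c (b : 'I_d -> R) (x : Rvec R d) : R :=
  c + \sum_i b i * tnth x i.

(** The products are centred, so that [c] is the mean. Constant and linear parts
    are kept because conditioning on one coordinate creates them. *)
Definition quad_form d c (b : 'I_d -> R) (M : 'I_d -> 'I_d -> R) (x : Rvec R d) : R :=
  c + \sum_i b i * tnth x i +
  \sum_i \sum_j M i j * (tnth x i * tnth x j - (i == j)%:R).

Definition lin_var d c (b : 'I_d -> R) : R := c ^+ 2 + \sum_i b i ^+ 2.

(** The second moment of [quad_form]. The last term is twice the squared norm of the
    symmetric part of [M], as [M] itself need not be symmetric. *)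
Definition quad_var d c (b : 'I_d -> R) (M : 'I_d -> 'I_d -> R) : R :=
  c ^+ 2 + \sum_i b i ^+ 2 + \sum_i \sum_j M i j * (M i j + M j i).

Let tl d (b : 'I_d.+1 -> R) : 'I_d -> R := fun i => b (lift ord0 i).
Let tl2 d (M : 'I_d.+1 -> 'I_d.+1 -> R) : 'I_d -> 'I_d -> R :=
  fun i j => M (lift ord0 i) (lift ord0 j).
Let cross d (M : 'I_d.+1 -> 'I_d.+1 -> R) : 'I_d -> R :=
  fun j => M ord0 (lift ord0 j) + M (lift ord0 j) ord0.

Let lin_form_cons d c (b : 'I_d.+1 -> R) (x : R) (X : Rvec R d) :
  lin_form c b (cons_tuple x X) = lin_form c (tl b) X + x * b ord0.
Proof.
rewrite /lin_form big_ord_recl (_ : tnth _ ord0 = x)// -addrA; congr (_ + _).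
rewrite addrC mulrC; congr (_ + _); apply: eq_bigr => i _.
by rewrite tnthS.
Qed.

Let quad_form_cons d c (b : 'I_d.+1 -> R) M (x : R) (X : Rvec R d) :
  quad_form c b M (cons_tuple x X) =
  quad_form c (tl b) (tl2 M) X + x * lin_form (b ord0) (cross M) X +
  (x ^+ 2 - 1) * M ord0 ord0.
Proof.
rewrite /quad_form /lin_form !big_ord_recl (_ : tnth _ ord0 = x)// eqxx.
have -> : \sum_i b (lift ord0 i) * tnth (cons_tuple x X) (lift ord0 i) =
    \sum_i tl b i * tnth X i.
  by apply: eq_bigr => i _; rewrite tnthS.
have -> : \sum_i cross M i * tnth X i =
    \sum_i M ord0 (lift ord0 i) * tnth X i + \sum_i M (lift ord0 i) ord0 * tnth X i.
  by rewrite -big_split; apply: eq_bigr => i _; rewrite /cross mulrDl.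
have -> : \sum_(i < d) M ord0 (lift ord0 i) *
      (x * tnth (cons_tuple x X) (lift ord0 i) - (ord0 == lift ord0 i)%:R) =
    x * \sum_i M ord0 (lift ord0 i) * tnth X i.
  by rewrite mulr_sumr; apply: eq_bigr => i _; rewrite tnthS subr0 mulrCA.
have -> : \sum_(i < d) \sum_(j < d.+1) M (lift ord0 i) j *
      (tnth (cons_tuple x X) (lift ord0 i) * tnth (cons_tuple x X) j -
       (lift ord0 i == j)%:R) =
    x * \sum_i M (lift ord0 i) ord0 * tnth X i +
    \sum_i \sum_j tl2 M i j * (tnth X i * tnth X j - (i == j)%:R).
  rewrite mulr_sumr -big_split; apply: eq_bigr => i _; rewrite big_ord_recl.
  congr (_ + _).
    by rewrite tnthS subr0 (_ : tnth _ ord0 = x)//; ring.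
  by apply: eq_bigr => j _; rewrite !tnthS (inj_eq lift_inj).
by rewrite (_ : true%:R = 1 :> R)//; ring.
Qed.

Let lin_var_recl d c (b : 'I_d.+1 -> R) :
  lin_var c b = lin_var c (tl b) + b ord0 ^+ 2.
Proof. by rewrite /lin_var big_ord_recl; ring. Qed.

Let quad_var_recl d c (b : 'I_d.+1 -> R) M :
  quad_var c b M = quad_var c (tl b) (tl2 M) + lin_var (b ord0) (cross M) +
    2 * M ord0 ord0 ^+ 2.
Proof.
rewrite /quad_var /lin_var !big_ord_recl.
have -> : \sum_i cross M i ^+ 2 =
    \sum_(i < d) M ord0 (lift ord0 i) * (M ord0 (lift ord0 i) + M (lift ord0 i) ord0) +
    \sum_(i < d) M (lift ord0 i) ord0 * (M (lift ord0 i) ord0 + M ord0 (lift ord0 i)).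
  by rewrite -big_split /=; apply: eq_bigr => i _; rewrite /cross; ring.
have -> : \sum_(i < d) \sum_(j < d.+1) M (lift ord0 i) j * (M (lift ord0 i) j + M j (lift ord0 i)) =
    \sum_(i < d) M (lift ord0 i) ord0 * (M (lift ord0 i) ord0 + M ord0 (lift ord0 i)) +
    \sum_i \sum_j tl2 M i j * (tl2 M i j + tl2 M j i).
  by rewrite -big_split; apply: eq_bigr => i _; rewrite big_ord_recl.
rewrite /tl; ring.
Qed.

Lemma lin_var_ge0 d c (b : 'I_d -> R) : 0 <= lin_var c b.
Proof. by rewrite addr_ge0 ?sqr_ge0// sumr_ge0// => i _; exact: sqr_ge0. Qed.

Lemma quad_var_ge0 d c (b : 'I_d -> R) M : 0 <= quad_var c b M.
Proof.
elim: d c b M => [|d IHd] c b M; first by rewrite /quad_var !big_ord0 !addr0 sqr_ge0.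
rewrite quad_var_recl; apply: addr_ge0; last by rewrite mulr_ge0 ?sqr_ge0.
by apply: addr_ge0; [exact: IHd|exact: lin_var_ge0].
Qed.

Let measurable_linear d (b : 'I_d -> R) :
  measurable_fun [set: Rvec R d] (fun x => \sum_i b i * (tnth x i : R)).
Proof.
apply: measurable_sum => i; apply: measurable_funM => //.
exact: measurable_tnth.
Qed.

Lemma measurable_lin_form d c (b : 'I_d -> R) :
  measurable_fun [set: Rvec R d] (lin_form c b).
Proof. by apply: measurable_funD => //; exact: measurable_linear. Qed.

Lemma measurable_quad_form d c (b : 'I_d -> R) M :
  measurable_fun [set: Rvec R d] (quad_form c b M).
Proof.
apply: measurable_funD; first exact: measurable_lin_form.
apply: measurable_sum => i; apply: measurable_sum => j.
apply: measurable_funM => //; apply: measurable_funB => //.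
by apply: measurable_funM; exact: measurable_tnth.
Qed.

Lemma has_mean_lin_form_sqr d c (b : 'I_d -> R) :
  has_mean (gaussian d) (fun x => lin_form c b x ^+ 2) (lin_var c b).
Proof.
elim: d c b => [|d IHd] c b.
  rewrite /lin_var big_ord0 addr0; apply: has_mean_ext (has_mean_cst _ (c ^+ 2)) => x.
  by rewrite /lin_form big_ord0 addr0.
rewrite lin_var_recl.
apply: (has_mean_iid_lawSr (G := fun X => lin_form c (tl b) X ^+ 2 + b ord0 ^+ 2)).
- by apply: measurable_funX; exact: measurable_lin_form.
- by move=> x; exact: sqr_ge0.
- move=> X; set A := lin_form c (tl b) X.
  apply: has_mean_ext (has_mean_val _ (has_mean_gaussian_poly8 (A ^+ 2)
    (2 * A * b ord0) (b ord0 ^+ 2) 0 0 0 0 0 0)); last by ring.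
  by move=> x; rewrite lin_form_cons -/A; ring.
- exact: has_meanD (IHd _ _) (has_mean_cst _ _).
Qed.

Lemma lin_form_moment4 d c (b : 'I_d -> R) :
  exists2 w, has_mean (gaussian d) (fun x => lin_form c b x ^+ 4) w &
    w <= 3 * lin_var c b ^+ 2.
Proof.
elim: d c b => [|d IHd] c b.
  exists (c ^+ 4); last first.
    by rewrite /lin_var big_ord0 addr0; have := sqr_ge0 (c ^+ 2); lra.
  apply: has_mean_ext (has_mean_cst _ (c ^+ 4)) => x.
  by rewrite /lin_form big_ord0 addr0.
have [w Aw wle] := IHd c (tl b).
have A2 := has_mean_lin_form_sqr c (tl b).
exists (w + 6 * b ord0 ^+ 2 * lin_var c (tl b) + 3 * b ord0 ^+ 4); last first.
  by rewrite lin_var_recl; lra.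
apply: (has_mean_iid_lawSr (G := fun X => lin_form c (tl b) X ^+ 4 +
  6 * b ord0 ^+ 2 * lin_form c (tl b) X ^+ 2 + 3 * b ord0 ^+ 4)).
- by apply: measurable_funX; exact: measurable_lin_form.
- by move=> x; rewrite exprn_even_ge0.
- move=> X; set A := lin_form c (tl b) X.
  apply: has_mean_ext (has_mean_val _ (has_mean_gaussian_poly8 (A ^+ 4)
    (4 * A ^+ 3 * b ord0) (6 * A ^+ 2 * b ord0 ^+ 2) (4 * A * b ord0 ^+ 3)
    (b ord0 ^+ 4) 0 0 0 0)); last by ring.
  by move=> x; rewrite lin_form_cons -/A; ring.
- exact: has_meanD (has_meanD Aw (has_meanZ _ A2)) (has_mean_cst _ _).
Qed.

Lemma has_mean_quad_form_sqr d c (b : 'I_d -> R) M :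
  has_mean (gaussian d) (fun x => quad_form c b M x ^+ 2) (quad_var c b M).
Proof.
elim: d c b M => [|d IHd] c b M.
  rewrite /quad_var !big_ord0 !addr0.
  apply: has_mean_ext (has_mean_cst _ (c ^+ 2)) => x.
  by rewrite /quad_form !big_ord0 !addr0.
rewrite quad_var_recl; set m := M ord0 ord0.
apply: (has_mean_iid_lawSr (G := fun X => quad_form c (tl b) (tl2 M) X ^+ 2 +
  lin_form (b ord0) (cross M) X ^+ 2 + 2 * m ^+ 2)).
- by apply: measurable_funX; exact: measurable_quad_form.
- by move=> x; exact: sqr_ge0.
- move=> X; set A := quad_form c (tl b) (tl2 M) X.
  set B := lin_form (b ord0) (cross M) X.
  apply: has_mean_ext (has_mean_val _ (has_mean_gaussian_poly8 ((A - m) ^+ 2)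
    (2 * (A - m) * B) (B ^+ 2 + 2 * (A - m) * m) (2 * B * m)
    (m ^+ 2) 0 0 0 0)); last by ring.
  by move=> x; rewrite quad_form_cons -/A -/B -/m; ring.
- exact: has_meanD (has_meanD (IHd _ _ _) (has_mean_lin_form_sqr _ _)) (has_mean_cst _ _).
Qed.

(** By polarisation: the second moments at [c + 1] and [c - 1] differ by four times
    the mean. *)
Lemma has_mean_quad_form d c (b : 'I_d -> R) M :
  has_mean (gaussian d) (quad_form c b M) c.
Proof.
apply: has_mean_ext (has_mean_val _ (has_meanZ 4^-1
  (has_meanB (has_mean_quad_form_sqr (c + 1) b M)
             (has_mean_quad_form_sqr (c - 1) b M)))).
  by move=> x; rewrite /quad_form; field.
by rewrite /quad_var; field.
Qed.

(** Conditioning on all coordinates but one, [f = A + x B + (x^2 - 1) m] with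
    [A] quadratic and [B] linear in the others; the leading coefficients [1] of
    [E A^4] and [6] of [E A^2 B^2] are small enough for the induction to close
    once [E A^2 B^2] is bounded by Cauchy-Schwarz and the mixed terms
    [24 m A B^2] and [32 m^3 A] are absorbed. With [a] and [v] the second moments of
    [A] and [B], Cauchy-Schwarz gives [E A^2 B^2 <= sqrt (75 * 3) a v = 15 a v], and
    absorbing the mixed terms raises its coefficient to [9]; the constant [75] is
    such that [9 * 15 <= 2 * 75]. *)
Lemma quad_form_moment4 d c (b : 'I_d -> R) M :
  exists2 w, has_mean (gaussian d) (fun x => quad_form c b M x ^+ 4) w &
    w <= 75 * quad_var c b M ^+ 2.
Proof.
elim: d c b M => [|d IHd] c b M.
  exists (c ^+ 4); last first.
    by rewrite /quad_var !big_ord0 !addr0; have := sqr_ge0 (c ^+ 2); lra.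
  apply: has_mean_ext (has_mean_cst _ (c ^+ 4)) => x.
  by rewrite /quad_form !big_ord0 !addr0.
set m := M ord0 ord0.
pose A := quad_form c (tl b) (tl2 M); pose B := lin_form (b ord0) (cross M).
have [w4 A4 w4le] := IHd c (tl b) (tl2 M); rewrite -/A in A4.
have [u4 B4 u4le] := lin_form_moment4 (b ord0) (cross M); rewrite -/B in B4.
have A2 := has_mean_quad_form_sqr c (tl b) (tl2 M); rewrite -/A in A2.
have B2 := has_mean_lin_form_sqr (b ord0) (cross M); rewrite -/B in B2.
rewrite quad_var_recl -/m.
have a0 := quad_var_ge0 c (tl b) (tl2 M).
have b0 := lin_var_ge0 (b ord0) (cross M).
set a := quad_var _ _ _ in w4le A2 a0 *; set v := lin_var _ _ in u4le B2 b0 *.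
have mA : measurable_fun [set: Rvec R d] A by exact: measurable_quad_form.
have mB : measurable_fun [set: Rvec R d] B by exact: measurable_lin_form.
have [r AB] : exists r, has_mean (gaussian d) (fun X => A X ^+ 2 * B X ^+ 2) r.
  apply: (has_mean_dom _ _ (has_meanD A4 B4)).
    by apply: measurable_funM; exact: measurable_funX.
  move=> X; rewrite ger0_norm; last by apply: mulr_ge0; exact: sqr_ge0.
  have := sqr_ge0 (A X ^+ 2 - B X ^+ 2); have := sqr_ge0 (A X ^+ 2).
  by have := sqr_ge0 (B X ^+ 2); lra.
have rle : r <= 15 * (a * v).
  have r2 : r ^+ 2 <= w4 * u4.
    apply: (has_mean_cauchy_schwarz _ _ AB).
      by apply: has_mean_ext A4 => X; ring.
    by apply: has_mean_ext B4 => X; ring.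
  have u0 : 0 <= u4.
    by apply: has_mean_le (has_mean_cst _ 0) B4 _ => X; rewrite exprn_even_ge0.
  have : r ^+ 2 <= (15 * (a * v)) ^+ 2.
    apply: (le_trans r2); apply: le_trans (_ : (75 * a ^+ 2) * u4 <= _).
      exact: ler_wpM2r.
    have -> : (15 * (a * v)) ^+ 2 = 75 * a ^+ 2 * (3 * v ^+ 2) by ring.
    by apply: ler_wpM2l => //; rewrite mulr_ge0// sqr_ge0.
  have av : 0 <= 15 * (a * v) by rewrite !mulr_ge0.
  by have [r0|r0] := lerP 0 r; [rewrite ler_pXn2r// nnegrE|lra].
pose G X := A X ^+ 4 + 6 * (A X ^+ 2 * B X ^+ 2) + 12 * m ^+ 2 * A X ^+ 2 +
  24 * m * (A X * B X ^+ 2) + 32 * m ^+ 3 * A X + 3 * B X ^+ 4 +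
  60 * m ^+ 2 * B X ^+ 2 + 60 * m ^+ 4.
have hG X : has_mean gaussian1
    (fun x => quad_form c b M (cons_tuple x X) ^+ 4) (G X).
  rewrite /G; set AX := A X; set BX := B X.
  apply: has_mean_ext (has_mean_val _ (has_mean_gaussian_poly8 ((AX - m) ^+ 4)
    (4 * (AX - m) ^+ 3 * BX)
    (6 * (AX - m) ^+ 2 * BX ^+ 2 + 4 * (AX - m) ^+ 3 * m)
    (4 * (AX - m) * BX ^+ 3 + 12 * (AX - m) ^+ 2 * BX * m)
    (BX ^+ 4 + 12 * (AX - m) * BX ^+ 2 * m + 6 * (AX - m) ^+ 2 * m ^+ 2)
    (4 * BX ^+ 3 * m + 12 * (AX - m) * BX * m ^+ 2)
    (6 * BX ^+ 2 * m ^+ 2 + 4 * (AX - m) * m ^+ 3)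
    (4 * BX * m ^+ 3) (m ^+ 4))); last by ring.
  by move=> x; rewrite quad_form_cons -/(A X) -/(B X) -/AX -/BX -/m; ring.
have G0 X : 0 <= G X.
  by apply: has_mean_le (has_mean_cst _ 0) (hG X) _ => x; rewrite exprn_even_ge0.
have Gdom := has_meanD (has_meanD (has_meanD (has_meanD (has_meanD A4
  (has_meanZ 9 AB)) (has_meanZ (28 * m ^+ 2) A2)) (has_meanZ 3 B4))
  (has_meanZ (108 * m ^+ 2) B2)) (has_mean_cst _ (76 * m ^+ 4)).
have Gle X : G X <= A X ^+ 4 + 9 * (A X ^+ 2 * B X ^+ 2) + 28 * m ^+ 2 * A X ^+ 2 +
   3 * B X ^+ 4 + 108 * m ^+ 2 * B X ^+ 2 + 76 * m ^+ 4.
  (* 24 m A B^2 <= 3 A^2 B^2 + 48 m^2 B^2 and 32 m^3 A <= 16 m^2 A^2 + 16 m^4 *)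
  rewrite /G; have := sqr_ge0 (A X * B X - 4 * (m * B X)).
  by have := sqr_ge0 (m * A X - m ^+ 2); lra.
have mG : measurable_fun [set: Rvec R d] G.
  rewrite /G; repeat (apply: measurable_funD || apply: measurable_funM ||
    apply: measurable_funX) => //.
have [w Gw] : exists w, has_mean (gaussian d) G w.
  by apply: (has_mean_dom mG _ Gdom) => X; rewrite ger0_norm.
exists w.
  apply: (has_mean_iid_lawSr _ _ hG Gw).
    by apply: measurable_funX; exact: measurable_quad_form.
  by move=> X; rewrite exprn_even_ge0.
have := has_mean_le Gw Gdom Gle.
have am : 0 <= m ^+ 2 * a by rewrite mulr_ge0// sqr_ge0.
have vm : 0 <= m ^+ 2 * v by rewrite mulr_ge0// sqr_ge0.
have m4 : 0 <= m ^+ 4 by rewrite exprn_even_ge0.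
have av : 0 <= a * v by rewrite mulr_ge0.
have := sqr_ge0 v.
lra.
Qed.

End quadratic_forms.

(** * A smooth approximation of half-line indicators *)

Section taylor.
Context {R : realType}.
Implicit Types (f g h : R -> R) (u t : R).

Let mean_value f f' u t : (forall x, is_derive x (1 : R) f (f' x)) ->
  exists2 c, `|c - u| <= `|t| & f (u + t) - f u = f' c * t.
Proof.
move=> df; have cf a b : {within `[a, b], continuous f}.
  by apply: derivable_within_continuous => x _; have [] := df x.
have [t0|t0] := leP 0 t.
  have uut : u <= u + t by rewrite lerDl.
  have [c] := MVT_segment uut (fun x _ => df x) (cf _ _).
  rewrite in_itv/= => /andP[uc cu] fE; exists c; last by rewrite fE addrC addKr.
  by rewrite !ger0_norm ?subr_ge0//; lra.
have utu : u + t <= u by lra.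
have [c] := MVT_segment utu (fun x _ => df x) (cf _ _).
rewrite in_itv/= => /andP[uc cu] fE; exists c.
  by rewrite !ler0_norm//; lra.
by rewrite -opprB fE; ring.
Qed.

Let is_derive_subpoly f f' u p q x : is_derive x (1 : R) f (f' x) ->
  is_derive x (1 : R) (fun x => f x - (p * x + q * (x - u) ^+ 2))
    (f' x - (p + 2 * q * (x - u))).
Proof.
move=> df.
apply: (is_derive_eq (is_deriveB df (is_deriveD (is_deriveZ p (is_derive_id x 1))
  (is_deriveZ q (is_deriveX 2 (is_deriveB (is_derive_id x 1) (is_derive_cst u x 1))))))).
by rewrite !fctE /GRing.scale /=; ring.
Qed.

(** By three applications of the mean value theorem: to [f2], to [f1] minus its
    tangent at [u], and to [f] minus its second-order expansion at [u]. *)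
Lemma taylor2_bound f f1 f2 f3 (L : R) u t :
  (forall x, is_derive x (1 : R) f (f1 x)) -> (forall x, is_derive x (1 : R) f1 (f2 x)) ->
  (forall x, is_derive x (1 : R) f2 (f3 x)) -> (forall x, `|f3 x| <= L) ->
  `|f (u + t) - (f u + f1 u * t + f2 u / 2 * t ^+ 2)| <= L * `|t| ^+ 3.
Proof.
move=> df df1 df2 f3L; have L0 : 0 <= L by apply: le_trans (f3L 0).
have lip2 x : `|f2 x - f2 u| <= L * `|x - u|.
  have [c _] := mean_value u (x - u) df2; rewrite subrKC => ->.
  by rewrite normrM ler_wpM2r.
have lip1 x : `|f1 x - f1 u - f2 u * (x - u)| <= L * `|x - u| ^+ 2.
  have [c cu] := mean_value u (x - u) (fun x => is_derive_subpoly u (f2 u) 0 (df1 x)).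
  rewrite subrKC !mul0r !addr0 mulr0 mul0r addr0 => E.
  have -> : f1 x - f1 u - f2 u * (x - u) = f1 x - f2 u * x - (f1 u - f2 u * u) by ring.
  rewrite E normrM expr2 mulrA ler_wpM2r// (le_trans (lip2 c))// ler_wpM2l//.
have [c cu E] := mean_value u t (fun x => is_derive_subpoly u (f1 u) (f2 u / 2) (df x)).
have -> : f (u + t) - (f u + f1 u * t + f2 u / 2 * t ^+ 2) =
  f (u + t) - (f1 u * (u + t) + f2 u / 2 * (u + t - u) ^+ 2) -
  (f u - (f1 u * u + f2 u / 2 * (u - u) ^+ 2)) by ring.
rewrite E normrM (_ : L * `|t| ^+ 3 = L * `|t| ^+ 2 * `|t|); last by ring.
rewrite ler_wpM2r//.
have -> : f1 c - (f1 u + 2 * (f2 u / 2) * (c - u)) = f1 c - f1 u - f2 u * (c - u).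
  by field.
by rewrite (le_trans (lip1 c))// ler_wpM2l// ler_pXn2r ?nnegrE.
Qed.

End taylor.

Section logistic.
Context {R : realType}.

(** Any smooth step would serve; the derivatives of this one are polynomials in the
    function itself, so they are bounded without further computation. *)
Definition logistic (x : R) : R := (1 + expR (- x))^-1.

Lemma logistic_ge0 x : 0 <= logistic x.
Proof. by rewrite invr_ge0 ltW. Qed.

Lemma logistic_le1 x : logistic x <= 1.
Proof. by rewrite invf_le1// lerDl expR_ge0. Qed.

Lemma logistic_le_expR x : logistic x <= expR x.
Proof.
rewrite -[leRHS]invrK -expRN lef_pV2 ?posrE ?expR_gt0//.
by rewrite lerDr.
Qed.

Lemma logistic_ge_expR x : 1 - expR (- x) <= logistic x.
Proof.
rewrite /logistic -[leRHS]mul1r ler_pdivlMr//.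
have := sqr_ge0 (expR (- x)); lra.
Qed.

Let is_derive_logistic x : is_derive x (1 : R) logistic (logistic x - logistic x ^+ 2).
Proof.
have d0 : 1 + expR (- x) != 0 by rewrite gt_eqF.
have dE : is_derive x (1 : R) (fun y : R => 1 + expR (- y)) (- expR (- x)).
  apply: (is_derive_eq (is_deriveD (is_derive_cst (1 : R) x 1)
    (is_derive1_comp (is_derive_expR (- x)) (is_deriveNid x 1)))).
  by rewrite add0r mulrN1.
have -> : logistic = (fun y : R => (1 + expR (- y))^-1) by [].
apply: (is_derive_eq (@is_deriveV _ (fun y : R => 1 + expR (- y)) x _ _ d0 dE)).
rewrite /GRing.scale /=; set e := expR _ in d0 *.
by field.
Qed.

Let poly_logistic (a b c : R) x :
  is_derive x (1 : R)
    (fun y => a * logistic y + b * logistic y ^+ 2 + c * logistic y ^+ 3)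
    ((a + 2 * b * logistic x + 3 * c * logistic x ^+ 2) *
     (logistic x - logistic x ^+ 2)).
Proof.
have d := is_derive_logistic x.
apply: (is_derive_eq (is_deriveD (is_deriveD (is_deriveZ a d)
  (is_deriveZ b (is_deriveX 2 d))) (is_deriveZ c (is_deriveX 3 d)))).
by rewrite /GRing.scale /=; ring.
Qed.

Lemma logistic_taylor u t : `|logistic (u + t) - (logistic u +
   (logistic u - logistic u ^+ 2) * t +
   (logistic u - 3 * logistic u ^+ 2 + 2 * logistic u ^+ 3) / 2 * t ^+ 2)|
  <= `|t| ^+ 3.
Proof.
rewrite -[leRHS]mul1r.
apply: (@taylor2_bound _ logistic (fun x => logistic x - logistic x ^+ 2)
  (fun x => logistic x - 3 * logistic x ^+ 2 + 2 * logistic x ^+ 3)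
  (fun x => (1 - 6 * logistic x + 6 * logistic x ^+ 2) * (logistic x - logistic x ^+ 2))).
- exact: is_derive_logistic.
- move=> x; rewrite (_ : (fun x => logistic x - logistic x ^+ 2) = fun y =>
      1 * logistic y + -1 * logistic y ^+ 2 + 0 * logistic y ^+ 3).
    by apply: (is_derive_eq (poly_logistic _ _ _ x)); ring.
  by apply/funext => y; ring.
- move=> x.
  rewrite (_ : (fun x => logistic x - 3 * logistic x ^+ 2 + 2 * logistic x ^+ 3) =
      fun y => 1 * logistic y + -3 * logistic y ^+ 2 + 2 * logistic y ^+ 3).
    by apply: (is_derive_eq (poly_logistic _ _ _ x)); ring.
  by apply/funext => y; ring.
- move=> x; have := logistic_ge0 x; have := logistic_le1 x.
  set s := logistic x => s1 s0.
  have q0 : 0 <= s - s ^+ 2 by rewrite expr2 subr_ge0 ler_piMl.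
  have -> : 1 - 6 * s + 6 * s ^+ 2 = 1 - 6 * (s - s ^+ 2) by ring.
  have q1 : s - s ^+ 2 <= 1 / 4 by have := sqr_ge0 (s - 1 / 2); lra.
  by rewrite ler_norml; apply/andP; split; nra.
Qed.

Lemma continuous_logistic : continuous logistic.
Proof.
move=> x; have [/derivable1_diffP/differentiable_continuous h _] := is_derive_logistic x.
exact: h.
Qed.

End logistic.

(** * A uniform central limit theorem *)

Section fubini_mean.
Context {d1 d2 : measure_display} {T1 : measurableType d1} {T2 : measurableType d2}.
Context {R : realType}.
Variables (P : probability T1 R) (Q : probability T2 R).

(** The iterated means are delivered as real-valued functions, so that the rules of
    [has_mean] apply to both orders of integration. *)
Lemma fubini_mean (F : T1 * T2 -> R) :
  measurable_fun [set: T1 * T2] F -> (forall p, 0 <= F p <= 1) ->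
  exists G, exists H, exists v,
    [/\ forall x, has_mean Q (fun y => F (x, y)) (G x),
        forall y, has_mean P (fun x => F (x, y)) (H y),
        has_mean P G v & has_mean Q H v].
Proof.
move=> mF F01.
have mE : measurable_fun [set: T1 * T2] (fun p => (F p)%:E).
  exact/measurable_EFinP.
have E0 p : (0 <= (F p)%:E)%E by rewrite lee_fin; have /andP[] := F01 p.
have F1 p : `|F p| <= 1 by have /andP[F0 ?] := F01 p; rewrite ger0_norm.
have hG x : exists v, has_mean Q (fun y => F (x, y)) v.
  by apply: has_mean_bounded (fun y => F1 _); exact: (measurableT_comp mF).
have hH y : exists v, has_mean P (fun x => F (x, y)) v.
  by apply: has_mean_bounded (fun x => F1 _); exact: (measurableT_comp mF).
pose G x := sval (cid (hG x)); pose H y := sval (cid (hH y)).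
have GE x : has_mean Q (fun y => F (x, y)) (G x) by exact: svalP.
have HE y : has_mean P (fun x => F (x, y)) (H y) by exact: svalP.
have mG : measurable_fun [set: T1] G.
  apply/measurable_EFinP.
  rewrite (_ : EFin \o G = fubini_F Q (fun p => (F p)%:E)).
    exact: measurable_fun_fubini_tonelli_F.
  by apply/funext => x; rewrite /fubini_F /=; have [_ ->] := GE x.
have mH : measurable_fun [set: T2] H.
  apply/measurable_EFinP.
  rewrite (_ : EFin \o H = fubini_G P (fun p => (F p)%:E)).
    exact: measurable_fun_fubini_tonelli_G.
  by apply/funext => y; rewrite /fubini_G /=; have [_ ->] := HE y.
have G01 x : 0 <= G x <= 1.
  apply/andP; split.
    by apply: has_mean_le (has_mean_cst Q 0) (GE x) _ => y; have /andP[] := F01 (x, y).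
  by apply: has_mean_le (GE x) (has_mean_cst Q 1) _ => y; have /andP[] := F01 (x, y).
have H01 y : 0 <= H y <= 1.
  apply/andP; split.
    by apply: has_mean_le (has_mean_cst P 0) (HE y) _ => x; have /andP[] := F01 (x, y).
  by apply: has_mean_le (HE y) (has_mean_cst P 1) _ => x; have /andP[] := F01 (x, y).
have [v Gv] : exists v, has_mean P G v.
  apply: (has_mean_bounded P mG (_ : forall x, `|G x| <= 1)) => x.
  by have /andP[? ?] := G01 x; rewrite ger0_norm.
exists G, H, v; split=> //; apply: has_mean_ge0_integral => //.
  by move=> y; have /andP[] := H01 y.
have [_ <-] := Gv.
transitivity (\int[Q]_y \int[P]_x (F (x, y))%:E)%E.
  by apply: eq_integral => y _; have [_ ->] := HE y.
rewrite -(fubini_tonelli _ mE E0).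
by apply: eq_integral => x _; have [_ ->] := GE x.
Qed.

End fubini_mean.

Section lindeberg.
Context {d : measure_display} {T : measurableType d} {R : realType}.
Variables (P : probability T R) (y : T -> R) (rho rhoN : R).
Hypotheses (y1 : has_mean P y 0) (y2 : has_mean P (fun x => y x ^+ 2) 1).
Hypothesis (y3 : has_mean P (fun x => `|y x| ^+ 3) rho).
Hypothesis (z3 : has_mean (@gaussian1 R) (fun z => `|z| ^+ 3) rhoN).
Variables (g g1 g2 : R -> R) (L c : R).
Hypothesis c0 : 0 < c.
Hypotheses (cg : continuous g) (g01 : forall x, 0 <= g x <= 1).
Hypothesis gT : forall u t,
  `|g (u + t) - (g u + g1 u * t + g2 u * t ^+ 2)| <= L * `|t| ^+ 3.

Let mg : measurable_fun [set: R] g. Proof. exact: continuous_measurable_fun. Qed.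
(** Only the first two moments of a summand enter the Taylor expansion. *)
Let replace_one (d' : measure_display) (T' : measurableType d') (Q : probability T' R)
    (f : T' -> R) r w v :
  has_mean Q f 0 -> has_mean Q (fun x => f x ^+ 2) 1 ->
  has_mean Q (fun x => `|f x| ^+ 3) r ->
  has_mean Q (fun x => g (w + c * f x)) v ->
  `|v - (g w + g2 w * c ^+ 2)| <= L * c ^+ 3 * r.
Proof.
move=> f1 f2 f3 gv.
have main := has_meanD (has_meanD (has_mean_cst Q (g w)) (has_meanZ (g1 w * c) f1))
  (has_meanZ (g2 w * c ^+ 2) f2).
rewrite mulr0 addr0 mulr1 in main.
have rem := has_meanZ (L * c ^+ 3) f3.
have bnd x := gT w (c * f x).
have normc x : L * `|c * f x| ^+ 3 = L * c ^+ 3 * `|f x| ^+ 3.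
  by rewrite normrM (gtr0_norm c0); ring.
rewrite ler_norml; apply/andP; split.
  rewrite -lerBlDr opprK addrC.
  apply: (has_mean_le (has_meanB main rem) gv) => x.
  have := bnd x; rewrite normc ler_norml => /andP[+ _].
  by rewrite exprMn; lra.
rewrite lerBlDr addrC.
apply: (has_mean_le gv (has_meanD main rem)) => x.
have := bnd x; rewrite normc ler_norml => /andP[_].
by rewrite exprMn; lra.
Qed.

Let mean_le_dist (d' : measure_display) (T' : measurableType d') (Q : probability T' R)
    (f h : T' -> R) v w e : has_mean Q f v -> has_mean Q h w ->
  (forall x, `|f x - h x| <= e) -> `|v - w| <= e.
Proof.
move=> fv hw fh; rewrite ler_norml; apply/andP; split.
  rewrite -[v - w]opprB lerN2.
  apply: has_mean_le (has_meanB hw fv) (has_mean_cst Q e) _ => x.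
  by have := fh x; rewrite ler_norml => /andP[]; lra.
apply: has_mean_le (has_meanB fv hw) (has_mean_cst Q e) _ => x.
by have := fh x; rewrite ler_norml => /andP[].
Qed.

(** Lindeberg's replacement argument, by induction on the sample size: given the
    first observation, the others are replaced by a single Gaussian variable (the
    offset [u] carries what has been conditioned upon); then the first observation is
    replaced too, and the two Gaussian variables merge by stability. *)
Lemma lindeberg_replacement n u v w :
  has_mean (iid_law P n) (fun X => g (u + c * \sum_(i < n) y (tnth X i))) v ->
  has_mean (@gaussian1 R) (fun z => g (u + c * Num.sqrt n%:R * z)) w ->
  `|v - w| <= n%:R * (L * c ^+ 3 * (rho + rhoN)).
Proof.
elim: n u v w => [|n IHn] u v w hv hw.
  have -> : v = g u.
    apply: has_mean_uniq hv (has_mean_ext _ (has_mean_cst _ (g u))) => X.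
    by rewrite big_ord0 mulr0 addr0.
  have -> : w = g u.
    apply: has_mean_uniq hw (has_mean_ext _ (has_mean_cst _ (g u))) => z.
    by rewrite sqrtr0 mulr0 mul0r addr0.
  by rewrite subrr normr0 mul0r.
set e := L * c ^+ 3 * (rho + rhoN) in IHn *.
set s := c * Num.sqrt n%:R.
have my := has_mean_measurable y1.
have mS n' : measurable_fun [set: n'.-tuple T] (fun X => \sum_(i < n') y (tnth X i)).
  exact: measurable_coord_sum.
(* [v'] is [v], computed by integrating the last [n] observations first *)
have [|p|G [_ [v' [hG _ Gv' _]]]] := @fubini_mean _ _ _ _ _ P (iid_law P n)
    (fun p => g (u + c * (y p.1 + \sum_(i < n) y (tnth p.2 i)))).
- apply: measurableT_comp => //; apply: measurable_funD => //.
  apply: measurable_funM => //; apply: measurable_funD.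
    exact: (measurableT_comp my measurable_fst).
  exact: (measurableT_comp (mS n)).
- exact: g01.
have vE : v = v'.
  apply: has_mean_uniq hv _.
  apply: (has_mean_iid_lawSl _ _ _ Gv').
  - apply: measurableT_comp => //; apply: measurable_funD => //.
    by apply: measurable_funM => //; exact: (mS n.+1).
  - by move=> X; have /andP[] := g01 (u + c * \sum_(i < n.+1) y (tnth X i)).
  - by move=> x; apply: has_mean_ext (hG x) => X; rewrite sum_tnth_cons.
(* [k]: the last [n] observations replaced by [s] times a Gaussian variable *)
have [|p|H [J [k [hH hJ Hk Jk]]]] := @fubini_mean _ _ _ _ _ P (@gaussian1 R)
    (fun p => g (u + c * y p.1 + s * p.2)).
- apply: measurableT_comp => //; apply: measurable_funD.
    apply: measurable_funD => //; apply: measurable_funM => //.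
    exact: (measurableT_comp my measurable_fst).
  exact: measurable_funM.
- exact: g01.
have vk : `|v - k| <= n%:R * e.
  rewrite vE; apply: (mean_le_dist Gv' Hk) => x.
  apply: (IHn (u + c * y x)); last exact: hH.
  by apply: has_mean_ext (hG x) => X; congr g; ring.
(* [k']: the first observation replaced as well *)
have [|p|J' [_ [k' [hJ' _ Jk' _]]]] := @fubini_mean _ _ _ _ _ (@gaussian1 R)
    (@gaussian1 R) (fun p => g (u + s * p.1 + c * p.2)).
- apply: measurableT_comp => //; apply: measurable_funD.
    by apply: measurable_funD => //; apply: measurable_funM.
  exact: measurable_funM.
- exact: g01.
have kk' : `|k - k'| <= e.
  apply: (mean_le_dist Jk Jk') => z; set wz := u + s * z.
  have g1z : has_mean (@gaussian1 R) (fun x => x) 0.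
    have := has_mean_gaussian_moment (R := R) (isT : 1 <= 8)%N.
    by rewrite gaussian_moment_odd.
  have g2z : has_mean (@gaussian1 R) (fun x => x ^+ 2) 1.
    by have := has_mean_gaussian_moment (R := R) (isT : 2 <= 8)%N; rewrite gaussian_moment2.
  have r1 := @replace_one _ _ P y rho wz (J z) y1 y2 y3.
  have r2 := @replace_one _ _ (@gaussian1 R) (fun x => x) rhoN wz (J' z) g1z g2z z3 (hJ' z).
  have {}r1 := r1 (has_mean_ext (fun x => congr1 g (addrAC _ _ _)) (hJ z)).
  rewrite -(subrKA (g wz + g2 wz * c ^+ 2)) (le_trans (ler_normD _ _))//.
  by rewrite (distrC (g wz + _)) /e mulrDr lerD.
have wE : k' = w.
  have S0 : 0 < c * Num.sqrt n.+1%:R by rewrite mulr_gt0// sqrtr_gt0 ltr0n.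
  apply: (@gaussian_convolution_mean _ s c (c * Num.sqrt n.+1%:R) (fun x => g (u + x)) J' _ _ c0 S0 _ _ _ _ Jk').
  - have sq k0 : Num.sqrt k0%:R ^+ 2 = k0%:R :> R by rewrite sqr_sqrtr// ler0n.
    by rewrite /s 2!exprMn !sq -[in LHS]natr1 mulrDr mulr1.
  - by move=> x; apply: (@continuous_comp _ _ _ (fun x => u + x) g); [apply: cvgD; [exact: cvg_cst|exact: cvg_id]|exact: cg].
  - by move=> x; have /andP[] := g01 (u + x).
  - by move=> z; apply: has_mean_ext (hJ' z) => x; rewrite addrA.
  - exact: hw.
rewrite -wE -(subrKA k) (le_trans (ler_normD _ _))//.
by rewrite -natr1 mulrDl mul1r lerD.
Qed.

End lindeberg.

Section gaussian_tail.
Context {R : realType}.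

Definition gaussian_tail (t : R) : R := pr (@gaussian1 R) [set z : R | t < z].

Let measurable_gt (t : R) : measurable [set z : R | t < z].
Proof. by rewrite -set_itvoy; exact: measurable_itv. Qed.

Let normal_pdf_le1 (x : R) : normal_pdf 0 1 x <= 1.
Proof.
apply: (le_trans (normal_pdf_ub 0 x (oner_neq0 R))).
rewrite /normal_peak invf_le1 ?sqrtr_gt0 ?expr1n ?mul1r.
  rewrite -[leLHS]sqrtr1 ler_wsqrtr//.
  by have := @pi_ge2 R; rewrite -mulr_natr; lra.
by rewrite mulrn_wgt0// pi_gt0.
Qed.

(** The Gaussian density is at most one, so an interval of length [h] has
    probability at most [h]. *)
Lemma gaussian_tail_lipschitz (t h : R) : 0 <= h ->
  gaussian_tail t <= gaussian_tail (t + h) + h.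
Proof.
move=> h0.
have mI : measurable [set` `]t, t + h]] by exact: measurable_itv.
have le_h : pr (@gaussian1 R) [set` `]t, t + h]] <= h.
  rewrite -lee_fin -prE//.
  have ub : (gaussian1 [set` `]t, (t + h)%R]] <=
      \int[@lebesgue_measure R]_(x in [set` `]t, (t + h)%R]]) (cst 1 x))%E.
    apply: ge0_le_integral => //=.
    - by move=> x _; rewrite lee_fin normal_pdf_ge0.
    - by apply/measurable_EFinP; apply: measurable_funTS; exact: measurable_normal_pdf.
    - by move=> x _; rewrite lee_fin.
  apply: (le_trans ub).
  rewrite integral_cst//= mul1e lebesgue_measure_itv/= lte_fin ltrDl.
  by case: ltrP => h'; rewrite ?lee_fin// addrC addKr.
apply: le_trans (lerD (lexx _) le_h); rewrite /gaussian_tail.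
apply: (has_mean_le (has_mean_indic (@gaussian1 R) (measurable_gt t))
  (has_meanD (has_mean_indic (@gaussian1 R) (measurable_gt (t + h)))
    (has_mean_indic (@gaussian1 R) mI))) => x.
rewrite !indic_bool in_itv/=.
by case: (ltrP t x) => tx; case: (ltrP (t + h) x) => thx /=; lra.
Qed.

End gaussian_tail.

Section clt.
Context {d : measure_display} {T : measurableType d} {R : realType}.
Variables (P : probability T R) (y : T -> R) (w C : R).
Hypotheses (y1 : has_mean P y 0) (y2 : has_mean P (fun x => y x ^+ 2) 1).
Hypotheses (y4 : has_mean P (fun x => y x ^+ 4) w) (wC : w <= C).

Let my : measurable_fun [set: T] y. Proof. exact: has_mean_measurable y1. Qed.

Let cube_le (a : R) : `|a| ^+ 3 <= 1 + a ^+ 4.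
Proof.
have -> : a ^+ 4 = `|a| ^+ 4 by rewrite -normrX ger0_norm// exprn_even_ge0.
have := normr_ge0 a; set b := `|a| => b0.
have := sqr_ge0 (b ^+ 2 - b / 2 - 1 / 2); have := sqr_ge0 (b - 1 / 3).
lra.
Qed.

Let expR_Ninv_le (e : R) : 0 < e -> expR (- e^-1) <= e.
Proof.
move=> e0; rewrite expRN -[leRHS]invrK lef_pV2 ?posrE ?expR_gt0 ?invr_gt0//.
by apply: le_trans (expR_ge1Dx _); rewrite lerDr.
Qed.

(** The term [4 e] pays for smoothing the indicator at scale [e]. In the other one,
    [e ^- 6] is the cube of the scaling [e ^- 2] in [smooth], and [C + 5] bounds
    the sum of the absolute third moments, at most [1 + C] for [y] and [1 + 3]
    for the Gaussian law. *)
Definition clt_error (n : nat) (e : R) : R :=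
  4 * e + e ^- 6 * (C + 5) / Num.sqrt n%:R.

(** The scaling is [e ^- 2] rather than [e ^- 1]: at distance [e] from [t] the logistic
    step is then within [expR (- e^-1) <= e] of its limit. *)
Let smooth (e t x : R) := logistic (e ^- 2 * (x - t)).

Let smooth01 e t x : 0 <= smooth e t x <= 1.
Proof. by rewrite logistic_ge0 logistic_le1. Qed.

Let continuous_smooth e t : continuous (smooth e t).
Proof.
move=> x; apply: (@continuous_comp _ _ _ (fun x => e ^- 2 * (x - t)) logistic).
  apply: cvgM; first exact: cvg_cst.
  by apply: cvgB; [exact: cvg_id|exact: cvg_cst].
exact: continuous_logistic.
Qed.

Let smooth_right (e t x : R) : 0 < e -> t + e <= x -> 1 - e <= smooth e t x.
Proof.
move=> e0 tx; apply: le_trans (logistic_ge_expR _); rewrite lerD2l lerN2.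
apply: le_trans (expR_Ninv_le e0); rewrite ler_expR lerN2.
have -> : e^-1 = e ^- 2 * e by field; rewrite gt_eqF.
have e2 : 0 <= e ^- 2 by rewrite invr_ge0 exprn_ge0// ltW.
by rewrite ler_wpM2l//; lra.
Qed.

Let smooth_left (e t x : R) : 0 < e -> x <= t - e -> smooth e t x <= e.
Proof.
move=> e0 tx; apply: le_trans (logistic_le_expR _) _.
apply: le_trans (expR_Ninv_le e0); rewrite ler_expR.
have -> : - e^-1 = e ^- 2 * (- e) by field; rewrite gt_eqF.
have e2 : 0 <= e ^- 2 by rewrite invr_ge0 exprn_ge0// ltW.
by rewrite ler_wpM2l//; lra.
Qed.

Let nsum n (X : n.-tuple T) := (Num.sqrt n%:R)^-1 * \sum_(i < n) y (tnth X i).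

Let measurable_nsum n : measurable_fun [set: n.-tuple T] (@nsum n).
Proof. by apply: measurable_funM => //; exact: measurable_coord_sum. Qed.

Let measurable_gt_nsum n t : measurable [set X : n.-tuple T | t < nsum X].
Proof.
have : measurable_fun [set: n.-tuple T] (fun X => t < nsum X).
  by apply: measurable_fun_ltr => //; exact: measurable_nsum.
by move=> /(_ measurableT [set true] I); rewrite setTI.
Qed.

Let smooth_dist (n : nat) (e t v u : R) : (0 < n)%N -> 0 < e ->
  has_mean (iid_law P n) (fun X => smooth e t (nsum X)) v ->
  has_mean (@gaussian1 R) (smooth e t) u ->
  `|v - u| <= e ^- 6 * (C + 5) / Num.sqrt n%:R.
Proof.
move=> n0 e0 hv hu.
have s0 : 0 < Num.sqrt n%:R :> R by rewrite sqrtr_gt0 ltr0n.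
have [rho y3] : exists rho, has_mean P (fun x => `|y x| ^+ 3) rho.
  apply: (has_mean_dom _ _ (has_meanD (has_mean_cst P 1) y4)) => [|x].
    by apply: measurable_funX; apply: measurableT_comp.
  by rewrite ger0_norm ?exprn_ge0.
have rhoC : rho <= 1 + C.
  apply: le_trans (_ : rho <= 1 + w) _; last by rewrite lerD2l.
  by apply: has_mean_le y3 (has_meanD (has_mean_cst P 1) y4) _ => x.
have z4 := has_mean_gaussian_moment (R := R) (isT : 4 <= 8)%N.
rewrite gaussian_moment4 in z4.
have [rhoN z3] : exists rho, has_mean (@gaussian1 R) (fun z : R => `|z| ^+ 3) rho.
  apply: (has_mean_dom _ _ (has_meanD (has_mean_cst _ 1) z4)) => [|x].
    by apply: measurable_funX; exact: normr_measurable.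
  by rewrite ger0_norm ?exprn_ge0.
have rhoN4 : rhoN <= 4.
  apply: le_trans (_ : rhoN <= 1 + 3) _; last by lra.
  by apply: has_mean_le z3 (has_meanD (has_mean_cst _ 1) z4) _ => x.
have s1 : e ^- 6 = (e ^- 2) ^+ 3 by rewrite exprVn -exprM.
have e2 : 0 < e ^- 2 by rewrite invr_gt0 exprn_gt0.
pose d1 x := (logistic (e ^- 2 * (x - t)) - logistic (e ^- 2 * (x - t)) ^+ 2) * e ^- 2.
pose d2 x := (logistic (e ^- 2 * (x - t)) - 3 * logistic (e ^- 2 * (x - t)) ^+ 2 +
  2 * logistic (e ^- 2 * (x - t)) ^+ 3) / 2 * (e ^- 2) ^+ 2.
have taylor (a b : R) :
    `|smooth e t (a + b) - (smooth e t a + d1 a * b + d2 a * b ^+ 2)|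
    <= e ^- 6 * `|b| ^+ 3.
  have := logistic_taylor (e ^- 2 * (a - t)) (e ^- 2 * b).
  rewrite normrM (gtr0_norm e2) exprMn s1 /smooth /d1 /d2.
  have -> : e ^- 2 * (a + b - t) = e ^- 2 * (a - t) + e ^- 2 * b by ring.
  by rewrite !mulrA exprMn !mulrA.
have c0 : 0 < (Num.sqrt n%:R)^-1 :> R by rewrite invr_gt0.
have := @lindeberg_replacement _ _ _ P y rho rhoN y1 y2 y3 z3 (smooth e t) d1 d2
  (e ^- 6) (Num.sqrt n%:R)^-1 c0 (@continuous_smooth e t) (smooth01 e t) taylor n 0 v u.
rewrite mulVf ?gt_eqF//.
move=> h; apply: le_trans (h _ _) _.
- by apply: has_mean_ext hv => X; rewrite add0r.
- by apply: has_mean_ext hu => z; rewrite add0r mul1r.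
have -> : n%:R * (e ^- 6 * (Num.sqrt n%:R)^-1 ^+ 3 * (rho + rhoN)) =
    e ^- 6 * (rho + rhoN) / Num.sqrt n%:R.
  by rewrite -{1}[n%:R](@sqr_sqrtr R)//; field; rewrite !gt_eqF.
have e6 : 0 <= e ^- 6 by rewrite invr_ge0 exprn_ge0// ltW.
by rewrite (ler_wpM2r (ltW c0))// (ler_wpM2l e6)//; lra.
Qed.

Lemma clt_upper (n : nat) (t e : R) : (0 < n)%N -> 0 < e ->
  pr (iid_law P n) [set X | t < (Num.sqrt n%:R)^-1 * \sum_(i < n) y (tnth X i)] <=
  gaussian_tail t + clt_error n e.
Proof.
move=> n0 e0.
have [v hv] : exists v, has_mean (iid_law P n) (fun X => smooth e (t - e) (nsum X)) v.
  apply: has_mean_bounded (_ : forall X, _ <= 1) => [|X].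
    apply: measurableT_comp; last exact: measurable_nsum.
    by apply: continuous_measurable_fun; exact: continuous_smooth.
  by have /andP[? ?] := smooth01 e (t - e) (nsum X); rewrite ger0_norm.
have [u hu] : exists u, has_mean (@gaussian1 R) (smooth e (t - e)) u.
  apply: has_mean_bounded (_ : forall X, _ <= 1) => [|X].
    by apply: continuous_measurable_fun; exact: continuous_smooth.
  by have /andP[? ?] := smooth01 e (t - e) X; rewrite ger0_norm.
have pv : pr (iid_law P n) [set X | t < nsum X] <= v + e.
  apply: (pr_le_mean (@measurable_gt_nsum n t) (has_meanD hv (has_mean_cst _ e))) => X.
    by have /andP[? ?] := smooth01 e (t - e) (nsum X); rewrite addr_ge0// ltW.
  by move=> tX; have := @smooth_right e (t - e) (nsum X) e0; rewrite subrK => /(_ (ltW tX)); lra.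
have mt : measurable [set z : R | t - 2 * e < z].
  by rewrite -set_itvoy; exact: measurable_itv.
have ut : u <= gaussian_tail (t - 2 * e) + e.
  rewrite /gaussian_tail.
  apply: (has_mean_le hu (has_meanD (has_mean_indic (@gaussian1 R) mt) (has_mean_cst _ e))) => z.
  rewrite indic_bool; case: ltrP => tz.
    by have /andP[_ ?] := smooth01 e (t - e) z; lra.
  by rewrite add0r; apply: smooth_left => //; lra.
have e20 : 0 <= 2 * e by lra.
have := gaussian_tail_lipschitz (t - 2 * e) e20; rewrite subrK.
have := smooth_dist n0 e0 hv hu; rewrite ler_norml => /andP[_].
rewrite /clt_error; lra.
Qed.

Lemma clt_lower (n : nat) (t e : R) : (0 < n)%N -> 0 < e ->
  gaussian_tail t - clt_error n e <=
  pr (iid_law P n) [set X | t < (Num.sqrt n%:R)^-1 * \sum_(i < n) y (tnth X i)].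
Proof.
move=> n0 e0.
have [v hv] : exists v, has_mean (iid_law P n) (fun X => smooth e (t + e) (nsum X)) v.
  apply: has_mean_bounded (_ : forall X, _ <= 1) => [|X].
    apply: measurableT_comp; last exact: measurable_nsum.
    by apply: continuous_measurable_fun; exact: continuous_smooth.
  by have /andP[? ?] := smooth01 e (t + e) (nsum X); rewrite ger0_norm.
have [u hu] : exists u, has_mean (@gaussian1 R) (smooth e (t + e)) u.
  apply: has_mean_bounded (_ : forall X, _ <= 1) => [|X].
    by apply: continuous_measurable_fun; exact: continuous_smooth.
  by have /andP[? ?] := smooth01 e (t + e) X; rewrite ger0_norm.
have pv : v <= pr (iid_law P n) [set X | t < nsum X] + e.
  apply: has_mean_le hv (has_meanD (has_mean_indic _ (@measurable_gt_nsum n t)) (has_mean_cst _ e)) _ => X.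
  rewrite indic_bool; case: ltrP => tz.
    by have /andP[_ ?] := smooth01 e (t + e) (nsum X); lra.
  by rewrite add0r; apply: smooth_left => //; lra.
have mt : measurable [set z : R | t + 2 * e < z].
  by rewrite -set_itvoy; exact: measurable_itv.
have ut : gaussian_tail (t + 2 * e) <= u + e.
  rewrite /gaussian_tail; apply: (@pr_le_mean _ _ _ (@gaussian1 R) _ _ _ mt
    (has_meanD hu (has_mean_cst _ e))) => z.
    by have /andP[? ?] := smooth01 e (t + e) z; rewrite addr_ge0// ltW.
  move=> /= tz; have := @smooth_right e (t + e) z e0; rewrite -addrA => h.
  by have := h ltac:(lra); lra.
have e20 : 0 <= 2 * e by lra.
have := gaussian_tail_lipschitz t e20.
have := smooth_dist n0 e0 hv hu; rewrite ler_norml => /andP[+ _].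
rewrite /clt_error; lra.
Qed.

End clt.

(** * Studentisation *)

Section studentized.
Context {R : realType}.

Definition emean m (Y : 'I_m -> R) : R := m%:R^-1 * \sum_i Y i.

Definition evar m (Y : 'I_m -> R) : R := m%:R^-1 * \sum_i (Y i - emean Y) ^+ 2.

Definition tstat m (Y : 'I_m -> R) : R := Num.sqrt m%:R * emean Y / Num.sqrt (evar Y).

Lemma evarE m (Y : 'I_m -> R) : (0 < m)%N ->
  evar Y = m%:R^-1 * \sum_i Y i ^+ 2 - emean Y ^+ 2.
Proof.
move=> m0; have m_neq0 : m%:R != 0 :> R by rewrite pnatr_eq0 -lt0n.
have SE : \sum_i Y i = m%:R * emean Y by rewrite /emean mulrA mulfV// mul1r.
rewrite /evar; set e := emean Y in SE *.
have -> : \sum_i (Y i - e) ^+ 2 = \sum_i Y i ^+ 2 - 2 * e * \sum_i Y i + m%:R * e ^+ 2.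
  rewrite (eq_bigr (fun i => Y i ^+ 2 + - (2 * e) * Y i + e ^+ 2)).
    by rewrite !big_split /= -mulr_sumr sumr_const card_ord -[e ^+ 2 *+ m]mulr_natl mulNr.
  by move=> i _; ring.
by rewrite SE; field.
Qed.

Lemma evar_ge0 m (Y : 'I_m -> R) : 0 <= evar Y.
Proof.
by rewrite mulr_ge0 ?invr_ge0 ?ler0n// sumr_ge0// => i _; exact: sqr_ge0.
Qed.

Lemma emeanZ m (k : R) (Y : 'I_m -> R) : emean (fun i => k * Y i) = k * emean Y.
Proof. by rewrite /emean -mulr_sumr mulrCA. Qed.

Lemma evarZ m (k : R) (Y : 'I_m -> R) : evar (fun i => k * Y i) = k ^+ 2 * evar Y.
Proof.
rewrite /evar emeanZ [RHS]mulrCA; congr (_ * _); rewrite mulr_sumr; apply: eq_bigr => i _.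
by rewrite -mulrBr exprMn.
Qed.

Lemma tstatZ m (k : R) (Y : 'I_m -> R) : 0 < k -> tstat (fun i => k * Y i) = tstat Y.
Proof.
move=> k0; rewrite /tstat emeanZ evarZ sqrtrM ?sqr_ge0// sqrtr_sqr gtr0_norm//.
by rewrite invfM; set s := (Num.sqrt (evar Y))^-1; field; rewrite gt_eqF.
Qed.

Lemma sqrtr_dist1 (a e : R) : 0 <= a -> `|a - 1| <= e -> `|Num.sqrt a - 1| <= e.
Proof.
move=> a0; apply: le_trans; have s0 := sqrtr_ge0 a.
have -> : a - 1 = (Num.sqrt a - 1) * (Num.sqrt a + 1).
  by rewrite -{1}(sqr_sqrtr a0); ring.
by rewrite normrM ler_peMr//; apply: le_trans (ler_norm _); rewrite lerDr.
Qed.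

End studentized.

Section student_clt.
Context {d : measure_display} {T : measurableType d} {R : realType}.
Implicit Types (P : probability T R) (y : T -> R).

Lemma measurable_emean m y : measurable_fun [set: T] y ->
  measurable_fun [set: m.-tuple T] (fun X => emean (fun i => y (tnth X i))).
Proof. by move=> my; apply: measurable_funM => //; exact: measurable_coord_sum. Qed.

Lemma measurable_evar m y : measurable_fun [set: T] y ->
  measurable_fun [set: m.-tuple T] (fun X => evar (fun i => y (tnth X i))).
Proof.
move=> my; apply: measurable_funM => //; apply: measurable_sum => i.
apply: measurable_funX; apply: measurable_funB; last exact: measurable_emean.
exact: measurable_coord.
Qed.

(** Inversion is not continuous at [0]; writing [x^-1] as [x * (x ^+ 2) `^ (-1)],
    valid at [0] too, reduces it to a measurable power. *)
Lemma measurable_inv_fun (d' : measure_display) (T' : measurableType d') (f : T' -> R) :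
  measurable_fun [set: T'] f -> measurable_fun [set: T'] (fun x => (f x)^-1).
Proof.
move=> mf; rewrite (_ : (fun x => _) = fun x => f x * (f x ^+ 2) `^ (-1)).
  apply: measurable_funM => //.
  by apply: (measurableT_comp (measurable_powR _)); exact: measurable_funX.
apply/funext => x; rewrite powR_inv1 ?sqr_ge0//.
by have [->|fx0] := eqVneq (f x) 0; [rewrite invr0 mul0r|field].
Qed.

Lemma measurable_sqrt_fun (d' : measure_display) (T' : measurableType d') (f : T' -> R) :
  measurable_fun [set: T'] f -> measurable_fun [set: T'] (fun x => Num.sqrt (f x)).
Proof.
by move=> mf; apply: measurableT_comp => //; apply: continuous_measurable_fun; exact: sqrt_continuous.
Qed.

Lemma measurable_tstat m y : measurable_fun [set: T] y ->
  measurable_fun [set: m.-tuple T] (fun X => tstat (fun i => y (tnth X i))).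
Proof.
move=> my; apply: measurable_funM.
  by apply: measurable_funM => //; exact: measurable_emean.
by apply: measurable_inv_fun; apply: measurable_sqrt_fun; exact: measurable_evar.
Qed.

Lemma measurable_lt_set (d' : measure_display) (T' : measurableType d') (f g : T' -> R) :
  measurable_fun [set: T'] f -> measurable_fun [set: T'] g ->
  measurable [set x | f x < g x].
Proof.
move=> mf mg; have := measurable_fun_ltr mf mg.
by move=> /(_ measurableT [set true] I); rewrite setTI.
Qed.

Section normalized.
Variables (P : probability T R) (y : T -> R) (w C : R).
Hypotheses (y1 : has_mean P y 0) (y2 : has_mean P (fun x => y x ^+ 2) 1).
Hypotheses (y4 : has_mean P (fun x => y x ^+ 4) w) (wC : w <= C).

Let my : measurable_fun [set: T] y. Proof. exact: has_mean_measurable y1. Qed.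

Let Y m (X : m.-tuple T) : 'I_m -> R := fun i => y (tnth X i).

Let far m (e : R) := [set X : m.-tuple T | e < `|evar (Y X) - 1|].

Let measurable_far m (e : R) : measurable (@far m e).
Proof.
apply: measurable_lt_set => //; apply: measurableT_comp => //.
by apply: measurable_funB => //; exact: measurable_evar.
Qed.

(** The deviation [evar - 1] is the mean of [y^2 - 1] minus the squared mean of [y];
    Chebyshev's inequality bounds the first term, Markov's the second. *)
Lemma evar_concentration (m : nat) (e : R) : (0 < m)%N -> 0 < e <= 1 ->
  pr (iid_law P m) [set X | e < `|evar (fun i => y (tnth X i)) - 1|] <=
  (4 * C + 2) / (m%:R * e ^+ 2).
Proof.
move=> m0 /andP[e0 e1]; have m_gt0 : 0 < m%:R :> R by rewrite ltr0n.
have q1 : has_mean P (fun x => y x ^+ 2 - 1) 0.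
  by apply: has_mean_val (has_meanB y2 (has_mean_cst P 1)); rewrite subrr.
have q2 : has_mean P (fun x => (y x ^+ 2 - 1) ^+ 2) (w - 1).
  apply: has_mean_ext (has_mean_val _ (has_meanD (has_meanB y4 (has_meanZ 2 y2))
    (has_mean_cst P 1))); last by ring.
  by move=> x; ring.
have S1 := has_mean_iid_sum_sqr m y1 y2.
have S2 := has_mean_iid_sum_sqr m q1 q2.
apply: le_trans (_ : 4 / e ^+ 2 / m%:R ^+ 2 * (m%:R * (w - 1)) +
  2 / e / m%:R ^+ 2 * (m%:R * 1) <= _).
  have mF : measurable [set X : m.-tuple T | e < `|evar (fun i => y (tnth X i)) - 1|].
    exact: measurable_far.
  apply: (pr_le_mean mF (has_meanD (has_meanZ (4 / e ^+ 2 / m%:R ^+ 2) S2)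
    (has_meanZ (2 / e / m%:R ^+ 2) S1))) => X.
    by rewrite addr_ge0// mulr_ge0 ?sqr_ge0// !divr_ge0 ?sqr_ge0// ltW.
  move=> /= eX.
  set S := \sum_i y (tnth X i); set Q := \sum_i (y (tnth X i) ^+ 2 - 1).
  have evE : evar (Y X) - 1 = Q / m%:R - (S / m%:R) ^+ 2.
    rewrite evarE// /emean -/S /Q sumrB sumr_const card_ord -[1 *+ m]/(m%:R).
    by field; rewrite gt_eqF.
  have -> : 4 / e ^+ 2 / m%:R ^+ 2 * Q ^+ 2 = (2 * (Q / m%:R) / e) ^+ 2.
    by field; rewrite !gt_eqF.
  have -> : 2 / e / m%:R ^+ 2 * S ^+ 2 = 2 * (S / m%:R) ^+ 2 / e.
    by field; rewrite !gt_eqF.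
  move: eX; rewrite evE; set a := Q / _; set b := (S / _) ^+ 2 => eX.
  have b0 : 0 <= b by exact: sqr_ge0.
  have [ea|ea] := leP e (2 * `|a|).
    have : 1 <= (2 * a / e) ^+ 2.
      rewrite -[(_ / _) ^+ 2]ger0_norm ?sqr_ge0// normrX expr_ge1//.
      by rewrite normrM normfV (gtr0_norm e0) ler_pdivlMr// mul1r normrM ger0_norm.
    have : 0 <= 2 * b / e by apply: divr_ge0; [exact: mulr_ge0|exact: ltW].
    lra.
  have : 1 <= 2 * b / e.
    rewrite ler_pdivlMr// mul1r; have := ler_normB a b; rewrite (ger0_norm b0); lra.
  by have := sqr_ge0 (2 * a / e); lra.
have -> : 4 / e ^+ 2 / m%:R ^+ 2 * (m%:R * (w - 1)) + 2 / e / m%:R ^+ 2 * (m%:R * 1) =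
   (4 * (w - 1) + 2 * e) / (m%:R * e ^+ 2) by field; rewrite !gt_eqF.
have q0 : 0 <= (m%:R * e ^+ 2)^-1 by rewrite invr_ge0 mulr_ge0 ?sqr_ge0// ler0n.
by rewrite (ler_wpM2r q0)//; have := wC; lra.
Qed.

Let sqrtm_emean m X : (0 < m)%N ->
  Num.sqrt m%:R * emean (@Y m X) = (Num.sqrt m%:R)^-1 * \sum_(i < m) y (tnth X i).
Proof.
move=> m0; rewrite /emean mulrA; congr (_ * _).
have s0 : 0 < Num.sqrt m%:R :> R by rewrite sqrtr_gt0 ltr0n.
by rewrite -{2}[m%:R](@sqr_sqrtr R) ?ler0n//; field; rewrite gt_eqF.
Qed.

(** The last two terms pay for replacing the empirical standard deviation by one up
    to [h]: a shift of the threshold by [|t| h], outside an exceptional event. *)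
Definition student_error (m : nat) (t e h : R) : R :=
  clt_error C m e + `|t| * h + (4 * C + 2) / (m%:R * h ^+ 2).

Lemma student_clt_bound (m : nat) (t e h : R) : (0 < m)%N -> 0 < e -> 0 < h < 1 ->
  `|pr (iid_law P m) [set X | t < tstat (fun i => y (tnth X i))] - gaussian_tail t|
  <= student_error m t e h.
Proof.
move=> m0 e0 /andP[h0 h1].
have mt : measurable [set X : m.-tuple T | t < tstat (fun i => y (tnth X i))].
  by apply: measurable_lt_set => //; exact: measurable_tstat.
have mn s : measurable [set X : m.-tuple T |
    s < (Num.sqrt m%:R)^-1 * \sum_(i < m) y (tnth X i)].
  apply: measurable_lt_set => //; apply: measurable_funM => //.
  exact: measurable_coord_sum.
have farle := @evar_concentration m h m0; rewrite h0 ltW// in farle.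
have {}farle := farle isT.
have th0 : 0 <= `|t| * h by rewrite mulr_ge0// ltW.
(* away from the exceptional event, dividing by the empirical standard deviation
   moves the threshold by at most |t| h *)
have near_sd X : ~~ (h < `|evar (Y X) - 1|) ->
    [/\ 0 < Num.sqrt (evar (Y X)), t - `|t| * h <= t * Num.sqrt (evar (Y X)) &
        t * Num.sqrt (evar (Y X)) <= t + `|t| * h].
  rewrite -leNgt => hX; have := sqrtr_dist1 (evar_ge0 (Y X)) hX.
  set s := Num.sqrt _ => sh.
  have tsh : `|t * s - t| <= `|t| * h.
    have -> : t * s - t = t * (s - 1) by ring.
    by rewrite normrM ler_wpM2l.
  move: sh tsh; rewrite !ler_norml => /andP[? ?] /andP[? ?]; split; lra.
have up := @clt_upper _ _ _ P y w C y1 y2 y4 wC m (t - `|t| * h) e m0 e0.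
have lo := @clt_lower _ _ _ P y w C y1 y2 y4 wC m (t + `|t| * h) e m0 e0.
have tail_up := gaussian_tail_lipschitz (t - `|t| * h) th0; rewrite subrK in tail_up.
have tail_lo := gaussian_tail_lipschitz t th0.
have tE X : tstat (fun i => y (tnth X i)) =
  ((Num.sqrt m%:R)^-1 * \sum_(i < m) y (tnth X i)) / Num.sqrt (evar (Y X)).
  by rewrite /tstat sqrtm_emean.
rewrite ler_norml; apply/andP; split.
  suff : pr (iid_law P m) [set X | t + `|t| * h <
      (Num.sqrt m%:R)^-1 * \sum_(i < m) y (tnth X i)] <=
    pr (iid_law P m) [set X | t < tstat (fun i => y (tnth X i))] +
    pr (iid_law P m) (@far m h) by rewrite /student_error -/(@far m h) in farle *; lra.
  apply: (pr_le_mean (mn _) (has_meanD (has_mean_indic _ mt)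
    (has_mean_indic _ (@measurable_far m h)))) => X.
    by rewrite addr_ge0// indicE ler0n.
  move=> /= HX; rewrite !indic_bool; case: ifPn => [_|].
    by rewrite lerDl; case: ifP.
  case: ifPn => [_|/near_sd[s0 _ st]]; first by rewrite add0r.
  by rewrite tE ltr_pdivlMr// (le_lt_trans st HX).
suff : pr (iid_law P m) [set X | t < tstat (fun i => y (tnth X i))] <=
    pr (iid_law P m) [set X | t - `|t| * h <
      (Num.sqrt m%:R)^-1 * \sum_(i < m) y (tnth X i)] +
    pr (iid_law P m) (@far m h) by rewrite /student_error -/(@far m h) in farle *; lra.
apply: (pr_le_mean mt (has_meanD (has_mean_indic _ (mn _))
    (has_mean_indic _ (@measurable_far m h)))) => X.
  by rewrite addr_ge0// indicE ler0n.
move=> /= HX; rewrite !indic_bool; case: ifPn => [_|].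
  by rewrite lerDl; case: ifP.
case: ifPn => [_|/near_sd[s0 st _]]; first by rewrite add0r.
move: HX; rewrite tE ltr_pdivlMr// => HX.
by rewrite (le_lt_trans st HX).
Qed.

End normalized.
End student_clt.

Lemma div_sqrt_nat_small (R : realType) (a e : R) : 0 < e ->
  exists n0, forall n, (n0 <= n)%N ->
    [/\ (0 < n)%N, a / Num.sqrt n%:R <= e & a / n%:R <= e].
Proof.
move=> e0; exists (Num.truncn ((a / e) ^+ 2)).+1 => n n0.
have n_gt0 : (0 < n)%N by exact: leq_trans n0.
have n_ge1 : 1 <= n%:R :> R by rewrite ler1n.
have sn_ge1 : 1 <= Num.sqrt n%:R :> R by rewrite -[leLHS]sqrtr1 ler_wsqrtr.
have sn_gt0 : 0 < Num.sqrt n%:R :> R by exact: lt_le_trans sn_ge1.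
have ae : (a / e) ^+ 2 <= n%:R.
  apply: ltW; apply: lt_le_trans (_ : (Num.truncn ((a / e) ^+ 2)).+1%:R <= _).
    exact: truncnS_gt.
  by rewrite ler_nat.
have aes : `|a| <= e * Num.sqrt n%:R.
  rewrite mulrC -ler_pdivrMr// -[e in leLHS]gtr0_norm// -normf_div -sqrtr_sqr.
  exact: ler_wsqrtr.
have small : `|a| / Num.sqrt n%:R <= e by rewrite ler_pdivrMr.
split=> //.
  by apply: le_trans small; rewrite ler_pM2r ?invr_gt0// ler_norm.
apply: le_trans small; apply: le_trans (_ : `|a| / n%:R <= _).
  by rewrite ler_pM2r ?invr_gt0 ?ltr0n// ler_norm.
rewrite ler_wpM2l// lef_pV2 ?posrE ?ltr0n//.
by rewrite -[leRHS](@sqr_sqrtr R) ?ler0n// expr2 ler_peMr// ltW.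
Qed.

Section student_clt_uniform.
Context {d : measure_display} {T : measurableType d} {R : realType}.
Variables (P : probability T R) (q : T -> R) (v w C : R).
Hypotheses (v0 : 0 < v) (q1 : has_mean P q 0) (q2 : has_mean P (fun x => q x ^+ 2) v).
Hypotheses (q4 : has_mean P (fun x => q x ^+ 4) w) (wC : w <= C * v ^+ 2).

Let k := (Num.sqrt v)^-1.
Let k0 : 0 < k. Proof. by rewrite invr_gt0 sqrtr_gt0. Qed.
Let k2 : k ^+ 2 = v^-1. Proof. by rewrite exprVn sqr_sqrtr// ltW. Qed.

Let y1 : has_mean P (fun x => k * q x) 0.
Proof. by have := has_meanZ k q1; rewrite mulr0. Qed.

Let y2 : has_mean P (fun x => (k * q x) ^+ 2) 1.
Proof.
apply: has_mean_ext (has_mean_val _ (has_meanZ v^-1 q2)).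
  by move=> x; rewrite exprMn k2.
by rewrite mulVf// gt_eqF.
Qed.

Let y4 : has_mean P (fun x => (k * q x) ^+ 4) (v ^- 2 * w).
Proof.
apply: has_mean_ext (has_meanZ (v ^- 2) q4) => x.
by rewrite exprMn -[k ^+ 4]/(k ^+ (2 * 2)) exprM k2 exprVn.
Qed.

Let wC1 : v ^- 2 * w <= C.
Proof. by rewrite mulrC ler_pdivrMr ?exprn_gt0. Qed.

Lemma student_clt_scaled m t e h : (0 < m)%N -> 0 < e -> 0 < h < 1 ->
  `|pr (iid_law P m) [set X | t < tstat (fun i => q (tnth X i))] - gaussian_tail t|
  <= student_error C m t e h.
Proof.
move=> m0 e0 h01; have := student_clt_bound y1 y2 y4 wC1 t m0 e0 h01.
congr (`|pr _ _ - _| <= _); apply/seteqP; split=> X /=; by rewrite tstatZ.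
Qed.

Lemma evar_lower_tail m : (0 < m)%N ->
  pr (iid_law P m) [set X | evar (fun i => q (tnth X i)) < v / 2] <=
  (16 * C + 8) / m%:R.
Proof.
move=> m0; have m_gt0 : 0 < m%:R :> R by rewrite ltr0n.
have half : 0 < (1 / 2 : R) <= 1 by apply/andP; split; lra.
have := evar_concentration y1 y2 y4 wC1 m0 half.
have -> : (4 * C + 2) / (m%:R * (1 / 2) ^+ 2) = (16 * C + 8) / m%:R.
  by field; rewrite gt_eqF.
apply: le_trans; have mq := has_mean_measurable q1.
apply: le_pr.
- by apply: measurable_lt_set => //; exact: measurable_evar.
- apply: measurable_lt_set => //; apply: measurableT_comp => //.
  apply: measurable_funB => //; apply: (measurable_evar (y := fun x => k * q x)).
  exact: measurable_funM.
- move=> X /=; rewrite evarZ k2; set s := evar _ => sv.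
  have : v^-1 * s < 1 / 2 by rewrite mulrC ltr_pdivrMr//; lra.
  by move=> ?; rewrite ler0_norm; lra.
Qed.

End student_clt_uniform.

(** The central limit theorem for Student's statistic holds uniformly over all laws
    of bounded kurtosis, on any space: this is what makes the conditional
    approximation indifferent to the dimension and to the direction. *)
Lemma student_clt (R : realType) (C t e : R) : 0 <= C -> 0 < e -> exists n0 : nat,
  forall (d : measure_display) (T : measurableType d) (P : probability T R)
    (q : T -> R) (v w : R) (m : nat), (n0 <= m)%N ->
    0 < v -> has_mean P q 0 -> has_mean P (fun x => q x ^+ 2) v ->
    has_mean P (fun x => q x ^+ 4) w -> w <= C * v ^+ 2 ->
  `|pr (iid_law P m) [set X | t < tstat (fun i => q (tnth X i))] - gaussian_tail t|
  <= e.
Proof.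
move=> C0 e0.
have e4 : 0 < e / 4 by lra.
have t1 : 0 < 4 * (`|t| + 1) by have := normr_ge0 t; lra.
pose h := Num.min (1 / 2) (e / (4 * (`|t| + 1))).
have h0 : 0 < h by rewrite lt_min; apply/andP; split; [lra|exact: divr_gt0].
have h1 : h < 1 by rewrite gt_min; apply/orP; left; lra.
have th : `|t| * h <= e / 4.
  apply: le_trans (_ : (`|t| + 1) * (e / (4 * (`|t| + 1))) <= _).
    by apply: ler_pM => //; [exact: ltW|rewrite lerDl|rewrite ge_min lexx orbT].
  rewrite le_eqVlt; apply/orP; left; apply/eqP; field.
  by have := normr_ge0 t; lra.
pose f := e / 16; have f0 : 0 < f by rewrite /f; lra.
have [n1 H1] := @div_sqrt_nat_small R (f ^- 6 * (C + 5)) _ e4.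
have [n2 H2] := @div_sqrt_nat_small R ((4 * C + 2) / h ^+ 2) _ e4.
exists (maxn n1 n2) => d T P q v w m; rewrite geq_max => /andP[m1 m2] v0 q1 q2 q4 wC.
have [m0 A1 _] := H1 _ m1; have [_ _ A2] := H2 _ m2.
have h01 : 0 < h < 1 by rewrite h0.
apply: le_trans (student_clt_scaled v0 q1 q2 q4 wC t m0 f0 h01) _.
rewrite /student_error /clt_error.
have -> : (4 * C + 2) / (m%:R * h ^+ 2) = (4 * C + 2) / h ^+ 2 / m%:R.
  by rewrite invfM mulrA mulrAC.
have : 4 * f = e / 4 by rewrite /f; field.
lra.
Qed.

(** * Gaussian quadratic forms in matrix notation *)

Section squared_norm.
Context {R : realType}.

Definition sqnorm m n (B : 'M[R]_(m, n)) : R := \sum_i \sum_j B i j ^+ 2.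

Lemma sqnorm_ge0 m n (B : 'M[R]_(m, n)) : 0 <= sqnorm B.
Proof. by do 2 (apply: sumr_ge0 => ? _); exact: sqr_ge0. Qed.

Lemma frobenius_normE d (B : 'M[R]_d) : frobenius_norm B ^+ 2 = sqnorm B.
Proof. by rewrite sqr_sqrtr// sqnorm_ge0. Qed.

Lemma sqnorm_eq0 m n (B : 'M[R]_(m, n)) : sqnorm B = 0 -> B = 0.
Proof.
move=> B0; apply/matrixP => i j; rewrite mxE; apply/eqP.
have h : \sum_(k < n) B i k ^+ 2 = 0.
  by apply: (psumr_eq0P _ B0) => // k _; apply: sumr_ge0 => l _; exact: sqr_ge0.
rewrite -sqrf_eq0; apply/eqP.
by apply: (psumr_eq0P _ h) => // k _; exact: sqr_ge0.
Qed.

Lemma sqnorm_mxtrace m n (B : 'M[R]_(m, n)) : sqnorm B = \tr (B *m B^T).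
Proof.
apply: eq_bigr => i _; rewrite mxE; apply: eq_bigr => j _.
by rewrite mxE expr2.
Qed.

Lemma sqnormD m n (B C : 'M[R]_(m, n)) :
  sqnorm (B + C) <= 2 * sqnorm B + 2 * sqnorm C.
Proof.
rewrite /sqnorm !mulr_sumr -big_split; apply: ler_sum => i _ /=.
rewrite !mulr_sumr -big_split; apply: ler_sum => j _ /=.
by rewrite mxE; have := sqr_ge0 (B i j - C i j); lra.
Qed.

Lemma sqnorm1 d : sqnorm (1%:M : 'M[R]_d) = d%:R.
Proof. by rewrite sqnorm_mxtrace trmx1 mulmx1 mxtrace1. Qed.

Lemma sum_cauchy_schwarz n (a b : 'I_n -> R) :
  (\sum_i a i * b i) ^+ 2 <= (\sum_i a i ^+ 2) * (\sum_i b i ^+ 2).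
Proof.
have : 0 <= \sum_i \sum_j (a i * b j - a j * b i) ^+ 2.
  by do 2 (apply: sumr_ge0 => ? _); exact: sqr_ge0.
have -> : \sum_i \sum_j (a i * b j - a j * b i) ^+ 2 =
    2 * ((\sum_i a i ^+ 2) * (\sum_i b i ^+ 2) - (\sum_i a i * b i) ^+ 2).
  rewrite expr2 !big_distrlr/= -sumrB mulr_sumr.
  have sym (F : 'I_n -> 'I_n -> R) : \sum_i \sum_j (F i j + F j i) = 2 * \sum_i \sum_j F i j.
    under eq_bigr do rewrite big_split.
    by rewrite big_split/= [X in _ + X]exchange_big; ring.
  transitivity (\sum_i \sum_j ((a i ^+ 2 * b j ^+ 2 - a i * b i * (a j * b j)) +
      (a j ^+ 2 * b i ^+ 2 - a j * b j * (a i * b i)))).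
    by apply: eq_bigr => i _; apply: eq_bigr => j _; ring.
  rewrite (sym (fun i j => a i ^+ 2 * b j ^+ 2 - a i * b i * (a j * b j))) mulr_sumr.
  by apply: eq_bigr => i _; rewrite -sumrB.
by rewrite pmulr_rge0// subr_ge0.
Qed.

Lemma sqnormM m n p (B : 'M[R]_(m, n)) (C : 'M[R]_(n, p)) :
  sqnorm (B *m C) <= sqnorm B * sqnorm C.
Proof.
have -> : sqnorm C = \sum_j \sum_k C k j ^+ 2 by rewrite exchange_big.
rewrite big_distrlr /=; apply: ler_sum => i _; apply: ler_sum => j _.
by rewrite mxE; exact: sum_cauchy_schwarz.
Qed.

Lemma posdefmx_scalar d (c : R) : 0 < c -> posdefmx (c%:M : 'M[R]_d).
Proof.
move=> c0; split; first exact: tr_scalar_mx.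
move=> u u0; rewrite mul_mx_scalar -scalemxAl mxE mulr_gt0//.
have -> : (u^T *m u) ord0 ord0 = sqnorm u.
  rewrite mxE /sqnorm; apply: eq_bigr => i _.
  by rewrite big_ord1 mxE expr2.
rewrite lt_neqAle sqnorm_ge0 andbT eq_sym; apply: contra u0 => /eqP/sqnorm_eq0 ->.
exact: eqxx.
Qed.

Lemma posdefmx_unit d (S : 'M[R]_d) : posdefmx S -> S \in unitmx.
Proof.
move=> [_ S0]; rewrite -row_free_unit; apply: inj_row_free => v vS.
apply/eqP/negPn/negP => v0.
have := S0 v^T; rewrite trmxK vS mul0mx mxE ltxx => /(_ _)/negP.
by apply => //; rewrite -(inj_eq trmx_inj) trmxK trmx0.
Qed.

End squared_norm.

Section mean_transfer.
Context {d1 d2 : measure_display} {T1 : measurableType d1} {T2 : measurableType d2}.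
Context {R : realType}.

Lemma has_mean_pushforward (P : probability T2 R) (Q : probability T1 R)
    (phi : T1 -> T2) (f : T2 -> R) v :
  measurable_fun [set: T1] phi ->
  (forall B, measurable B -> P B = pushforward Q phi B) ->
  measurable_fun [set: T2] f -> has_mean Q (f \o phi) v -> has_mean P f v.
Proof.
move=> mphi PE mf [fi fv].
have intE (g : T2 -> \bar R) : (\int[P]_x g x = \int[pushforward Q phi]_x g x)%E.
  by refine (eq_measure_integral (pushforward Q phi) _) => A mA _; exact: PE.
split.
  apply/integrableP; split; first exact/measurable_EFinP.
  rewrite intE ge0_integral_pushforward//; last first.
    apply: (@measurableT_comp _ _ _ _ _ _ abse _ (EFin \o f)) => //.
    exact/measurable_EFinP.
  by have /integrableP[] := fi.
by rewrite intE integral_pushforward//; exact/measurable_EFinP.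
Unshelve. all: by [].
Qed.

End mean_transfer.

Section gaussian_matrix.
Context {R : realType}.
Variables (d : nat) (A : 'M[R]_d).
Implicit Types (x z : Rvec R d) (M : 'M[R]_d).

Lemma measurable_cov_dev (i j : 'I_d) :
  measurable_fun [set: Rvec R d] (fun x => cov_dev x i j).
Proof.
rewrite (_ : (fun x => _) =
    fun x : Rvec R d => (tnth x i : R) * tnth x j - (1%:M : 'M[R]_d) i j).
  apply: measurable_funB => //.
  by apply: measurable_funM; exact: measurable_tnth.
by apply/funext => x; rewrite !mxE big_ord1 !mxE.
Qed.

Lemma cov_dev_sym x : (cov_dev x)^T = cov_dev x.
Proof. by rewrite /cov_dev linearB /= trmx_mul trmxK trmx1. Qed.

Lemma measurable_mxtrace_cov_dev M :
  measurable_fun [set: Rvec R d] (fun x => \tr (cov_dev x *m M)).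
Proof.
rewrite (_ : (fun x => _) = fun x => \sum_i \sum_j cov_dev x i j * M j i).
  apply: measurable_sum => i; apply: measurable_sum => j.
  by apply: measurable_funM => //; exact: measurable_cov_dev.
by apply/funext => x; apply: eq_bigr => i _; rewrite mxE.
Qed.

Lemma measurable_lin_tuple : measurable_fun [set: Rvec R d] (lin_tuple A).
Proof.
apply/measurable_fun_tnthP => i.
rewrite (_ : _ \o _ = fun x : Rvec R d => \sum_j A i j * (tnth x j : R)).
  apply: measurable_sum => j; apply: measurable_funM => //.
  exact: measurable_tnth.
apply/funext => x /=; rewrite tnth_mktuple mxE.
by apply: eq_bigr => j _; rewrite mxE.
Qed.

Lemma mxtrace_cov_dev_quad_form x M :
  \tr (cov_dev x *m M) = quad_form 0 (fun=> 0) (fun i j => M j i) x.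
Proof.
rewrite /quad_form add0r [X in X + _]big1 ?add0r; last by move=> i _; rewrite mul0r.
apply: eq_bigr => i _; rewrite mxE; apply: eq_bigr => j _.
by rewrite mulrC !mxE big_ord1 !mxE.
Qed.

Lemma cov_dev_lin_tuple z :
  cov_dev (lin_tuple A z) = A *m cov_dev z *m A^T + (A *m A^T - 1%:M).
Proof.
have -> : cov_dev (lin_tuple A z) = A *m col_of z *m (A *m col_of z)^T - 1%:M.
  congr (_ *m _^T - _); apply/matrixP => i j; rewrite mxE tnth_mktuple;
  by rewrite (ord1 j).
rewrite /cov_dev trmx_mul mulmxBr mulmxBl mulmx1 !mulmxA.
by rewrite addrA subrK.
Qed.

(** The variance of [\tr (cov_dev x *m M)] when [x] has law [N(0, A *m A^T)]. *)
Definition tr_var M : R := quad_var 0 (fun=> 0) (fun i j => (A^T *m M *m A) j i).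

Lemma tr_var_le M : tr_var M <= 2 * sqnorm (A^T *m M *m A).
Proof.
rewrite /tr_var /quad_var expr0n add0r [X in X + _]big1 ?add0r//.
set B := A^T *m M *m A.
have -> : 2 * sqnorm B =
    \sum_i \sum_j (3 / 2 * B j i ^+ 2 + 1 / 2 * B i j ^+ 2).
  under [RHS]eq_bigr do rewrite big_split -!mulr_sumr.
  rewrite big_split -!mulr_sumr /= [X in _ = _ * X + _]exchange_big /sqnorm.
  by field.
apply: ler_sum => i _; apply: ler_sum => j _.
by have := sqr_ge0 (B j i - B i j); lra.
Qed.

Lemma tr_var_sym M : M^T = M -> tr_var M = 2 * sqnorm (A^T *m M *m A).
Proof.
move=> Msym; rewrite /tr_var /quad_var expr0n add0r [X in X + _]big1 ?add0r//.
set B := A^T *m M *m A; have Bsym : B^T = B by rewrite /B !trmx_mul trmxK Msym mulmxA.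
rewrite /sqnorm mulr_sumr; apply: eq_bigr => i _; rewrite mulr_sumr.
apply: eq_bigr => j _; have -> : B j i = B i j by rewrite -[in LHS]Bsym mxE.
ring.
Qed.

Variables (Sigma : 'M[R]_d) (P : probability (Rvec R d) R).
Hypothesis SigmaE : A *m A^T = Sigma.
Hypothesis PE : forall B, measurable B -> P B = pushforward (std_normal d) (lin_tuple A) B.

(** Writing [x = A z] with [z] standard Gaussian turns this centred statistic into the
    quadratic form in [z] with coefficient matrix [A^T *m M *m A]. *)
Definition tr_stat M x : R := \tr (cov_dev x *m M) - \tr ((Sigma - 1%:M) *m M).

Lemma measurable_tr_stat M : measurable_fun [set: Rvec R d] (tr_stat M).
Proof. by apply: measurable_funB => //; exact: measurable_mxtrace_cov_dev. Qed.

Let tr_stat_lin_tuple M z :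
  tr_stat M (lin_tuple A z) = quad_form 0 (fun=> 0) (fun i j => (A^T *m M *m A) j i) z.
Proof.
rewrite /tr_stat cov_dev_lin_tuple SigmaE mulmxDl mxtraceD addrK.
by rewrite -mxtrace_cov_dev_quad_form -!mulmxA mxtrace_mulC !mulmxA.
Qed.

Let transfer (g : R -> R) M v : measurable_fun [set: R] g ->
  has_mean (std_normal d) (fun z => g (tr_stat M (lin_tuple A z))) v ->
  has_mean P (fun x => g (tr_stat M x)) v.
Proof.
move=> mg; apply: (has_mean_pushforward measurable_lin_tuple PE).
by apply: measurableT_comp => //; exact: measurable_tr_stat.
Qed.

Lemma has_mean_tr_stat M : has_mean P (tr_stat M) 0.
Proof.
apply: (@transfer (fun t : R => t) M 0) => //.
apply: has_mean_ext (has_mean_quad_form 0 _ _) => z.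
by rewrite tr_stat_lin_tuple.
Qed.

Lemma has_mean_tr_stat_sqr M : has_mean P (fun x => tr_stat M x ^+ 2) (tr_var M).
Proof.
apply: (transfer (g := fun t : R => t ^+ 2)); first exact: measurable_funX.
apply: has_mean_ext (has_mean_quad_form_sqr 0 _ _) => z.
by rewrite tr_stat_lin_tuple.
Qed.

Lemma tr_stat_moment4 M : exists2 w, has_mean P (fun x => tr_stat M x ^+ 4) w &
  w <= 75 * tr_var M ^+ 2.
Proof.
have [w hw wle] := quad_form_moment4 0 (fun=> 0) (fun i j => (A^T *m M *m A) j i).
exists w => //; apply: (transfer (g := fun t : R => t ^+ 4)); first exact: measurable_funX.
by apply: has_mean_ext hw => z; rewrite tr_stat_lin_tuple.
Qed.

End gaussian_matrix.

(** * Sample splitting *)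

Section sample_splitting.
Context {R : realType}.

Lemma pr_iid_cat (d : measure_display) (T : measurableType d) (P : probability T R)
    (m k : nat) (S : set ((m + k).-tuple T)) : measurable S ->
  (forall Y : k.-tuple T, measurable [set X : m.-tuple T | S (cat_tuple X Y)]) /\
  has_mean (iid_law P k)
    (fun Y => pr (iid_law P m) [set X : m.-tuple T | S (cat_tuple X Y)])
    (pr (iid_law P (m + k)) S).
Proof.
move=> mS.
have mI : measurable_fun [set: (m + k).-tuple T] (\1_S : _ -> R).
  exact: measurable_indic.
have mF : measurable_fun [set: m.-tuple T * k.-tuple T]
    (fun p => \1_S (cat_tuple p.1 p.2) : R).
  exact: (measurableT_comp mI (@measurable_cat_tuple _ T m k)).
have mSY (Y : k.-tuple T) : measurable [set X : m.-tuple T | S (cat_tuple X Y)].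
  have := measurableT_comp (@measurable_cat_tuple _ T m k) (measurable_pair2 Y).
  by move=> /(_ measurableT S mS); rewrite setTI.
split=> //.
have [|p|_ [H [v [_ hH _ Hv]]]] := @fubini_mean _ _ _ _ R (iid_law P m) (iid_law P k)
  (fun p => \1_S (cat_tuple p.1 p.2)) => //.
- by rewrite indicE ler0n lern1 leq_b1.
have HE Y : H Y = pr (iid_law P m) [set X : m.-tuple T | S (cat_tuple X Y)].
  by apply: has_mean_uniq (hH Y) _; exact: (has_mean_indic _ (mSY Y)).
have -> : pr (iid_law P (m + k)) S = v.
  apply: has_mean_uniq (has_mean_indic _ mS) _.
  by apply: (has_mean_iid_law_cat _ _ hH Hv) => // X; rewrite indicE ler0n.
exact: has_mean_ext HE Hv.
Qed.

Section cov_split.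
Variables (m1 m2 d : nat).
Implicit Types (X : m1.-tuple (Rvec R d)) (Y : m2.-tuple (Rvec R d)).

(** For [Y] the second half of the sample, [f_cov] is the trace pairing with
    [cov_mean Y]. Given [Y], the test statistic is therefore a Student statistic built
    on the first half, in the fixed direction [cov_mean Y]. *)
Definition cov_mean k (Y : k.-tuple (Rvec R d)) : 'M[R]_d :=
  k%:R^-1 *: \sum_(j < k) cov_dev (tnth Y j).

Lemma cov_mean_sym k (Y : k.-tuple (Rvec R d)) : (cov_mean Y)^T = cov_mean Y.
Proof.
rewrite /cov_mean linearZ /= linear_sum /=; congr (_ *: _).
by apply: eq_bigr => j _; rewrite cov_dev_sym.
Qed.

Lemma mxtrace_cov_mean k (Y : k.-tuple (Rvec R d)) (D : 'M[R]_d) :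
  \tr (D *m cov_mean Y) = emean (fun j => \tr (cov_dev (tnth Y j) *m D)).
Proof.
rewrite /cov_mean -scalemxAr mxtraceZ /emean mulmx_sumr raddf_sum /=; congr (_ * _).
by apply: eq_bigr => j _; rewrite mxtrace_mulC.
Qed.

Lemma f_cov_cat X Y x :
  f_cov m1 (cat_tuple X Y) x = \tr (cov_dev x *m cov_mean Y).
Proof.
rewrite mxtrace_cov_mean /f_cov /emean addKn big_split_ord /= big1 ?add0r; last first.
  by move=> i; rewrite leqNgt ltn_ord.
congr (_ * _); apply: eq_big => [j|j _]; first by rewrite leq_addr.
by rewrite tnth_rshift mxtrace_mulC.
Qed.

Let sum_first (F : Rvec R d -> R) X Y :
  \sum_(i < m1 + m2 | (i < m1)%N) F (tnth (cat_tuple X Y) i) =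
  \sum_(i < m1) F (tnth X i).
Proof.
rewrite big_split_ord /= [X in _ + X]big1 ?addr0; last first.
  by move=> i; rewrite ltnNge leq_addr.
by apply: eq_big => [i|i _]; [rewrite ltn_ord|rewrite tnth_lshift].
Qed.

Lemma T_cov_cat X Y : T_cov m1 (cat_tuple X Y) =
  tstat (fun i => \tr (cov_dev (tnth X i) *m cov_mean Y)).
Proof.
have fE : f_cov m1 (cat_tuple X Y) = fun x => \tr (cov_dev x *m cov_mean Y).
  by apply/funext => x; exact: f_cov_cat.
rewrite /T_cov /fbar_cov fE (sum_first (fun x => \tr (cov_dev x *m cov_mean Y))).
by rewrite (sum_first (fun x => (\tr (cov_dev x *m cov_mean Y) - _) ^+ 2)).
Qed.

End cov_split.

Lemma measurable_f_cov n m1 d (i : 'I_n) :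
  measurable_fun [set: n.-tuple (Rvec R d)] (fun X => f_cov m1 X (tnth X i)).
Proof.
apply: measurable_funM => //; rewrite (_ : (fun X => _) = fun X : n.-tuple (Rvec R d) =>
  \sum_(j < n) if (m1 <= j)%N then
    \sum_k \sum_l cov_dev (tnth X i) k l * cov_dev (tnth X j) l k else 0); last first.
  apply/funext => X; rewrite big_mkcond; apply: eq_bigr => j _; case: ifP => // _.
  by apply: eq_bigr => k _; rewrite mxE.
apply: measurable_sum => j; case: (m1 <= j)%N => //.
apply: measurable_sum => k; apply: measurable_sum => l.
apply: measurable_funM.
  exact: (measurableT_comp (measurable_cov_dev k l) (measurable_tnth i)).
exact: (measurableT_comp (measurable_cov_dev l k) (measurable_tnth j)).
Qed.

Let measurable_sum_first n m1 d (F : 'I_n -> n.-tuple (Rvec R d) -> R) :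
  (forall i, measurable_fun [set: n.-tuple (Rvec R d)] (F i)) ->
  measurable_fun [set: n.-tuple (Rvec R d)]
    (fun X => \sum_(i < n | (i < m1)%N) F i X).
Proof.
move=> mF; rewrite (_ : (fun X => _) = fun X =>
    \sum_(i < n) if (i < m1)%N then F i X else 0).
  by apply: measurable_sum => i; case: (i < m1)%N.
by apply/funext => X; rewrite big_mkcond.
Qed.

Lemma measurable_T_cov n m1 d :
  measurable_fun [set: n.-tuple (Rvec R d)] (fun X => T_cov m1 X).
Proof.
have mf := fun i : 'I_n => measurable_f_cov m1 (d := d) i.
have mfbar : measurable_fun [set: n.-tuple (Rvec R d)] (fun X => fbar_cov m1 X).
  by apply: measurable_funM => //; exact: measurable_sum_first.
apply: measurable_funM; first exact: measurable_funM.
apply: measurable_inv_fun; apply: measurable_sqrt_fun; apply: measurable_funM => //.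
apply: (@measurable_sum_first n m1 d
  (fun i X => (f_cov m1 X (tnth X i) - fbar_cov m1 X) ^+ 2)) => i.
by apply: measurable_funX; exact: measurable_funB.
Qed.

End sample_splitting.

Section shifted.
Context {R : realType}.

Lemma emean_shift m (c : R) (Y : 'I_m -> R) : (0 < m)%N ->
  emean (fun i => c + Y i) = c + emean Y.
Proof.
move=> m0; rewrite /emean big_split /= sumr_const card_ord -[c *+ m]mulr_natl mulrDr.
by rewrite mulKf// pnatr_eq0 -lt0n.
Qed.

Lemma evar_shift m (c : R) (Y : 'I_m -> R) : (0 < m)%N ->
  evar (fun i => c + Y i) = evar Y.
Proof.
move=> m0; rewrite /evar emean_shift//; congr (_ * _); apply: eq_bigr => i _.
by congr (_ ^+ 2); ring.
Qed.

Lemma evar_le_sqr m (Y : 'I_m -> R) : (0 < m)%N ->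
  evar Y <= m%:R^-1 * \sum_i Y i ^+ 2.
Proof. by move=> m0; rewrite evarE// gerBl sqr_ge0. Qed.

End shifted.

(** * Power of the test *)

(** If the statistic does not exceed [z], then the empirical variance is below
    [v / 2] (this event is set apart to keep the denominator away from zero), or the
    empirical mean of [q] exceeds [tau / 2] in absolute value, or the empirical
    variance is at least of order [m tau^2 / z^2]. The three events are bounded by
    [evar_lower_tail], Chebyshev's and Markov's inequalities. *)
Lemma tstat_le_pr (d : measure_display) (T : measurableType d) (R : realType)
    (P : probability T R) (q : T -> R) (v w C tau z : R) (m : nat) : (0 < m)%N ->
  0 < v -> has_mean P q 0 -> has_mean P (fun x => q x ^+ 2) v ->
  has_mean P (fun x => q x ^+ 4) w -> w <= C * v ^+ 2 -> 0 < tau ->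
  pr (iid_law P m) [set X | ~ (z < tstat (fun i => tau + q (tnth X i)))] <=
  (16 * C + 8) / m%:R + 4 * (1 + z ^+ 2) * v / (m%:R * tau ^+ 2).
Proof.
move=> m0 v0 q1 q2 q4 wC tau0; have m_gt0 : 0 < m%:R :> R by rewrite ltr0n.
have mq := has_mean_measurable q1.
have mbad : measurable [set X : m.-tuple T | ~ (z < tstat (fun i => tau + q (tnth X i)))].
  apply: measurableC; apply: measurable_lt_set => //.
  apply: (measurable_tstat (y := fun x => tau + q x)).
  exact: measurable_funD.
have mlow : measurable [set X : m.-tuple T | evar (fun i => q (tnth X i)) < v / 2].
  by apply: measurable_lt_set => //; exact: measurable_evar.
have S1 := has_mean_iid_sum_sqr m q1 q2.
have S2 := has_mean_iid_sum m q2.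
have low := evar_lower_tail v0 q1 q2 q4 wC m0.
apply: le_trans (_ : pr (iid_law P m) [set X | evar (fun i => q (tnth X i)) < v / 2] +
  4 / (m%:R * tau) ^+ 2 * (m%:R * v) +
  4 * z ^+ 2 / (m%:R * tau) ^+ 2 * (m%:R * v) <= _); last first.
  have -> : 4 * (1 + z ^+ 2) * v / (m%:R * tau ^+ 2) =
    4 / (m%:R * tau) ^+ 2 * (m%:R * v) + 4 * z ^+ 2 / (m%:R * tau) ^+ 2 * (m%:R * v).
    by field; rewrite !gt_eqF.
  by rewrite addrA !lerD2r.
have mt2 : 0 < (m%:R * tau) ^+ 2 by rewrite exprn_gt0// mulr_gt0.
have c1 : 0 <= 4 / (m%:R * tau) ^+ 2 by rewrite divr_ge0// ltW.
have c2 : 0 <= 4 * z ^+ 2 / (m%:R * tau) ^+ 2.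
  by rewrite divr_ge0 ?(ltW mt2)// mulr_ge0// sqr_ge0.
have sq0 (X : m.-tuple T) : 0 <= \sum_(i < m) q (tnth X i) ^+ 2.
  by apply: sumr_ge0 => i _; exact: sqr_ge0.
apply: (pr_le_mean mbad (has_meanD (has_meanD (has_mean_indic _ mlow)
  (has_meanZ (4 / (m%:R * tau) ^+ 2) S1))
  (has_meanZ (4 * z ^+ 2 / (m%:R * tau) ^+ 2) S2))) => X.
  apply: addr_ge0; last exact: mulr_ge0.
  by apply: addr_ge0; [rewrite indicE ler0n|rewrite mulr_ge0// sqr_ge0].
move=> /negP; rewrite -leNgt /tstat emean_shift// evar_shift// indic_bool.
set Q := fun i : 'I_m => q (tnth X i).
have t1_ge0 : 0 <= 4 / (m%:R * tau) ^+ 2 * (\sum_i Q i) ^+ 2.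
  by rewrite mulr_ge0// sqr_ge0.
have t2_ge0 : 0 <= 4 * z ^+ 2 / (m%:R * tau) ^+ 2 * \sum_i Q i ^+ 2.
  by rewrite mulr_ge0// sq0.
case: ltrP => [_ _|ev]; first by rewrite -addrA lerDl addr_ge0.
rewrite add0r => Tz.
have ev0 : 0 < evar Q by apply: lt_le_trans ev; rewrite divr_gt0.
have [eQ|eQ] := lerP (2 * `|emean Q|) tau; last first.
  suff : 1 <= 4 / (m%:R * tau) ^+ 2 * (\sum_i Q i) ^+ 2 by lra.
  have -> : 4 / (m%:R * tau) ^+ 2 * (\sum_i Q i) ^+ 2 = (2 * emean Q / tau) ^+ 2.
    by rewrite /emean; field; rewrite !gt_eqF.
  rewrite -[(_ / _) ^+ 2]ger0_norm ?sqr_ge0// normrX expr_ge1//.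
  rewrite normrM normfV (gtr0_norm tau0) ler_pdivlMr// mul1r normrM ger0_norm//.
  exact: ltW.
have mean_ge : tau / 2 <= tau + emean Q.
  by have := ler_norm (- emean Q); rewrite normrN; lra.
have s0 : 0 < Num.sqrt (evar Q) by rewrite sqrtr_gt0.
have sm0 : 0 < Num.sqrt m%:R :> R by rewrite sqrtr_gt0.
have zs : Num.sqrt m%:R * (tau / 2) <= `|z| * Num.sqrt (evar Q).
  apply: le_trans (_ : Num.sqrt m%:R * (tau + emean Q) <= _).
    by rewrite ler_pM2l.
  move: Tz; rewrite ler_pdivrMr// => /le_trans; apply.
  by rewrite ler_pM2r// ler_norm.
have : (Num.sqrt m%:R * (tau / 2)) ^+ 2 <= (`|z| * Num.sqrt (evar Q)) ^+ 2.
  by rewrite ler_pXn2r// nnegrE; rewrite mulr_ge0// ltW// divr_gt0.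
rewrite !exprMn sqr_sqrtr ?ler0n// sqr_sqrtr ?(ltW ev0)// -normrX ger0_norm ?sqr_ge0//.
move=> zz.
suff : 1 <= 4 * z ^+ 2 / (m%:R * tau) ^+ 2 * \sum_i Q i ^+ 2 by lra.
have -> : 4 * z ^+ 2 / (m%:R * tau) ^+ 2 * \sum_i Q i ^+ 2 =
    z ^+ 2 * (m%:R^-1 * \sum_i Q i ^+ 2) / (m%:R * (tau * 2^-1) ^+ 2).
  by field; rewrite !gt_eqF.
rewrite ler_pdivlMr; last by rewrite mulr_gt0// exprn_gt0// mulr_gt0// invr_gt0.
rewrite mul1r exprMn; apply: (le_trans zz); apply: ler_wpM2l; first exact: sqr_ge0.
exact: evar_le_sqr.
Qed.

Section alternative.
Context {R : realType}.
Variables (d : nat) (A Sigma : 'M[R]_d) (P : probability (Rvec R d) R).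
Hypotheses (SigmaE : A *m A^T = Sigma) (Sigma_pos : posdefmx Sigma).
Hypothesis PE : forall B, measurable B -> P B = pushforward (std_normal d) (lin_tuple A) B.

Let D := Sigma - 1%:M.
Let G := A^T *m A.
Let stat := tr_stat Sigma.

Let Dsym : D^T = D.
Proof. by rewrite /D linearB /= trmx1 -SigmaE trmx_mul trmxK. Qed.

Let sqnorm_conj (M : 'M[R]_d) : M^T = M ->
  sqnorm (A^T *m M *m A) = \tr (Sigma *m M *m Sigma *m M).
Proof.
move=> Ms; rewrite sqnorm_mxtrace !trmx_mul trmxK Ms -SigmaE !mulmxA.
by rewrite mxtrace_mulC !mulmxA mxtrace_mulC !mulmxA.
Qed.

(** As [Sigma] is invertible, no nonzero symmetric direction is degenerate. *)
Lemma tr_var_gt0 (M : 'M[R]_d) : M^T = M -> M != 0 -> 0 < tr_var A M.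
Proof.
move=> Ms M0; rewrite tr_var_sym// mulr_gt0// lt_neqAle sqnorm_ge0 andbT eq_sym.
apply: contra M0 => /eqP/sqnorm_eq0 AMA.
have SMS : Sigma *m M *m Sigma = 0.
  have -> : Sigma *m M *m Sigma = A *m (A^T *m M *m A) *m A^T by rewrite -SigmaE !mulmxA.
  by rewrite AMA mulmx0 mul0mx.
have Su := posdefmx_unit Sigma_pos.
by rewrite -(mulKmx Su M) -(mulmxK Su (Sigma *m M)) SMS mul0mx mulmx0.
Qed.

(** With [Sigma = 1 + D], the trace of [Sigma D Sigma D] is the squared norm of
    [D + D^2]. *)
Lemma tr_var_dev_le : tr_var A D <= 4 * (sqnorm D + sqnorm D ^+ 2).
Proof.
rewrite tr_var_sym// sqnorm_conj//.
have SE : Sigma = 1%:M + D by rewrite /D addrC subrK.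
have -> : \tr (Sigma *m D *m Sigma *m D) = sqnorm (D + D *m D).
  have sym : (D + D *m D)^T = D + D *m D by rewrite [LHS]linearD /= trmx_mul Dsym.
  have prod (S E : 'M[R]_d) : S = 1%:M + E ->
      S *m E *m S *m E = (E + E *m E) *m (E + E *m E).
    by move=> ->; rewrite [(1%:M + E) *m E]mulmxDl mul1mx -mulmxA [(1%:M + E) *m E]mulmxDl mul1mx.
  by rewrite sqnorm_mxtrace sym (prod _ _ SE).
have := sqnormD D (D *m D); have := sqnormM D D.
by rewrite -expr2; lra.
Qed.

Lemma sqnorm_gram_le : sqnorm G <= 2 * (d%:R + sqnorm D).
Proof.
have -> : sqnorm G = sqnorm (1%:M + D).
  have SE : 1%:M + D = Sigma by rewrite /D addrC subrK.
  rewrite SE !sqnorm_mxtrace -SigmaE !trmx_mul !trmxK /G !mulmxA.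
  by rewrite mxtrace_mulC !mulmxA.
by have := sqnormD (1%:M : 'M[R]_d) D; rewrite sqnorm1; lra.
Qed.

(** Pairing with this matrix extracts the entry [(k, l)] of [A^T *m W *m A], so that
    the entries of the estimation error are themselves means of trace statistics. *)
Let unit_dir (k l : 'I_d) : 'M[R]_d := A *m delta_mx l k *m A^T.

Let conj_entry (W : 'M[R]_d) k l :
  (A^T *m W *m A) k l = \tr (W *m unit_dir k l).
Proof.
rewrite /unit_dir !mulmxA mxtrace_mulC !mulmxA; set B := A^T *m W *m A.
rewrite /mxtrace (bigD1 k)//= big1 ?addr0.
  rewrite [RHS]mxE (bigD1 l)//= big1 ?addr0; first by rewrite [delta_mx _ _ _ _]mxE !eqxx mulr1.
  by move=> j /negPf jl; rewrite [delta_mx _ _ _ _]mxE jl mulr0.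
by move=> i /negPf ik; rewrite mxE big1// => j _; rewrite [delta_mx _ _ _ _]mxE ik andbF mulr0.
Qed.

Lemma sum_tr_var_unit_dir : \sum_k \sum_l tr_var A (unit_dir k l) <= 2 * sqnorm G ^+ 2.
Proof.
have GdG k l i j : (A^T *m unit_dir k l *m A) i j = G i l * G k j.
  have -> : A^T *m unit_dir k l *m A = G *m delta_mx l k *m G by rewrite /unit_dir /G !mulmxA.
  rewrite mxE (bigD1 k)//= big1 ?addr0.
    congr (_ * _); rewrite mxE (bigD1 l)//= big1 ?addr0; first by rewrite [delta_mx _ _ _ _]mxE !eqxx mulr1.
    by move=> p /negPf pl; rewrite [delta_mx _ _ _ _]mxE pl mulr0.
  by move=> p /negPf pk; rewrite mxE big1 ?mul0r// => q _; rewrite [delta_mx _ _ _ _]mxE pk andbF mulr0.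
have sqE k l : sqnorm (A^T *m unit_dir k l *m A) =
    (\sum_i G i l ^+ 2) * (\sum_j G k j ^+ 2).
  rewrite big_distrlr/=; apply: eq_bigr => i _; apply: eq_bigr => j _.
  by rewrite GdG exprMn.
apply: le_trans (_ : \sum_k \sum_l 2 * sqnorm (A^T *m unit_dir k l *m A) <= _).
  by apply: ler_sum => k _; apply: ler_sum => l _; exact: tr_var_le.
have -> : 2 * sqnorm G ^+ 2 = 2 * ((\sum_k \sum_j G k j ^+ 2) * \sum_l \sum_i G i l ^+ 2).
  by rewrite expr2 /sqnorm [X in _ = _ * (_ * X)]exchange_big.
rewrite big_distrlr /= mulr_sumr le_eqVlt; apply/orP; left; apply/eqP.
apply: eq_bigr => k _; rewrite mulr_sumr; apply: eq_bigr => l _.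
by rewrite sqE mulrC [in RHS]mulrC; congr (_ * _); rewrite mulrC.
Qed.

Let noise k (Y : k.-tuple (Rvec R d)) := cov_mean Y - D.

Let noise_conj_entry k (Y : k.-tuple (Rvec R d)) i j : (0 < k)%N ->
  (A^T *m noise Y *m A) i j = emean (fun l => stat (unit_dir i j) (tnth Y l)).
Proof.
move=> k0; rewrite conj_entry /noise mulmxBl raddfB /= mxtrace_mulC mxtrace_cov_mean.
set c := \tr (D *m _).
have -> : (fun l => stat (unit_dir i j) (tnth Y l)) =
    (fun l => - c + \tr (cov_dev (tnth Y l) *m unit_dir i j)).
  by apply/funext => l; rewrite /stat /tr_stat addrC.
by rewrite emean_shift// addrC.
Qed.

Lemma has_mean_noise k : (0 < k)%N ->
  exists2 s, has_mean (iid_law P k) (fun Y => sqnorm (A^T *m noise Y *m A)) s &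
    s <= 2 * sqnorm G ^+ 2 / k%:R.
Proof.
move=> k0; have k_gt0 : 0 < k%:R :> R by rewrite ltr0n.
exists (\sum_i \sum_j k%:R ^- 2 * (k%:R * tr_var A (unit_dir i j))); last first.
  have -> : \sum_i \sum_j k%:R ^- 2 * (k%:R * tr_var A (unit_dir i j)) =
      (\sum_i \sum_j tr_var A (unit_dir i j)) / k%:R.
    rewrite mulr_suml; apply: eq_bigr => i _; rewrite mulr_suml; apply: eq_bigr => j _.
    by field; rewrite gt_eqF.
  by rewrite ler_pM2r ?invr_gt0//; exact: sum_tr_var_unit_dir.
apply: has_mean_sum => i _; apply: has_mean_sum => j _.
apply: has_mean_ext (has_meanZ (k%:R ^- 2) (has_mean_iid_sum_sqr k
  (has_mean_tr_stat SigmaE PE (unit_dir i j))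
  (has_mean_tr_stat_sqr SigmaE PE (unit_dir i j)))) => Y.
by rewrite noise_conj_entry// /emean exprMn exprVn.
Qed.

(** Given the second half, the signal is [tau = \tr (D *m cov_mean Y)]. It has mean
    [sqnorm D], and falls below half of it with a probability bounded by Chebyshev's
    inequality. Otherwise [tstat_le_pr] applies conditionally; there the variance in
    the direction [cov_mean Y] is at most twice the one in the direction [D] plus a
    multiple of the squared estimation error, whose mean is bounded by
    [has_mean_noise]. *)
Lemma type2_error_bound (m1 m2 : nat) (z : R) : (0 < m1)%N -> (0 < m2)%N ->
  0 < sqnorm D ->
  pr (iid_law P (m1 + m2)) [set X | ~ (z < T_cov m1 X)] <=
  4 * tr_var A D / (m2%:R * sqnorm D ^+ 2) + (16 * 75 + 8) / m1%:R +
  16 * (1 + z ^+ 2) / (m1%:R * sqnorm D ^+ 2) *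
    (2 * tr_var A D + 8 * sqnorm G ^+ 2 / m2%:R).
Proof.
move=> m10 m20 th0; set th := sqnorm D in th0 *.
have m1_gt0 : 0 < m1%:R :> R by rewrite ltr0n.
have m2_gt0 : 0 < m2%:R :> R by rewrite ltr0n.
have mS : measurable [set X : (m1 + m2).-tuple (Rvec R d) | ~ (z < T_cov m1 X)].
  apply: measurableC; apply: measurable_lt_set => //; exact: measurable_T_cov.
have [mSY SY] := pr_iid_cat P mS.
have [s hs sle] := has_mean_noise m20.
have signal := has_meanZ (4 / th ^+ 2 / m2%:R ^+ 2) (has_mean_iid_sum_sqr m2
  (has_mean_tr_stat SigmaE PE D) (has_mean_tr_stat_sqr SigmaE PE D)).
set c := 16 * (1 + z ^+ 2) / (m1%:R * th ^+ 2).
have mth : 0 < m1%:R * th ^+ 2 by rewrite mulr_gt0// exprn_gt0.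
have c0 : 0 <= c.
  by apply: divr_ge0; [have := sqr_ge0 z; lra|exact: ltW].
have bound := has_meanD (has_meanD signal (has_mean_cst _ ((16 * 75 + 8) / m1%:R)))
  (has_meanZ c (has_meanD (has_mean_cst _ (2 * tr_var A D)) (has_meanZ 4 hs))).
apply: (@le_trans _ _ (4 / th ^+ 2 / m2%:R ^+ 2 * (m2%:R * tr_var A D) + (16 * 75 + 8) / m1%:R +
    c * (2 * tr_var A D + 4 * s))); last first.
  rewrite lerD//; last first.
    by apply: ler_wpM2l => //; rewrite lerD2l; lra.
  rewrite lerD2r le_eqVlt; apply/orP; left; apply/eqP.
  by field; rewrite !gt_eqF.
apply: (has_mean_le SY bound) => Y.
set M := cov_mean Y; have Msym : M^T = M by exact: cov_mean_sym.
set tau := \tr (D *m M).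
have tauE : m2%:R^-1 * \sum_(i < m2) tr_stat Sigma D (tnth Y i) = tau - th.
  have -> : tau = th + m2%:R^-1 * \sum_(i < m2) tr_stat Sigma D (tnth Y i).
    rewrite /tau mxtrace_cov_mean -(emean_shift _ _ m20); congr emean.
    apply/funext => j; rewrite /tr_stat addrC -/D /th sqnorm_mxtrace Dsym.
    by rewrite subrK.
  by rewrite addrC addKr.
have sgE : 4 / th ^+ 2 / m2%:R ^+ 2 * (\sum_(i < m2) tr_stat Sigma D (tnth Y i)) ^+ 2 =
    (2 * (tau - th) / th) ^+ 2.
  by rewrite -tauE; field; rewrite !gt_eqF.
rewrite sgE.
have b1 : 0 <= (16 * 75 + 8) / m1%:R :> R.
  by rewrite mulr_ge0 ?invr_ge0 ?ler0n// addr_ge0.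
have V0 : 0 <= tr_var A D by exact: quad_var_ge0.
have b2 : 0 <= c * (2 * tr_var A D + 4 * sqnorm (A^T *m noise Y *m A)).
  by apply: mulr_ge0 => //; have := sqnorm_ge0 (A^T *m noise Y *m A); lra.
have [tau_small|tau_large] := ltP tau (th / 2).
  have : 1 <= (2 * (tau - th) / th) ^+ 2.
    have -> : (2 * (tau - th) / th) ^+ 2 = (2 * (th - tau) / th) ^+ 2.
      by field; rewrite gt_eqF.
    by rewrite expr_ge1// ?ler_pdivlMr//; lra.
  by have := pr_le1 (iid_law P m1) (mSY Y); lra.
have tau0 : 0 < tau by lra.
have M0 : M != 0.
  by apply: contraTneq tau0 => M0; rewrite /tau M0 mulmx0 mxtrace0 ltxx.
have v0 := tr_var_gt0 Msym M0.
have [w hw wle] := tr_stat_moment4 SigmaE PE M.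
have := tstat_le_pr z m10 v0 (has_mean_tr_stat SigmaE PE M)
  (has_mean_tr_stat_sqr SigmaE PE M) hw wle tau0.
have -> : [set X : m1.-tuple (Rvec R d) | ~ (z < tstat (fun i => tau + tr_stat Sigma M (tnth X i)))] =
   [set X : m1.-tuple (Rvec R d) | ~ (z < T_cov m1 (cat_tuple X Y))].
  have shift (X : m1.-tuple (Rvec R d)) :
      (fun i => tau + tr_stat Sigma M (tnth X i)) =
      (fun i => \tr (cov_dev (tnth X i) *m M)).
    by apply/funext => i; rewrite /tr_stat addrC subrK.
  by apply/seteqP; split=> X /=; rewrite T_cov_cat shift.
move=> /le_trans; apply.
have sq := sqr_ge0 (2 * (tau - th) / th).
apply: (@le_trans _ _ ((16 * 75 + 8) / m1%:R + c * (2 * tr_var A D + 4 * sqnorm (A^T *m noise Y *m A)))); last by lra.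
rewrite lerD2l.
have vle : tr_var A M <= 2 * tr_var A D + 4 * sqnorm (A^T *m noise Y *m A).
  rewrite !tr_var_sym//.
  have -> : A^T *m M *m A = A^T *m D *m A + A^T *m noise Y *m A.
    by rewrite -mulmxDl -mulmxDr /noise addrC subrK.
  by have := sqnormD (A^T *m D *m A) (A^T *m noise Y *m A); lra.
apply: (@le_trans _ _ (c * tr_var A M)); last exact: ler_wpM2l.
have -> : 4 * (1 + z ^+ 2) * tr_var A M / (m1%:R * tau ^+ 2) =
  4 * (1 + z ^+ 2) / m1%:R * tr_var A M * (tau ^- 2) by field; rewrite !gt_eqF.
have -> : c * tr_var A M = 4 * (1 + z ^+ 2) / m1%:R * tr_var A M * ((th / 2) ^- 2).
  by rewrite /c; field; rewrite !gt_eqF.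
apply: ler_wpM2l.
  apply: mulr_ge0; last exact: ltW.
  by apply: divr_ge0; [have := sqr_ge0 z; lra|exact: ltW].
have th2 : 0 < th / 2 by rewrite divr_gt0.
rewrite lef_pV2 ?posrE ?exprn_gt0//.
by rewrite ler_pXn2r// nnegrE ltW.
Qed.

(** Writing [th = sqnorm D], the three terms of [type2_error_bound] have orders
    [(1 + th) / (m2 th)], [1 / m1] and
    [(1 + th) / (m1 th) + (d + th)^2 / (m1 m2 th^2)], all of them controlled by the
    ratios [(d + th) / (m th)] since [1 <= d]. *)
Lemma type2_error_rate (m1 m2 : nat) (z r : R) : (0 < d)%N ->
  (0 < m1)%N -> (0 < m2)%N -> 0 < sqnorm D ->
  (d%:R + sqnorm D) / (m1%:R * sqnorm D) <= r ->
  (d%:R + sqnorm D) / (m2%:R * sqnorm D) <= r ->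
  pr (iid_law P (m1 + m2)) [set X | ~ (z < T_cov m1 X)] <=
  (16 + (16 * 75 + 8) + 128 * (1 + z ^+ 2)) * r + 512 * (1 + z ^+ 2) * r ^+ 2.
Proof.
move=> d0 m10 m20 th0 r1 r2; apply: (le_trans (type2_error_bound z m10 m20 th0)).
have Vle := tr_var_dev_le; have gle := sqnorm_gram_le; have g0 := sqnorm_ge0 G.
set th := sqnorm D in th0 r1 r2 Vle gle *; set V := tr_var A D in Vle *.
set g := sqnorm G in gle g0 *.
have m1_gt0 : 0 < m1%:R :> R by rewrite ltr0n.
have m2_gt0 : 0 < m2%:R :> R by rewrite ltr0n.
have d1 : 1 <= d%:R :> R by rewrite ler1n.
have z2 := sqr_ge0 z.
have one_th k : 0 < k -> (d%:R + th) / (k * th) <= r -> (1 + th) / (k * th) <= r.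
  move=> k0; apply: le_trans; rewrite ler_pM2r ?lerD2r//.
  by rewrite invr_gt0 mulr_gt0.
have q1 := one_th _ m1_gt0 r1; have q2 := one_th _ m2_gt0 r2.
have i1 : m1%:R^-1 <= r.
  apply: le_trans q1.
  have -> : (1 + th) / (m1%:R * th) = m1%:R^-1 + (m1%:R * th)^-1 by field; rewrite !gt_eqF.
  by rewrite lerDl invr_ge0 mulr_ge0// ltW.
have V1 k : 0 < k -> V / (k * th ^+ 2) <= 4 * ((1 + th) / (k * th)).
  move=> k0; have -> : 4 * ((1 + th) / (k * th)) = 4 * (th + th ^+ 2) / (k * th ^+ 2).
    by field; rewrite !gt_eqF.
  by rewrite ler_pM2r// invr_gt0 mulr_gt0// exprn_gt0.
have r0 : 0 <= r by apply: le_trans i1; rewrite invr_ge0 ltW.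
have h1 : 4 * V / (m2%:R * th ^+ 2) <= 16 * r.
  have -> : 4 * V / (m2%:R * th ^+ 2) = 4 * (V / (m2%:R * th ^+ 2)) by rewrite mulrA.
  by have := V1 _ m2_gt0; lra.
have h2 : (16 * 75 + 8) / m1%:R <= (16 * 75 + 8) * r by apply: ler_wpM2l.
have h3 : 16 * (1 + z ^+ 2) / (m1%:R * th ^+ 2) * (2 * V) <= 128 * (1 + z ^+ 2) * r.
  have -> : 16 * (1 + z ^+ 2) / (m1%:R * th ^+ 2) * (2 * V) =
    32 * (1 + z ^+ 2) * (V / (m1%:R * th ^+ 2)) by field; rewrite !gt_eqF.
  have -> : 128 * (1 + z ^+ 2) * r = 32 * (1 + z ^+ 2) * (4 * r) by ring.
  by apply: ler_wpM2l; [lra|have := V1 _ m1_gt0; lra].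
have h4 : 16 * (1 + z ^+ 2) / (m1%:R * th ^+ 2) * (8 * g ^+ 2 / m2%:R) <=
    512 * (1 + z ^+ 2) * r ^+ 2.
  have gg : g ^+ 2 <= (2 * (d%:R + th)) ^+ 2 by rewrite ler_pXn2r// nnegrE; lra.
  apply: (@le_trans _ _ (16 * (1 + z ^+ 2) / (m1%:R * th ^+ 2) *
      (8 * (2 * (d%:R + th)) ^+ 2 / m2%:R))).
    apply: ler_wpM2l; first by apply: divr_ge0; [lra|rewrite mulr_ge0 ?sqr_ge0// ltW].
    by rewrite ler_pM2r ?invr_gt0// ler_pM2l.
  have -> : 16 * (1 + z ^+ 2) / (m1%:R * th ^+ 2) * (8 * (2 * (d%:R + th)) ^+ 2 / m2%:R) =
    512 * (1 + z ^+ 2) * ((d%:R + th) / (m1%:R * th) * ((d%:R + th) / (m2%:R * th))).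
    by field; rewrite !gt_eqF.
  apply: ler_wpM2l; first by lra.
  by rewrite expr2; apply: ler_pM => //; apply: divr_ge0; rewrite ?mulr_ge0 ?ltW//; lra.
rewrite [X in _ + X <= _]mulrDr.
lra.
Qed.

End alternative.

(** * Quantiles of the Gaussian law *)

Section quantiles.
Context {R : realType}.

Let mgt (t : R) : measurable ([set z : R | t < z] : set (measurableTypeR R)).
Proof. by rewrite -set_itvoy; exact: measurable_itv. Qed.

Lemma gaussian_tailE (t : R) : gaussian_tail t = 1 - Phi t.
Proof.
have -> : Phi t = pr (@gaussian1 R) [set` `]-oo, t]] by [].
have mi : measurable ([set` `]-oo, t]] : set (measurableTypeR R)) by exact: measurable_itv.
rewrite -prC//; congr (pr _ _); apply/seteqP; split=> z /=.
  by rewrite in_itv/= leNgt => ->.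
by rewrite in_itv/= => /negP; rewrite -ltNge.
Qed.

Lemma gaussian_tail_nonincreasing (s t : R) : s <= t -> gaussian_tail t <= gaussian_tail s.
Proof.
by move=> st; apply: (le_pr (@gaussian1 R) (mgt t) (mgt s)) => z /=; exact: le_lt_trans.
Qed.

Lemma gaussian_tail01 (t : R) : 0 <= gaussian_tail t <= 1.
Proof. by rewrite pr_ge0 (pr_le1 (@gaussian1 R) (mgt t)). Qed.

Lemma Phi_nondecreasing : {homo @Phi R : s t / s <= t}.
Proof.
move=> s t /gaussian_tail_nonincreasing; rewrite !gaussian_tailE; lra.
Qed.

Lemma Phi_lipschitz (t h : R) : 0 <= h -> Phi (t + h) <= Phi t + h.
Proof. by move=> /(gaussian_tail_lipschitz t); rewrite !gaussian_tailE; lra. Qed.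

Let sqr_mean : has_mean (@gaussian1 R) (fun x : R => x ^+ 2) 1.
Proof.
by have := has_mean_gaussian_moment (R := R) (isT : 2 <= 8)%N; rewrite gaussian_moment2.
Qed.

Lemma gaussian_tail_le (t : R) : 0 < t -> gaussian_tail t <= t ^- 2.
Proof.
move=> t0; have h := has_meanZ (t ^- 2) sqr_mean; rewrite mulr1 in h.
apply: (@pr_le_mean _ _ _ (@gaussian1 R) _ _ _ (mgt t) h) => z.
  by rewrite mulr_ge0 ?invr_ge0 ?sqr_ge0.
move=> /= tz; rewrite mulrC ler_pdivlMr ?exprn_gt0// mul1r.
by rewrite ler_pXn2r// ?nnegrE; lra.
Qed.

Lemma Phi_le (t : R) : 0 < t -> Phi (- t) <= t ^- 2.
Proof.
move=> t0; have h := has_meanZ (t ^- 2) sqr_mean; rewrite mulr1 in h.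
have mi : measurable ([set` `]-oo, - t]] : set (measurableTypeR R)) by exact: measurable_itv.
apply: (@pr_le_mean _ _ _ (@gaussian1 R) _ _ _ mi h) => z.
  by rewrite mulr_ge0 ?invr_ge0 ?sqr_ge0.
rewrite /= in_itv/= => zt; rewrite mulrC ler_pdivlMr ?exprn_gt0// mul1r.
by rewrite -[z ^+ 2]sqrrN ler_pXn2r// ?nnegrE; lra.
Qed.

Let inv_sqr_le (e : R) : 0 < e <= 1 -> (e^-1) ^- 2 <= e.
Proof.
by move=> /andP[e0 e1]; rewrite exprVn invrK expr2 ler_piMl// ltW.
Qed.

(** Chebyshev's inequality on the two tails makes the infimum finite, and the
    Lipschitz bound on [Phi] makes it a solution. *)
Lemma Phi_z_quantile (b : R) : 0 < b < 1 -> Phi (z_quantile b) = b.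
Proof.
move=> /andP[b0 b1]; set S := [set x | b <= Phi x].
have Sne : S !=set0.
  exists (1 - b)^-1; rewrite /S /=.
  have c0 : 0 < 1 - b by lra.
  have := gaussian_tail_le (_ : 0 < (1 - b)^-1); rewrite invr_gt0 => /(_ c0).
  have := @inv_sqr_le (1 - b); rewrite gaussian_tailE => h.
  by have {}h := h ltac:(apply/andP; split; lra); lra.
have Slb : has_lbound S.
  exists (- (b / 2)^-1) => x; rewrite /S /= => bx.
  rewrite leNgt; apply/negP => /ltW/Phi_nondecreasing.
  have c0 : 0 < b / 2 by lra.
  have := Phi_le (_ : 0 < (b / 2)^-1); rewrite invr_gt0 => /(_ c0).
  have := @inv_sqr_le (b / 2) => h.
  by have {}h := h ltac:(apply/andP; split; lra); lra.
have Sinf : has_inf S by [].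
apply/eqP; rewrite eq_le; apply/andP; split; apply/ler_addgt0Pr => e e0.
  have : ~ S (z_quantile b - e).
    move=> Sz; have := ge_inf Slb Sz; rewrite -/(z_quantile b); lra.
  rewrite /S /= => /negP; rewrite -ltNge => lt_b.
  have := Phi_lipschitz (z_quantile b - e) (ltW e0); rewrite subrK; lra.
have [x Sx xz] := inf_adherent e0 Sinf.
apply: (le_trans Sx); apply: (le_trans (Phi_nondecreasing (ltW xz))).
by apply: Phi_lipschitz; exact: ltW.
Qed.

End quantiles.

(** * Level and power in the limit *)

Section level.
Context {R : realType}.

Let std_normal_root (d : nat) : exists2 A : 'M[R]_d, A *m A^T = 1%:M &
  forall B, measurable B -> std_normal d B = pushforward (std_normal d) (lin_tuple A) B.
Proof. exact: std_normal_is_normal0. Qed.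

(** Given the second half [Y], the statistic is asymptotically Gaussian as soon as
    the direction [cov_mean Y] is nonzero, at a rate that depends neither on [Y] nor
    on [d]. If [cov_mean Y] vanishes, so does the Student statistic of the traces of
    the [cov_dev (tnth Y j)]; by the same central limit theorem, the latter is within
    [f] of zero with a probability of order [f]. *)
Lemma null_level (t e : R) : 0 < e -> exists n0 : nat, forall d m1 m2 : nat,
  (0 < d)%N -> (n0 <= m1)%N -> (n0 <= m2)%N ->
  `|pr (iid_law (@std_normal R d) (m1 + m2)) [set X | t < T_cov m1 X] - gaussian_tail t|
  <= e.
Proof.
move=> e0; pose f := e / 8; have f0 : 0 < f by rewrite /f; lra.
have C0 : 0 <= 75 :> R by [].
have [n1 H1] := student_clt t C0 f0.
have [n2 H2] := student_clt (- f) C0 f0.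
have [n3 H3] := student_clt f C0 f0.
exists (maxn n1 (maxn n2 n3)) => d m1 m2 d0.
rewrite !geq_max => /and3P[m11 _ _] /and3P[_ m22 m23].
have [A A1 PA] := std_normal_root d.
have mS : measurable [set X : (m1 + m2).-tuple (Rvec R d) | t < T_cov m1 X].
  by apply: measurable_lt_set => //; exact: measurable_T_cov.
have [mSY SY] := pr_iid_cat (@std_normal R d) mS.
have tr_statE M (x : Rvec R d) : tr_stat 1%:M M x = \tr (cov_dev x *m M).
  by rewrite /tr_stat subrr mul0mx mxtrace0 subr0.
have pos (M : 'M[R]_d) : M^T = M -> M != 0 -> 0 < tr_var A M.
  exact: (tr_var_gt0 A1 (posdefmx_scalar d ltr01)).
(* [trT] vanishes with [cov_mean Y], see [close] below *)
have one_neq0 : (1%:M : 'M[R]_d) != 0.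
  apply/eqP => /matrixP /(_ (Ordinal d0) (Ordinal d0)).
  by rewrite !mxE eqxx; exact/eqP/oner_neq0.
have v1 := pos _ (trmx1 _ _) one_neq0.
have [w1 hw1 w1le] := tr_stat_moment4 A1 PA 1%:M.
pose trT (Y : m2.-tuple (Rvec R d)) := tstat (fun j => tr_stat 1%:M 1%:M (tnth Y j)).
have mtrT : measurable_fun [set: m2.-tuple (Rvec R d)] trT.
  apply: (measurable_tstat (y := tr_stat 1%:M 1%:M)).
  exact: measurable_tr_stat.
have left := H2 _ _ _ _ _ _ _ m22 v1 (has_mean_tr_stat A1 PA 1%:M)
  (has_mean_tr_stat_sqr A1 PA 1%:M) hw1 w1le.
have right := H3 _ _ _ _ _ _ _ m23 v1 (has_mean_tr_stat A1 PA 1%:M)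
  (has_mean_tr_stat_sqr A1 PA 1%:M) hw1 w1le.
have ml : measurable [set Y | - f < trT Y] by exact: measurable_lt_set.
have mr : measurable [set Y | f < trT Y] by exact: measurable_lt_set.
have near0 := has_meanB (has_mean_indic (iid_law (std_normal d) m2) ml)
  (has_mean_indic (iid_law (std_normal d) m2) mr).
have near0_le : pr (iid_law (std_normal d) m2) [set Y | - f < trT Y] -
    pr (iid_law (std_normal d) m2) [set Y | f < trT Y] <= 4 * f.
  have f2 : 0 <= 2 * f by lra.
  have := gaussian_tail_lipschitz (- f) f2.
  have -> : - f + 2 * f = f by ring.
  move: left right; rewrite !ler_norml => /andP[_ l] /andP[r _].
  rewrite -/(trT _) in l r; lra.
have close Y : `|pr (iid_law (std_normal d) m1)
      [set X : m1.-tuple (Rvec R d) | t < T_cov m1 (cat_tuple X Y)] - gaussian_tail t| <=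
    f + (\1_[set Y | - f < trT Y] Y - \1_[set Y | f < trT Y] Y).
  rewrite !indic_bool; set M := cov_mean Y.
  have [M0|M0] := eqVneq M 0.
    have -> : trT Y = 0.
      rewrite /trT /tstat (_ : emean _ = 0) ?mulr0 ?mul0r//.
      under [X in emean X]eq_fun do rewrite tr_statE.
      by rewrite -mxtrace_cov_mean -/M M0 mulmx0 mxtrace0.
    have -> : - f < 0 by lra.
    rewrite (ltNge f) (ltW f0) /= subr0.
    have /andP[? ?] := gaussian_tail01 t.
    have := pr_le1 (iid_law (std_normal d) m1) (mSY Y).
    have := pr_ge0 (iid_law (std_normal d) m1)
      [set X : m1.-tuple (Rvec R d) | t < T_cov m1 (cat_tuple X Y)].
    by rewrite ler_norml => ? ?; apply/andP; split; lra.
  have ind0 : 0 <= (if - f < trT Y then 1 else 0) - (if f < trT Y then 1 else 0) :> R.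
    by case: (ltrP f) => fT; [have -> : - f < trT Y by lra|rewrite subr0; case: ifP].
  have Ms : M^T = M by exact: cov_mean_sym.
  have [w hw wle] := tr_stat_moment4 A1 PA M.
  have := H1 _ _ _ _ _ _ _ m11 (pos _ Ms M0) (has_mean_tr_stat A1 PA M)
    (has_mean_tr_stat_sqr A1 PA M) hw wle.
  have -> : [set X : m1.-tuple (Rvec R d) | t < tstat (fun i => tr_stat 1%:M M (tnth X i))] =
      [set X : m1.-tuple (Rvec R d) | t < T_cov m1 (cat_tuple X Y)].
    have statE (X : m1.-tuple (Rvec R d)) : (fun i => tr_stat 1%:M M (tnth X i)) =
        (fun i => \tr (cov_dev (tnth X i) *m M)).
      by apply/funext => i; exact: tr_statE.
    by apply/seteqP; split=> X /=; rewrite T_cov_cat statE.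
  by move=> h; apply: (le_trans h); rewrite lerDl.
have lower := has_meanB (has_mean_cst (iid_law (std_normal d) m2) (gaussian_tail t - f)) near0.
have upper := has_meanD (has_mean_cst (iid_law (std_normal d) m2) (gaussian_tail t + f)) near0.
have ge_lower := has_mean_le lower SY.
have le_upper := has_mean_le SY upper.
have eE : e = 8 * f by rewrite /f; field.
rewrite ler_norml; apply/andP; split.
  suff /ge_lower : forall Y, gaussian_tail t - f -
      (\1_[set Y | - f < trT Y] Y - \1_[set Y | f < trT Y] Y) <=
    pr (iid_law (std_normal d) m1) [set X : m1.-tuple (Rvec R d) | t < T_cov m1 (cat_tuple X Y)].
    by rewrite eE; lra.
  by move=> Y; have := close Y; rewrite ler_norml => /andP[+ _]; lra.
suff /le_upper : forall Y,
    pr (iid_law (std_normal d) m1) [set X : m1.-tuple (Rvec R d) | t < T_cov m1 (cat_tuple X Y)] <=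
    gaussian_tail t + f + (\1_[set Y | - f < trT Y] Y - \1_[set Y | f < trT Y] Y).
  by rewrite eE; lra.
by move=> Y; have := close Y; rewrite ler_norml => /andP[_]; lra.
Qed.

End level.

Section asymptotics.
Context {R : realType}.

Lemma null_level_subn (t e : R) : 0 < e -> exists n0 : nat, forall d n m : nat,
  (0 < d)%N -> (m <= n)%N -> (n0 <= m)%N -> (n0 <= n - m)%N ->
  `|pr (iid_law (@std_normal R d) n) [set X | t < T_cov m X] - gaussian_tail t| <= e.
Proof.
move=> e0; have [n0 H] := null_level t e0; exists n0 => d n m d0 mn.
move: (subnKC mn); move: (n - m)%N => k <- m0 k0; exact: H.
Qed.

Lemma type2_error_rate_subn (d n m : nat) (P : probability (Rvec R d) R)
    (eps z r : R) : (0 < d)%N -> (0 < m < n)%N -> 0 < eps -> @Qcov R d eps P ->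
  (forall th, eps ^+ 2 <= th -> (d%:R + th) / (m%:R * th) <= r /\
    (d%:R + th) / ((n - m)%:R * th) <= r) ->
  pr (iid_law P n) [set X | ~ (z < T_cov m X)] <=
  (16 + (16 * 75 + 8) + 128 * (1 + z ^+ 2)) * r + 512 * (1 + z ^+ 2) * r ^+ 2.
Proof.
move=> d0 /andP[m0 mn] eps0 [Sigma [pos [A AE PE] epsle]].
have := subnKC (ltnW mn); move: mn; rewrite -subn_gt0; move: (n - m)%N => k k0 <-.
have th_ge : eps ^+ 2 <= sqnorm (Sigma - 1%:M).
  rewrite -frobenius_normE ler_pXn2r// nnegrE; first exact: ltW.
  exact: sqrtr_ge0.
move=> /(_ _ th_ge)[r1 r2].
apply: (type2_error_rate AE pos PE z d0 m0 k0 _ r1 r2).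
by apply: lt_le_trans th_ge; rewrite exprn_gt0.
Qed.

Lemma measurable_lin_tuple_law (d : nat) (A : 'M[R]_d) :
  exists P : probability (Rvec R d) R,
    forall B, measurable B -> P B = pushforward (std_normal d) (lin_tuple A) B.
Proof.
pose f : {mfun (Rvec R d) >-> (Rvec R d)} :=
  HB.pack (lin_tuple A) (isMeasurableFun.Build _ _ _ _ _ (measurable_lin_tuple A)).
by exists (distribution (std_normal d) f) => B mB.
Qed.

(** The supremum over an empty alternative would be [-oo]. *)
Lemma Qcov_nonempty (d : nat) (eps : R) : (0 < d)%N -> @Qcov R d eps !=set0.
Proof.
move=> d0; pose c := 1 + `|eps|; have c0 : 0 < c by rewrite ltr_pwDl.
pose A : 'M[R]_d := (Num.sqrt (1 + c))%:M.
have AE : A *m A^T = (1 + c)%:M.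
  rewrite /A tr_scalar_mx -scalar_mxM -expr2 sqr_sqrtr//; lra.
have [P PE] := measurable_lin_tuple_law A.
exists P, (1 + c)%:M; split; last 1 first.
- have -> : (1 + c)%:M - 1%:M = c%:M :> 'M[R]_d by rewrite raddfD /= addrC addKr.
  apply: le_trans (ler_norm _) _; rewrite -sqrtr_sqr ler_wsqrtr//.
  rewrite -real_normK ?num_real//.
  apply: (@le_trans _ _ (c ^+ 2)).
    by rewrite ler_pXn2r ?nnegrE ?(ltW c0)// lerDr.
  rewrite (bigD1 (Ordinal d0))//= (bigD1 (Ordinal d0))//= !mxE eqxx mulr1n -addrA lerDl.
  by rewrite addr_ge0// sumr_ge0// => i _; [exact: sqr_ge0|apply: sumr_ge0 => j _; exact: sqr_ge0].
- by apply: posdefmx_scalar; lra.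
- by exists A.
Qed.

Lemma le_limn_esup (u v : (\bar R)^nat) :
  (forall n, (u n <= v n)%E) -> (limn_esup u <= limn_esup v)%E.
Proof.
move=> uv; rewrite !limn_esup_lim; apply: lee_lim.
- exact: is_cvg_esups.
- exact: is_cvg_esups.
- apply: nearW => n; apply: ge_ereal_sup => _ [k nk <-].
  by apply: le_trans (uv k) _; apply: ereal_sup_ubound; exists k.
Qed.

End asymptotics.

Unset Implicit Arguments.
Set Strict Implicit.

Theorem proposition3p3 (R : realType) (alpha : R) (halpha : 0 < alpha < 1)
    (d : nat -> nat) (hd : forall n, (0 < d n)%N)
    (m1 : nat -> nat) (hm1 : forall n, (2 <= n)%N -> (0 < m1 n < n)%N)
    (klow kupp : R) (hk : [/\ 0 < klow, klow <= kupp & kupp < 1])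
    (hratio : forall n, (2 <= n)%N -> klow <= (m1 n)%:R / n%:R <= kupp)
    (K : nat -> R) (hKpos : forall n, 0 < K n)
    (hKmono : {homo K : m n / (m <= n)%N >-> m <= n})
    (hKlim : K n @[n --> \oo] --> +oo)
    (eps : nat -> R)
    (heps : forall n, (0 < n)%N -> K n * Num.sqrt ((d n)%:R / n%:R) <= eps n) :
  [/\ 'E_(iid_law (std_normal (d n)) n)[phi_cov (m1 n) alpha]%E @[n --> \oo]
        --> alpha%:E,
      ereal_sup [set 'E_(iid_law P n)[(fun X => 1 - phi_cov (m1 n) alpha X)%R]%E
                | P in @Qcov R (d n) (eps n)] @[n --> \oo] --> 0%E
    & forall a : R, 0 <= a <= 1 ->
        (limn_esup (fun n => iid_law (std_normal (d n)) n
           [set X | (p_cov (m1 n) X <= a)%R]) <= a%:E)%E].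
Proof.
case: hk => klow0 _ kupp1.
pose c := Num.min klow (1 - kupp).
have c0 : 0 < c by rewrite lt_min klow0 subr_gt0.
have sizes n : (2 <= n)%N -> c * n%:R <= (m1 n)%:R /\ c * n%:R <= (n - m1 n)%:R.
  move=> n2; have n0 : 0 < n%:R :> R by rewrite ltr0n (leq_trans _ n2).
  have /andP[_ /ltnW m1n] := hm1 n n2.
  have /andP[] := hratio n n2; rewrite ler_pdivlMr// ler_pdivrMr// => lo up.
  split.
    by apply: le_trans lo; rewrite ler_pM2r// ge_min lexx.
  rewrite natrB//; apply: (@le_trans _ _ ((1 - kupp) * n%:R)); last by lra.
  by rewrite ler_pM2r// ge_min lexx orbT.
have large (n0 : nat) : \forall n \near \oo,
    [/\ (2 <= n)%N, (n0 <= m1 n)%N & (n0 <= n - m1 n)%N].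
  exists (maxn 2 (Num.truncn (n0%:R / c)).+1) => // n /=; rewrite geq_max => /andP[n2 nN].
  have : n0%:R <= c * n%:R :> R.
    rewrite mulrC -ler_pdivrMr//; apply: ltW; apply: lt_le_trans (truncnS_gt _) _.
    by rewrite ler_nat.
  have [s1 s2] := sizes n n2.
  by move=> h; split=> //; rewrite -(ler_nat R); [exact: le_trans s1|exact: le_trans s2].
pose reject (t : R) n : R :=
  pr (iid_law (@std_normal R (d n)) n) [set X | t < T_cov (m1 n) X].
have mreject (t : R) n : measurable [set X : n.-tuple (Rvec R (d n)) | t < T_cov (m1 n) X].
  by apply: measurable_lt_set => //; exact: measurable_T_cov.
have level (a : R) : 0 < a < 1 -> reject (z_quantile (1 - a)) n @[n --> \oo] --> a.
  move=> /andP[a0 a1]; apply/cvgrPdist_le => e e0.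
  have [n0 H] := null_level_subn (z_quantile (1 - a)) e0.
  near=> n.
  have [n2 nm1 nm2] : [/\ (2 <= n)%N, (n0 <= m1 n)%N & (n0 <= n - m1 n)%N].
    by near: n; exact: large.
  have /andP[_ /ltnW m1n] := hm1 n n2.
  have := H (d n) n (m1 n) (hd n) m1n nm1 nm2.
  rewrite gaussian_tailE Phi_z_quantile; last by apply/andP; split; lra.
  by rewrite distrC; congr (`|_ - _| <= e); lra.
split.
- rewrite (_ : (fun n => _) = EFin \o reject (z_quantile (1 - alpha))); last first.
    apply/funext => n; apply: expectation_has_mean.
    apply: has_mean_ext (has_mean_indic _ (mreject _ n)) => X.
    by rewrite indic_bool /phi_cov; case: ifP.
  by apply: cvg_EFin; [exact: nearW|exact: level].
- set z := z_quantile (1 - alpha).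
  (* [r n] bounds the ratios (d + th) / (m th) for both halves as soon as
     th >= K^2 d / n *)
  pose r n : R := c^-1 * ((K n)^-1 ^+ 2 + n%:R^-1).
  pose beta n : R := (16 + (16 * 75 + 8) + 128 * (1 + z ^+ 2)) * r n +
    512 * (1 + z ^+ 2) * (r n * r n).
  have r0 : r n @[n --> \oo] --> (0 : R).
    have Kinv : (K n)^-1 @[n --> \oo] --> (0 : R).
      by apply/(gtr0_cvgV0 (f := K)) => //; exact: nearW.
    have ninv : (n%:R : R)^-1 @[n --> \oo] --> (0 : R).
      apply/(gtr0_cvgV0 (f := fun n : nat => n%:R : R)); last exact: cvgr_idn.
      by near do rewrite ltr0n; exists 1%N.
    rewrite -[X in _ --> X](mulr0 c^-1); apply: cvgM; first exact: cvg_cst.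
    rewrite -[X in _ --> X](addr0 0); apply: cvgD => //.
    rewrite -[X in _ --> X](mulr0 0); under eq_fun do rewrite expr2.
    exact: cvgM.
  have beta0 : beta n @[n --> \oo] --> (0 : R).
    rewrite -[X in _ --> X](addr0 0); apply: cvgD.
      by rewrite -[X in _ --> X](mulr0 (16 + (16 * 75 + 8) + 128 * (1 + z ^+ 2)));
        apply: cvgM; [exact: cvg_cst|].
    rewrite -[X in _ --> X](mulr0 (512 * (1 + z ^+ 2))); apply: cvgM; first exact: cvg_cst.
    by rewrite -[X in _ --> X](mulr0 0); exact: cvgM.
  have accept n (P : probability (Rvec R (d n)) R) :
      ('E_(iid_law P n)[(fun X => 1 - phi_cov (m1 n) alpha X)%R] =
       (pr (iid_law P n) [set X | ~ (z < T_cov (m1 n) X)])%:E)%E.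
    have mS : measurable [set X : n.-tuple (Rvec R (d n)) | ~ (z < T_cov (m1 n) X)].
      exact: (measurableC (mreject z n)).
    apply: expectation_has_mean; apply: has_mean_ext (has_mean_indic _ mS) => X.
    rewrite /phi_cov -/z indicE.
    case: (ltrP z (T_cov (m1 n) X)) => zT; last by
      rewrite mem_set ?subr0//= ltNge zT.
    by rewrite memNset ?subrr//= zT; apply.
  apply: (@squeeze_cvge _ _ _ _ (cst 0%E) _ (EFin \o beta)).
  + near=> n; apply/andP; split.
      have [P QP] := Qcov_nonempty (eps n) (hd n).
      apply: (@le_trans _ _ ('E_(iid_law P n)[(fun X => 1 - phi_cov (m1 n) alpha X)%R])%E).
        by rewrite accept lee_fin pr_ge0.
      by apply: ereal_sup_ubound; exists P.
    apply: ge_ereal_sup => _ [P QP <-]; rewrite accept lee_fin /beta -expr2.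
    have n2 : (2 <= n)%N by near: n; exists 2%N.
    have n_gt0 : 0 < n%:R :> R by rewrite ltr0n (leq_trans _ n2).
    have d_gt0 : 0 < (d n)%:R :> R by rewrite ltr0n hd.
    have K0 := hKpos n; have [s1 s2] := sizes n n2.
    have cn : 0 < c * n%:R by rewrite mulr_gt0.
    have sd0 : 0 < K n * Num.sqrt ((d n)%:R / n%:R).
      by rewrite mulr_gt0// sqrtr_gt0 divr_gt0.
    have epsn := heps n (leq_trans (isT : (0 < 2)%N) n2).
    have eps0 : 0 < eps n by exact: lt_le_trans epsn.
    apply: (type2_error_rate_subn z (hd n) (hm1 n n2) eps0 QP) => th th_ge.
    have th_low : K n ^+ 2 * ((d n)%:R / n%:R) <= th.
      apply: le_trans th_ge.
      have -> : K n ^+ 2 * ((d n)%:R / n%:R) = (K n * Num.sqrt ((d n)%:R / n%:R)) ^+ 2.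
        by rewrite exprMn sqr_sqrtr// divr_ge0 ?ler0n.
      by rewrite ler_pXn2r// nnegrE ltW.
    have th0 : 0 < th.
      by apply: lt_le_trans th_low; rewrite mulr_gt0 ?exprn_gt0// divr_gt0.
    have main (m : R) : c * n%:R <= m -> ((d n)%:R + th) / (m * th) <= r n.
      move=> cm; have m0 : 0 < m by exact: lt_le_trans cm.
      apply: (@le_trans _ _ (((d n)%:R + th) / (c * n%:R * th))).
        apply: ler_wpM2l; first by rewrite addr_ge0// ltW.
        by rewrite lef_pV2 ?posrE ?mulr_gt0// ler_pM2r.
      have -> : ((d n)%:R + th) / (c * n%:R * th) =
          c^-1 * ((d n)%:R / n%:R / th + n%:R^-1) by field; rewrite !gt_eqF.
      rewrite /r ler_pM2l ?invr_gt0// lerD2r ler_pdivrMr// exprVn.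
      by rewrite ler_pdivlMl ?exprn_gt0.
    by split; apply: main.
  + exact: cvg_cst.
  + by apply: cvg_EFin; [exact: nearW|exact: beta0].
- (* for [a < b], a p-value at most [a] means a rejection at level [b] *)
  move=> a /andP[a0 a1].
  have mp n : measurable [set X : n.-tuple (Rvec R (d n)) | (p_cov (m1 n) X <= a)%R].
    have mPhi : measurable_fun [set: R] (@Phi R).
      by apply: nondecreasing_measurable => //; exact: Phi_nondecreasing.
    have mpn : measurable_fun [set: n.-tuple (Rvec R (d n))] (@p_cov R n (m1 n) (d n)).
      apply: measurable_funB => //; apply: measurableT_comp => //.
      exact: measurable_T_cov.
    have := measurable_fun_ler mpn (@measurable_cst _ _ _ _ setT a).
    by move=> /(_ measurableT [set true] I); rewrite setTI.
  have mono (b : R) : a < b -> b < 1 -> (limn_esup (fun n => iid_law (@std_normal R (d n)) n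
      [set X | (p_cov (m1 n) X <= a)%R]) <= b%:E)%E.
    move=> ab b1; have b01 : 0 < b < 1 by apply/andP; split; lra.
    have cvgb : (reject (z_quantile (1 - b)) n)%:E @[n --> \oo] --> b%:E.
      by apply: cvg_EFin; [exact: nearW|exact: level].
    rewrite -(cvg_limn_einf_sup cvgb).2; apply: le_limn_esup => n.
    rewrite /reject -prE; last exact: mreject.
    apply: le_measure; rewrite ?inE; [exact: mp|exact: mreject|].
    move=> X /=; rewrite /p_cov => pa; rewrite ltNge; apply/negP => /Phi_nondecreasing.
    rewrite Phi_z_quantile; [lra|by apply/andP; split; lra].
  have [a_lt1|a_ge1] := ltP a 1.
    apply/lee_addgt0Pr => e e0; pose b := Num.min (a + e) ((a + 1) / 2).
    apply: (@le_trans _ _ b%:E).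
      by apply: mono; rewrite /b ?lt_min ?gt_min; [apply/andP; split; lra|apply/orP; right; lra].
    by rewrite -EFinD lee_fin ge_min lexx.
  apply: (@le_trans _ _ (limn_esup (fun=> 1%E : \bar R))).
    by apply: le_limn_esup => n; exact: probability_le1 (mp n).
  by rewrite (cvg_limn_einf_sup (cvg_cst _)).2 lee_fin.
Unshelve. all: by end_near.
Qed.
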